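(* Let $p,q$ be prime numbers with $q-p=2$, let $K=\mathbf{Q}(\sqrt{-1})$, and for $\sigma\in\{1,-1\}$ let $E_\sigma$ be the elliptic curve $y^2=x(x+\sigma p)(x+\sigma q)$. Let $E=E_\sigma$ with either choice of sign $\sigma=\pm1$. Then: (a) If $p\equiv 5 \pmod 8$, then $\operatorname{rank} E(K)=0$ and $E(K)\cong \mathbf{Z}/2\mathbf{Z}\oplus \mathbf{Z}/2\mathbf{Z}$. (b) If $p\equiv 3\pmod 8$ and there are integers $a,b,c\in\mathbf{Z}$ and signs $\epsilon,\delta\in\{1,-1\}$ such that $q=a^2+b^2$ and $(a+\epsilon)^2+(b+\delta)^2=c^2$, then $\operatorname{rank} E(K)=1$ and $E(K)\cong \mathbf{Z}/2\mathbf{Z}\oplus \mathbf{Z}/2\mathbf{Z}\oplus\mathbf{Z}$. (c) In all cases (for every pair of primes $p,q$ with $q-p=2$), $\operatorname{rank} E(K)\le 3$. (d) If $p\equiv 3\pmod 8$ and there are integers $a,b,c\in\mathbf{Z}$ and signs $\epsilon,\delta\in\{1,-1\}$ such that $q=a^2+b^2$ and $(a+\epsilon)^2+(b+\delta)^2=c^2$, then for the curve $E_+=E_{1}: y^2=x(x+p)(x+q)$ one has $\operatorname{rank} E_+(\mathbf{Q})=1$ and $E_+(\mathbf{Q})\cong \mathbf{Z}/2\mathbf{Z}\oplus \mathbf{Z}/2\mathbf{Z}\oplus\mathbf{Z}$.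
   Context: For a number field $F$ and an elliptic curve $E$ defined over $F$, $E(F)$ is the Mordell-Weil group of $F$-rational points (including the point at infinity), a finitely generated abelian group, $E(F)\cong E(F)_{tors}\oplus\mathbf{Z}^r$ with $E(F)_{tors}$ the torsion subgroup, and $\operatorname{rank}E(F)=r$. *)

(* Defs.v *)
From HB Require Import structures.
From mathcomp Require Import all_boot all_order all_algebra.
From mathcomp Require Import boolp complex ring.

Set Implicit Arguments.
Unset Strict Implicit.
Unset Printing Implicit Defensive.

Import GRing.Theory.
Local Open Scope ring_scope.

(* Elliptic curves y^2 = x^3 + a2 x^2 + a4 x + a6. The standard discriminant
   carries the factor 16, so that its non-vanishing excludes characteristic 2. *)

Definition wdisc (F : pzRingType) (a2 a4 a6 : F) : F :=
  16%:R * (a2 ^+ 2 * a4 ^+ 2 - 4%:R * a4 ^+ 3 - 4%:R * a2 ^+ 3 * a6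
           + 18%:R * a2 * a4 * a6 - 27%:R * a6 ^+ 2).

Record ellCurve (F : fieldType) := EllCurve {
  ec2 : F;
  ec4 : F;
  ec6 : F;
  ec_disc : wdisc ec2 ec4 ec6 != 0
}.

Definition wcubic (F : fieldType) (E : ellCurve F) (x : F) : F :=
  x ^+ 3 + ec2 E * x ^+ 2 + ec4 E * x + ec6 E.

(* [None] is the point at infinity. *)
Definition on_curve (F : fieldType) (E : ellCurve F) : pred (option (F * F)) :=
  fun P => if P is Some (x, y) then y ^+ 2 == wcubic E x else true.

(* With l the slope of the chord or tangent, the three intersection abscissae
   sum to l^2 - a2; the sum is the reflection of the third point. When x1 = x2
   and y1 <> - y2, two points of the curve are equal and y1 <> 0. *)
Definition addpt (F : fieldType) (E : ellCurve F) (P Q : option (F * F)) :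
    option (F * F) :=
  match P, Q with
  | None, _ => Q
  | _, None => P
  | Some (x1, y1), Some (x2, y2) =>
    if (x1 == x2) && (y1 == - y2) then None else
    let l := if x1 == x2
             then (3%:R * x1 ^+ 2 + 2%:R * ec2 E * x1 + ec4 E) / (2%:R * y1)
             else (y2 - y1) / (x2 - x1) in
    let x3 := l ^+ 2 - ec2 E - x1 - x2 in
    Some (x3, - (y1 + l * (x3 - x1)))
  end.

Definition opppt (F : fieldType) (P : option (F * F)) : option (F * F) :=
  if P is Some (x, y) then Some (x, - y) else None.

Section Coordinates.
Variables (F : fieldType) (E : ellCurve F).
Implicit Types P Q : option (F * F).

Lemma ec_two : 2%:R != 0 :> F.
Proof.
apply/eqP => h; have := ec_disc E; rewrite /wdisc.
have -> : 16%:R = 2%:R * 8%:R :> F by ring.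
by rewrite h !mul0r eqxx.
Qed.

Lemma ec_smooth x : wcubic E x = 0 ->
  3%:R * x ^+ 2 + 2%:R * ec2 E * x + ec4 E != 0.
Proof.
rewrite /wcubic => h0; apply/eqP => h1; have := ec_disc E.
have h4 : ec4 E = - (3%:R * x ^+ 2 + 2%:R * ec2 E * x).
  by apply/eqP; rewrite -subr_eq0 opprK addrC h1.
have h6 : ec6 E = - (x ^+ 3 + ec2 E * x ^+ 2 + ec4 E * x).
  by apply/eqP; rewrite -subr_eq0 opprK addrC h0.
suff -> : wdisc (ec2 E) (ec4 E) (ec6 E) = 0 by rewrite eqxx.
by rewrite h6 h4 /wdisc; ring.
Qed.

(* The two equations satisfied by the slope of the chord or tangent. *)
Variant add_spec P Q : option (F * F) -> Prop :=
| AddNone1 of P = None : add_spec P Q Q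
| AddNone2 of Q = None : add_spec P Q P
| AddOpp x y of P = Some (x, y) & Q = Some (x, - y) : add_spec P Q None
| AddAff x1 y1 x2 y2 l x3 y3 of P = Some (x1, y1) & Q = Some (x2, y2)
   & (x1 != x2) || ((y1 == y2) && (y1 != 0))
   & y1 - y2 = l * (x1 - x2)
   & l * (y1 + y2) = x1 ^+ 2 + x1 * x2 + x2 ^+ 2 + ec2 E * (x1 + x2) + ec4 E
   & x3 = l ^+ 2 - ec2 E - x1 - x2 & y3 = - (y1 + l * (x3 - x1)) :
   add_spec P Q (Some (x3, y3)).

Lemma addptP P Q : on_curve E P -> on_curve E Q -> add_spec P Q (addpt E P Q).
Proof.
case: P => [[x1 y1]|]; last by move=> _ _; apply: AddNone1.
case: Q => [[x2 y2]|]; last by move=> _ _; apply: AddNone2.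
rewrite /= => /eqP h1 /eqP h2.
case: (eqVneq x1 x2) => [e|ne] /=.
  subst x2; case: (eqVneq y1 (- y2)) => [->|ne].
    by apply: (@AddOpp _ _ x1 (- y2)); rewrite ?opprK.
  have ey : y1 = y2.
    have : (y1 - y2) * (y1 + y2) = 0 by rewrite -subr_sqr h1 h2 subrr.
    by move/eqP; rewrite mulf_eq0 subr_eq0 addr_eq0 (negPf ne) orbF => /eqP.
  subst y2.
  have y0 : y1 != 0 by apply: contra ne => /eqP ->; rewrite oppr0.
  apply: (AddAff (erefl _) (erefl _)) (erefl _) (erefl _).
  - by rewrite !eqxx y0.
  - by rewrite !subrr mulr0.
  - by field; rewrite y0 ec_two.
have d0 : x2 - x1 != 0 by rewrite subr_eq0 eq_sym.
apply: (AddAff (erefl _) (erefl _)) (erefl _) (erefl _).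
- by rewrite ne.
- by field.
- have -> : (y2 - y1) / (x2 - x1) * (y1 + y2) =
            (y2 ^+ 2 - y1 ^+ 2) / (x2 - x1) by field.
  by rewrite h1 h2 /wcubic; field.
Qed.

Lemma third_root x1 y1 x2 y2 l :
  y1 ^+ 2 = wcubic E x1 -> y1 - y2 = l * (x1 - x2) ->
  l * (y1 + y2) = x1 ^+ 2 + x1 * x2 + x2 ^+ 2 + ec2 E * (x1 + x2) + ec4 E ->
  let x3 := l ^+ 2 - ec2 E - x1 - x2 in
  (l * x3 + (y1 - l * x1)) ^+ 2 = wcubic E x3.
Proof.
move=> h1 h2 h3 x3.
have e6 : ec6 E = y1 ^+ 2 - (x1 ^+ 3 + ec2 E * x1 ^+ 2 + ec4 E * x1).
  by rewrite h1 /wcubic; ring.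
have e2 : y2 = y1 - l * (x1 - x2) by rewrite -h2; ring.
have e4 : ec4 E = l * (y1 + y2) -
                  (x1 ^+ 2 + x1 * x2 + x2 ^+ 2 + ec2 E * (x1 + x2)).
  by rewrite h3; ring.
by rewrite /wcubic e6 e4 e2 /x3; ring.
Qed.

Lemma addpt_on P Q :
  on_curve E P -> on_curve E Q -> on_curve E (addpt E P Q).
Proof.
move=> hP hQ; case: (addptP hP hQ) => //= x1 y1 x2 y2 l x3 y3 eP eQ _ h1 h2.
move=> e3 ->; rewrite eP /= in hP.
have /= := third_root (eqP hP) h1 h2; rewrite -e3 => <-.
by apply/eqP; ring.
Qed.

Lemma opppt_on P : on_curve E P -> on_curve E (opppt P).
Proof. by case: P => [[x y]|] //=; rewrite sqrrN. Qed.

Lemma addptC P Q : on_curve E P -> on_curve E Q -> addpt E P Q = addpt E Q P.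
Proof.
case: P => [[x1 y1]|]; case: Q => [[x2 y2]|] //= /eqP h1 /eqP h2.
case: (eqVneq x1 x2) => [e|ne] /=.
  subst x2; have -> : (y2 == - y1) = (y1 == - y2).
    by rewrite -!addr_eq0 addrC.
  case: eqVneq => [//|ne].
  have -> // : y1 = y2.
    have : (y1 - y2) * (y1 + y2) = 0 by rewrite -subr_sqr h1 h2 subrr.
    move/eqP; rewrite mulf_eq0 subr_eq0 addr_eq0 => /orP[/eqP //|/eqP e].
    by rewrite e eqxx in ne.
have d0 : x2 - x1 != 0 by rewrite subr_eq0 eq_sym.
have d1 : x1 - x2 != 0 by rewrite subr_eq0.
have -> : (y1 - y2) / (x1 - x2) = (y2 - y1) / (x2 - x1) by field; rewrite d0 d1.
by congr (Some (_, _)); field.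
Qed.

Lemma addptN P : addpt E (opppt P) P = None.
Proof. by case: P => [[x y]|] //=; rewrite !eqxx. Qed.

End Coordinates.

(* Associativity is proved through the ideals of the coordinate ring
   F[x, y] / (y^2 - f), whose element u + v y is encoded as the pair (u, v). *)

Definition coordring (F : fieldType) (f : {poly F}) : Type :=
  ({poly F} * {poly F})%type.

Section CoordRing.
Variables (F : fieldType) (f : {poly F}).
Local Notation R := (coordring f).
Local Notation pR := ({poly F} * {poly F})%type.

HB.instance Definition _ := GRing.Zmodule.copy R pR.

Definition cr_one : R := (1, 0).
Definition cr_mul (g h : R) : R :=
  (g.1 * h.1 + f * g.2 * h.2, g.1 * h.2 + g.2 * h.1).

Lemma cr_mulA : associative cr_mul.
Proof. by move=> [a b] [c d] [e k]; congr (_, _) => /=; ring. Qed.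
Lemma cr_mulC : commutative cr_mul.
Proof. by move=> [a b] [c d]; congr (_, _) => /=; ring. Qed.
Lemma cr_mul1 : left_id cr_one cr_mul.
Proof. by move=> [a b]; congr (_, _) => /=; ring. Qed.
Lemma cr_mulD : left_distributive cr_mul +%R.
Proof. by move=> [a b] [c d] [e k]; congr (_, _) => /=; ring. Qed.
Lemma cr_oner0 : cr_one != 0.
Proof. by rewrite /eq_op /= oner_eq0. Qed.

HB.instance Definition _ :=
  GRing.Zmodule_isComNzRing.Build R cr_mulA cr_mulC cr_mul1 cr_mulD cr_oner0.

Definition cr_norm (g : R) : {poly F} := g.1 ^+ 2 - f * g.2 ^+ 2.
Definition crC (u : {poly F}) : R := (u, 0).
Definition crY : R := (0, 1).

Lemma cr_normM : {morph cr_norm : g h / g * h}.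
Proof. by move=> [a b] [c d]; rewrite /cr_norm /=; ring. Qed.

Lemma crCM u v : crC (u * v) = crC u * crC v.
Proof. by congr (_, _) => /=; ring. Qed.
Lemma crCD u v : crC (u + v) = crC u + crC v.
Proof. by congr (_, _) => /=; rewrite addr0. Qed.
Lemma crCB u v : crC (u - v) = crC u - crC v.
Proof. by congr (_, _) => /=; rewrite subr0. Qed.
Lemma crYY : crY * crY = crC f.
Proof. by congr (_, _) => /=; ring. Qed.

Hypothesis szf : size f = 4%N.

Lemma cr_size (g : R) : g.2 != 0 -> size (cr_norm g) = maxn (size g.1).*2.-1 (size g.2).*2.+2.
Proof.
case: g => u v /= v0.
have f0 : f != 0 by rewrite -size_poly_eq0 szf.
have s1 : size (f * v ^+ 2) = (size v).*2.+2.
  rewrite size_mul ?expf_neq0 // szf expr2 size_mul //.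
  by move: v0; rewrite -size_poly_gt0; case: (size v) => // n _; rewrite addnn doubleS.
rewrite /cr_norm /=; have [->|u0] := eqVneq u 0.
  by rewrite expr0n /= sub0r size_polyN s1 size_poly0 max0n.
have s2 : size (u ^+ 2) = (size u).*2.-1 by rewrite expr2 size_mul // addnn.
have h : odd (size u).*2.-1.
  by move: u0; rewrite -size_poly_gt0; case: (size u) => // n _; rewrite doubleS /= odd_double.
have ne : size (u ^+ 2) != size (- (f * v ^+ 2)).
  by rewrite size_polyN s1 s2; apply: contraTneq h => ->; rewrite /= !negbK odd_double.
case: (ltngtP (size (u ^+ 2)) (size (- (f * v ^+ 2)))) ne => // lt _.
  rewrite addrC size_polyDl // -s1 -s2 size_polyN; apply/esym/maxn_idPr.
  by rewrite -[X in (_ <= X)%N]size_polyN ltnW.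
rewrite size_polyDl // -s1 -s2; apply/esym/maxn_idPl.
by rewrite -[X in (X <= _)%N]size_polyN ltnW.
Qed.

Lemma cr_size3 (g : R) : (size (cr_norm g) <= 3)%N ->
  g.2 = 0 /\ (size (cr_norm g) = (size g.1).*2.-1).
Proof.
have [v0|v0] := eqVneq g.2 0.
  move=> _; split=> //; rewrite /cr_norm v0 expr0n mulr0 subr0.
  have [->|u0] := eqVneq g.1 0; first by rewrite expr0n /= size_poly0.
  by rewrite expr2 size_mul // addnn.
rewrite cr_size // geq_max => /andP[_].
by move: v0; rewrite -size_poly_gt0; case: (size g.2) => // n _; rewrite doubleS.
Qed.

Lemma cr_norm_eq0 (g : R) : (cr_norm g == 0) = (g == 0).
Proof.
apply/idP/idP => [/eqP h|/eqP ->]; last first.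
  by rewrite /cr_norm /= !expr0n mulr0 subr0.
have [|] := @cr_size3 g; first by rewrite h size_poly0.
move=> v0; rewrite h size_poly0 => /esym s0.
have u0 : g.1 = 0.
  apply/eqP; rewrite -size_poly_eq0; move: s0; case: (size g.1) => // n.
by rewrite [g]surjective_pairing u0 v0.
Qed.

Lemma cr_mulI (g : R) : g != 0 -> injective ( *%R g).
Proof.
move=> g0 a b e; apply/eqP; rewrite -subr_eq0 -cr_norm_eq0.
have : cr_norm (g * (a - b)) == 0 by rewrite cr_norm_eq0 mulrBr e subrr.
by rewrite cr_normM mulf_eq0 (cr_norm_eq0 g) (negPf g0).
Qed.

Lemma cr_mul_neq0 (g h : R) : g != 0 -> h != 0 -> g * h != 0.
Proof. by rewrite -!cr_norm_eq0 cr_normM mulf_eq0 negb_or => -> ->. Qed.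

Definition cr_eval (x y : F) (g : R) : F := g.1.[x] + g.2.[x] * y.

Lemma cr_evalD x y : {morph cr_eval x y : g h / g + h}.
Proof. by move=> [a b] [c d]; rewrite /cr_eval /= !hornerD; ring. Qed.

Lemma cr_evalM x y : y ^+ 2 = f.[x] ->
  {morph cr_eval x y : g h / g * h}.
Proof.
move=> e [a b] [c d]; rewrite /cr_eval /= !(hornerD, hornerM) -e; ring.
Qed.

(* A nonzero function vanishing at a point has norm of degree at least 2. *)
Lemma cr_size_vanish x y (g : R) :
  g != 0 -> cr_eval x y g = 0 -> (2 < size (cr_norm g))%N.
Proof.
move=> g0 e; rewrite ltnNge; apply/negP => le2.
have [v0 s] := @cr_size3 g (leqW le2).
have s1 : (size g.1 <= 1)%N.
  by move: le2; rewrite s; case: (size g.1) => // [[|n]].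
case/negP: g0; rewrite [g]surjective_pairing v0.
move: e; rewrite /cr_eval v0 horner0 mul0r addr0.
by rewrite (size1_polyC s1) hornerC => ->.
Qed.

Lemma cr_size_line x y (g : R) : cr_eval x y g = 0 ->
  (size (cr_norm g) <= 3)%N -> exists c, g = crC (c%:P * ('X - x%:P)).
Proof.
move=> e le3; have [v0 s] := cr_size3 le3.
move: e; rewrite /cr_eval v0 horner0 mul0r addr0 => /eqP /factor_theorem[k ek].
have sk : (size k <= 1)%N.
  have [->|k0] := eqVneq k 0; first by rewrite size_poly0.
  move: le3; rewrite s ek size_mul ?polyXsubC_eq0 // size_XsubC addn2 /=.
  by case: (size k) => // [[|n]].
by exists k`_0; rewrite -(size1_polyC sk) -ek [g]surjective_pairing v0.
Qed.

Lemma size_norm_X x : size (cr_norm (crC ('X - x%:P))) = 3%N.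
Proof.
by rewrite /cr_norm /= expr0n mulr0 subr0 expr2 size_mul ?polyXsubC_eq0 //
  size_XsubC.
Qed.

Lemma size_prod_vanish x y x' y' (g h k : R) :
  g != 0 -> h != 0 -> cr_eval x y g = 0 -> cr_eval x' y' h = 0 ->
  cr_norm (g * h) = cr_norm k -> size (cr_norm k) = 5%N ->
  (size (cr_norm g) <= 3)%N.
Proof.
move=> g0 h0 eg eh e s; have := cr_size_vanish g0 eg; have := cr_size_vanish h0 eh.
move: s; rewrite -e cr_normM size_mul ?cr_norm_eq0 //.
move: (size (cr_norm g)) (size (cr_norm h)) => m n.
case: m => [|[|[|[|m]]]] //; case: n => [|[|[|n]]] //.
by rewrite !addnS /= => -[].
Qed.

End CoordRing.

Lemma lincomb (R : pzRingType) (k a b c d : R) :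
  a = b -> c - d = (a - b) * k -> c = d.
Proof. by move=> ->; rewrite subrr mul0r => /eqP; rewrite subr_eq0 => /eqP. Qed.

Section Ideals.
Variables (F : fieldType) (E : ellCurve F).

Definition curve_poly : {poly F} :=
  'X ^+ 3 + (ec2 E)%:P * 'X ^+ 2 + (ec4 E)%:P * 'X + (ec6 E)%:P.

Local Notation R := (coordring curve_poly).
Local Notation C := (@crC F curve_poly).
Local Notation Y := (crY curve_poly).

Lemma size_curve_poly : size curve_poly = 4%N.
Proof.
rewrite /curve_poly -!addrA size_polyDl size_polyXn //.
apply: leq_ltn_trans (size_polyD _ _) _; rewrite gtn_max.
have cP (c : F) : (size c%:P < 2)%N by rewrite ltnS size_polyC_leq1.
apply/andP; split.
  by apply: leq_ltn_trans (size_polyMleq _ _) _; rewrite size_polyXn;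
    case: (size _) (cP (ec2 E)) => [|[]].
apply: leq_ltn_trans (size_polyD _ _) _; rewrite gtn_max.
rewrite (leq_trans (cP _)) // andbT.
by apply: leq_ltn_trans (size_polyMleq _ _) _; rewrite size_polyX;
  case: (size _) (cP (ec4 E)) => [|[]].
Qed.

Lemma horner_curve_poly x : curve_poly.[x] = wcubic E x.
Proof. by rewrite /curve_poly /wcubic !(hornerD, hornerM, hornerXn, hornerX, hornerC). Qed.

Definition idX (x : F) : R := C ('X - x%:P).
Definition idY (y : F) : R := Y - C y%:P.

Definition ideal_mul (P : option (F * F)) (J : R -> Prop) : R -> Prop :=
  if P is Some (x, y)
  then fun g => exists j1 j2, [/\ J j1, J j2 & g = idX x * j1 + idY y * j2]
  else J.

Definition is_ideal (J : R -> Prop) : Prop :=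
  (forall a b, J a -> J b -> J (a + b)) /\ (forall r a, J a -> J (r * a)).

Definition ideal_sim (J J' : R -> Prop) : Prop :=
  exists a b, [/\ a != 0, b != 0 &
    forall g, (exists2 j, J j & g = a * j) <-> (exists2 j, J' j & g = b * j)].

Lemma ideal_mul_ideal P J : is_ideal J -> is_ideal (ideal_mul P J).
Proof.
case: P => [[x y]|] // [JD JM]; split=> /=.
  move=> _ _ [j1 [j2 [h1 h2 ->]]] [k1 [k2 [l1 l2 ->]]].
  by exists (j1 + k1), (j2 + k2); split; [exact: JD | exact: JD | ring].
move=> r _ [j1 [j2 [h1 h2 ->]]].
by exists (r * j1), (r * j2); split; [exact: JM | exact: JM | ring].
Qed.

Lemma ideal_sim_sym J J' : ideal_sim J J' -> ideal_sim J' J.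
Proof.
by case=> a [b [a0 b0 h]]; exists b, a; split=> // g; split=> /h.
Qed.

Lemma ideal_sim_trans J2 J1 J3 :
  ideal_sim J1 J2 -> ideal_sim J2 J3 -> ideal_sim J1 J3.
Proof.
case=> a [b [a0 b0 h]] [c [d [c0 d0 k]]].
exists (c * a), (b * d); split.
- exact: (cr_mul_neq0 size_curve_poly).
- exact: (cr_mul_neq0 size_curve_poly).
move=> g; split=> -[j Jj ->].
  have [i Ji e] : exists2 i, J2 i & a * j = b * i by apply/h; exists j.
  have [m Jm e'] : exists2 m, J3 m & c * i = d * m by apply/k; exists i.
  by exists m => //; rewrite -!mulrA e -e'; ring.
have [i Ji e] : exists2 i, J2 i & d * j = c * i by apply/k; exists j.
have [m Jm e'] : exists2 m, J1 m & b * i = a * m by apply/h; exists i.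
by exists m => //; rewrite -!mulrA e -e'; ring.
Qed.

Lemma ideal_sim_mul P J J' :
  ideal_sim J J' -> ideal_sim (ideal_mul P J) (ideal_mul P J').
Proof.
case: P => [[x y]|] // [a [b [a0 b0 h]]]; exists a, b; split=> // g /=; split.
  case=> _ [j1 [j2 [h1 h2 ->]]] ->.
  have [k1 K1 e1] : exists2 k, J' k & a * j1 = b * k by apply/h; exists j1.
  have [k2 K2 e2] : exists2 k, J' k & a * j2 = b * k by apply/h; exists j2.
  exists (idX x * k1 + idY y * k2); first by exists k1, k2.
  by rewrite !mulrDr ![a * (_ * _)]mulrCA e1 e2; ring.
case=> _ [j1 [j2 [h1 h2 ->]]] ->.
have [k1 K1 e1] : exists2 k, J k & b * j1 = a * k by apply/h; exists j1.
have [k2 K2 e2] : exists2 k, J k & b * j2 = a * k by apply/h; exists j2.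
exists (idX x * k1 + idY y * k2); first by exists k1, k2.
by rewrite !mulrDr ![b * (_ * _)]mulrCA e1 e2; ring.
Qed.

Lemma curve_poly_chord x1 y1 x2 y2 l :
  y1 ^+ 2 = wcubic E x1 -> y1 - y2 = l * (x1 - x2) ->
  l * (y1 + y2) = x1 ^+ 2 + x1 * x2 + x2 ^+ 2 + ec2 E * (x1 + x2) + ec4 E ->
  let x3 := l ^+ 2 - ec2 E - x1 - x2 in
  curve_poly = (y1%:P + l%:P * ('X - x1%:P)) ^+ 2 +
               ('X - x1%:P) * ('X - x2%:P) * ('X - x3%:P).
Proof.
move=> h1 h2 h3 x3.
have e6 : ec6 E = y1 ^+ 2 - (x1 ^+ 3 + ec2 E * x1 ^+ 2 + ec4 E * x1).
  by rewrite h1 /wcubic; ring.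
have e2 : y2 = y1 - l * (x1 - x2) by rewrite -h2; ring.
have e4 : ec4 E = l * (y1 + y2) -
                  (x1 ^+ 2 + x1 * x2 + x2 ^+ 2 + ec2 E * (x1 + x2)).
  by rewrite h3; ring.
rewrite /curve_poly e6 e4 e2 /x3.
rewrite !(polyCD, polyCN, polyCB, polyCM, rmorphXn) /=; ring.
Qed.

(* The class of the product of the ideals of P and Q is that of P + Q. *)
Lemma ideal_mul_add P Q J : on_curve E P -> on_curve E Q -> is_ideal J ->
  ideal_sim (ideal_mul P (ideal_mul Q J)) (ideal_mul (addpt E P Q) J).
Proof.
move=> hP hQ [JD JM].
have sim_refl J' : ideal_sim J' J'.
  by exists 1, 1; split; rewrite ?oner_neq0.
case: (addptP hP hQ) => [->|->|x y eP eQ|]; try exact: sim_refl.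
  subst P Q; move: hP => /= /eqP hP.
  pose h := 'X ^+ 2 + x%:P * 'X + x%:P ^+ 2 + (ec2 E)%:P * ('X + x%:P) + (ec4 E)%:P.
  have eH : idY y * idY (- y) = idX x * C h.
    have -> : idY y * idY (- y) = C (curve_poly - (y ^+ 2)%:P).
      rewrite /idY polyCN crCB -crYY rmorphXn expr2 crCM.
      have -> : C (- y%:P) = - C y%:P by congr (_, _); rewrite oppr0.
      by ring.
    rewrite -crCM hP /wcubic /curve_poly /h; congr (crC _ _).
    by rewrite !(polyCD, polyCM, rmorphXn) /=; ring.
  have [c1 [c2 [c3 [c4 e1]]]] : exists c1 c2 c3 c4,
      1 = idX x * c1 + idY (- y) * c2 + idY y * c3 + C h * c4.
    have [y0|y0] := eqVneq y 0.
      have d0 := ec_smooth (E := E) (x := x).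
      rewrite -hP y0 expr0n in d0; have {}d0 := d0 (erefl _).
      set d := (X in X != 0) in d0.
      exists (- C (d^-1%:P * ('X + (2%:R * x + ec2 E)%:P))), 0, 0, (C d^-1%:P).
      rewrite !mulr0 !addr0 mulrN -!crCM addrC -crCB.
      have -> : (1 : R) = C 1 by [].
      congr (crC _ _).
      have -> : 1 = d%:P * d^-1%:P by rewrite -polyCM divff.
      by rewrite /d /h !(polyCD, polyCM, rmorphXn, rmorph_nat) /=; ring.
    exists 0, (C (2%:R * y)^-1%:P), (- C (2%:R * y)^-1%:P), 0.
    rewrite !mulr0 addr0 add0r mulrN -mulrBl.
    have -> : idY (- y) - idY y = C (2%:R * y)%:P.
      rewrite /idY opprB addrC addrA subrK -crCB -polyCB; congr (crC _ _%:P); ring.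
    by rewrite -crCM -polyCM divff // mulf_neq0 ?(ec_two E).
  exists 1, (idX x); split; rewrite ?oner_neq0 //.
    by rewrite /eq_op /= polyXsubC_eq0.
  move=> g /=; split.
    case=> _ [_ [_ [[j1 [j2 [J1 J2 ->]]] [j3 [j4 [J3 J4 ->]]] ->]]] ->.
    exists (idX x * j1 + idY (- y) * j2 + idY y * j3 + C h * j4).
      by rewrite -?addrA; do ![apply: (JD)]; apply: JM.
    by apply: (lincomb (k := j4) eH); ring.
  case=> j Jj ->; exists (idX x * j); last by rewrite mul1r.
  exists (idX x * (c1 * j) + idY (- y) * (c2 * j)),
         (idX x * (c3 * j) + idY (- y) * (c4 * j)); split.
  - by exists (c1 * j), (c2 * j); split => //; apply: JM.
  - by exists (c3 * j), (c4 * j); split => //; apply: JM.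
  apply: (lincomb (k := idX x * j) e1).
  by apply: (lincomb (k := - (c4 * j)) eH); ring.
move=> x1 y1 x2 y2 l x3 y3 eP eQ ne h1 h2 e3 e3'; subst P Q.
move: hP hQ => /= /eqP hP /eqP hQ.
have := curve_poly_chord hP h1 h2; rewrite -e3 /= => ef.
pose L := C (y1%:P + l%:P * ('X - x1%:P)); pose K := C l%:P.
pose t := Y - L.
have eY1 : idY y1 = t + K * idX x1.
  by rewrite /idY /t /L /K /idX crCD crCM; ring.
have eL2 : y1%:P + l%:P * ('X - x1%:P) = y2%:P + l%:P * ('X - x2%:P).
  have -> : y1 = y2 + l * (x1 - x2) by rewrite -h1; ring.
  by rewrite !(polyCD, polyCM, polyCB, polyCN); ring.
have eL3 : y1%:P + l%:P * ('X - x1%:P) = - y3%:P + l%:P * ('X - x3%:P).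
  by rewrite e3' !(polyCD, polyCM, polyCB, polyCN); ring.
have eY2 : idY y2 = t + K * idX x2.
  by rewrite /idY /t /L /K /idX eL2 crCD crCM; ring.
have eY3 : idY y3 = Y + L - K * idX x3.
  rewrite /idY /L /K /idX eL3 crCD crCM.
  have -> : C (- y3%:P) = - C y3%:P by congr (_, _); rewrite oppr0.
  by ring.
have et : t * (Y + L) = idX x1 * idX x2 * idX x3.
  rewrite /idX -!crCM.
  have -> : ('X - x1%:P) * ('X - x2%:P) * ('X - x3%:P) =
    curve_poly - (y1%:P + l%:P * ('X - x1%:P)) ^+ 2 by rewrite {1}ef; ring.
  by rewrite crCB expr2 crCM -crYY /t -/L; ring.
have {}eY3 : t * idY y3 = idX x1 * idX x2 * idX x3 - t * K * idX x3.
  by rewrite eY3 mulrBr et; ring.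
have [c1 [c2 [c3 [c4 ec]]]] : exists c1 c2 c3 c4,
    t = idX x1 * (idX x2 * c1 + idY y2 * c2) + idY y1 * (idX x2 * c3 + idY y2 * c4).
  have [e12|n12] := eqVneq x1 x2; last first.
    pose d := C (x2 - x1)^-1%:P.
    have ed : (idX x1 - idX x2) * d = 1.
      rewrite /idX -crCB opprB addrC addrA subrK -polyCB -crCM -polyCM.
      by rewrite divff // subr_eq0 eq_sym.
    exists 0, d, (- d), 0; rewrite eY1 eY2.
    by apply: (lincomb (k := - t) ed); ring.
  move: ne; rewrite e12 eqxx /= => /andP[/eqP e y0]; subst x2 y2.
  pose d := C (2%:R * y1)^-1%:P.
  have ed : C y1%:P * 2%:R * d = 1.
    rewrite mulr_natr mulr2n -crCD -crCM -polyCD -polyCM.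
    have -> : y1 + y1 = 2%:R * y1 by ring.
    by rewrite divff // mulf_neq0 ?(ec_two E).
  exists (d * (idX x3 + K ^+ 2)), 0, 0, (- d).
  have eL : L = C y1%:P + K * idX x1 by rewrite /L crCD crCM.
  have e0 : t * t = idX x1 * idX x1 * idX x3 - L * t * 2%:R.
    by rewrite -et /t; ring.
  rewrite eY1.
  transitivity (d * (idX x1 * idX x1 * idX x3 - t * t - 2%:R * K * idX x1 * t)); last by ring.
  by rewrite e0 eL; apply: (lincomb (k := - t) ed); ring.
exists (idX x3), t; split.
- by rewrite /eq_op /= polyXsubC_eq0.
- by rewrite /eq_op /= subr0 oner_eq0 andbF.
move=> g /=; split.
  case=> _ [_ [_ [[j1 [j2 [J1 J2 ->]]] [j3 [j4 [J3 J4 ->]]] ->]]] ->.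
  pose k2 := j1 + K * j2 + K * j3 + K * K * j4.
  have Jk2 : J k2 by rewrite /k2; do ![apply: (JD)]; rewrite ?mulrA //; apply: JM.
  pose k1 := K * k2 + (idX x1 + K * 0) * j2 + K * idX x1 * j4 + idX x2 * j3
             + K * idX x2 * j4 + t * j4.
  exists (idX x3 * k1 + idY y3 * k2).
    exists k1, k2; split=> //.
    by rewrite /k1; do ![apply: (JD)]; apply: JM.
  by rewrite eY1 eY2; apply: (lincomb (k := - k2) eY3); rewrite /k1 /k2; ring.
case=> _ [k1 [k2 [J1 J2 ->]]] ->.
pose k := k1 + - K * k2.
have Jk : J k by apply: JD => //; apply: JM.
exists (idX x1 * (idX x2 * (k2 + c1 * k) + idY y2 * (c2 * k)) +
        idY y1 * (idX x2 * (c3 * k) + idY y2 * (c4 * k))).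
  do 2![eexists; eexists; split; last reflexivity | eexists _, _];
  try by [apply: JM | apply: JD => //; apply: JM].
transitivity (idX x3 * (idX x1 * idX x2 * k2 + t * k)).
  by apply: (lincomb (k := k2) eY3); rewrite /k; ring.
by apply: (lincomb (k := idX x3 * k) ec); ring.
Qed.

Lemma ideal_mul_eval x y g : y ^+ 2 = wcubic E x ->
  ideal_mul (Some (x, y)) (fun _ => True) g -> cr_eval x y g = 0.
Proof.
move=> e [j1 [j2 [_ _ ->]]].
rewrite cr_evalD !cr_evalM ?horner_curve_poly //.
rewrite /cr_eval /= !(hornerD, hornerN, hornerX, hornerC) ; ring.
Qed.

Lemma ideal_simP P Q : on_curve E P -> on_curve E Q ->
  ideal_sim (ideal_mul P (fun _ => True)) (ideal_mul Q (fun _ => True)) -> P = Q.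
Proof.
pose szf := size_curve_poly.
have X0 x : idX x != 0 by rewrite /eq_op /= polyXsubC_eq0.
have inX x y : ideal_mul (Some (x, y)) (fun _ => True) (idX x).
  by exists 1, 0; split=> //; ring.
have inY x y : ideal_mul (Some (x, y)) (fun _ => True) (idY y).
  by exists 0, 1; split=> //; ring.
have none x y : y ^+ 2 = wcubic E x ->
    ~ ideal_sim (fun _ => True) (ideal_mul (Some (x, y)) (fun _ => True)).
  move=> hP [a [b [a0 b0 h]]].
  have [t It et] : exists2 t, ideal_mul (Some (x, y)) (fun _ => True) t & a * 1 = b * t.
    by apply/h; exists 1.
  have [s _ es] : exists2 s, True & b * idX x = a * s by apply/h; exists (idX x).
  have [r _ er] : exists2 r, True & b * idY y = a * r by apply/h; exists (idY y).
  rewrite -[a]mulr1 et -mulrA in es; rewrite -[a]mulr1 et -mulrA in er.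
  have {}es := cr_mulI szf b0 es; have {}er := cr_mulI szf b0 er.
  have t0 : t != 0 by apply: contraTneq (X0 x) => t0; rewrite es t0 mul0r eqxx.
  have s0 : s != 0 by apply: contraTneq (X0 x) => s0; rewrite es s0 mulr0 eqxx.
  have szt : (size (cr_norm t) <= 3)%N.
    rewrite -(size_norm_X curve_poly x) -/(idX x) es cr_normM size_mul ?cr_norm_eq0 //.
    have : (0 < size (cr_norm s))%N by rewrite size_poly_gt0 cr_norm_eq0.
    by case: (size (cr_norm s)) => // n _; rewrite addnS leq_addr.
  have [c ct] := cr_size_line szf (ideal_mul_eval hP It) szt.
  move: er => /(congr1 (fun g : R => g.2.[x])).
  rewrite ct /= subr0 mul0r addr0 !hornerE; move/eqP.
  by rewrite subrr !(mulr0, mul0r, addr0) oner_eq0.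
case: P => [[x y]|]; case: Q => [[x' y']|] //= /eqP hP /eqP hQ; last first.
- by move/none => /(_ hQ).
- by move/ideal_sim_sym/none => /(_ hP).
move=> [a [b [a0 b0 h]]].
have {}h g : (exists2 j, ideal_mul (Some (x, y)) (fun _ => True) j & g = a * j) <->
  (exists2 j, ideal_mul (Some (x', y')) (fun _ => True) j & g = b * j) by exact: h.
have [t It et] : exists2 t, ideal_mul (Some (x', y')) (fun _ => True) t & a * idX x = b * t.
  by apply/h; exists (idX x).
have [s Is es] : exists2 s, ideal_mul (Some (x, y)) (fun _ => True) s & b * idX x' = a * s.
  by apply/h; exists (idX x').
have [r Ir er] : exists2 r, ideal_mul (Some (x', y')) (fun _ => True) r & a * idY y = b * r.
  by apply/h; exists (idY y).
have ets : idX x * idX x' = t * s.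
  apply: (cr_mulI szf a0); apply: (cr_mulI szf b0).
  transitivity ((a * idX x) * (b * idX x')); first by ring.
  by rewrite et es; ring.
have XX0 := cr_mul_neq0 szf (X0 x) (X0 x').
have t0 : t != 0 by apply: contraTneq XX0 => t0; rewrite ets t0 mul0r eqxx.
have s0 : s != 0 by apply: contraTneq XX0 => s0; rewrite ets s0 mulr0 eqxx.
have szt : (size (cr_norm t) <= 3)%N.
  apply: (size_prod_vanish szf t0 s0 (ideal_mul_eval hQ It) (ideal_mul_eval hP Is)
    (congr1 _ (esym ets))).
  rewrite cr_normM size_mul ?cr_norm_eq0 //.
  by rewrite !size_norm_X.
have [c ct] := cr_size_line szf (ideal_mul_eval hQ It) szt.
have c0 : c != 0.
  by apply: contraNneq t0 => c0; rewrite ct c0 mul0r.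
have e : t * idY y = r * idX x.
  apply: (cr_mulI szf b0); rewrite mulrA -et [RHS]mulrA -er; ring.
have e2 : c%:P * ('X - x'%:P) = r.2 * ('X - x%:P).
  move/(congr1 snd): e; rewrite ct /= => e2.
  transitivity ((c%:P * ('X - x'%:P)) * (1 - 0) + 0 * (0 - y%:P)); first by ring.
  by rewrite e2; ring.
have e1 : - (c * y)%:P * ('X - x'%:P) = r.1 * ('X - x%:P).
  move/(congr1 fst): e; rewrite ct /= => e1.
  transitivity ((c%:P * ('X - x'%:P)) * (0 - y%:P) + curve_poly * 0 * (1 - 0)).
    by rewrite polyCM; ring.
  by rewrite e1; ring.
have exx : x = x'.
  move/(congr1 (horner^~ x)): (e2); rewrite !hornerE subrr mulr0 => /eqP.
  by rewrite mulf_eq0 (negPf c0) subr_eq0 => /eqP.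
subst x'.
have r2 : r.2 = c%:P by apply: (mulIf (negbT (polyXsubC_eq0 x))); rewrite -e2.
have r1 : r.1 = - (c * y)%:P by apply: (mulIf (negbT (polyXsubC_eq0 x))); rewrite -e1.
have := ideal_mul_eval hQ Ir; rewrite /cr_eval r1 r2 !hornerE.
have -> : - (c * y) + c * y' = c * (y' - y) by ring.
by move/eqP; rewrite mulf_eq0 (negPf c0) subr_eq0 => /eqP ->.
Qed.

Lemma addptA P Q S : on_curve E P -> on_curve E Q -> on_curve E S ->
  addpt E P (addpt E Q S) = addpt E (addpt E P Q) S.
Proof.
move=> hP hQ hS; have hPQ := addpt_on hP hQ; have hQS := addpt_on hQ hS.
have iT : is_ideal (fun _ => True) by [].
apply: ideal_simP; rewrite ?addpt_on //.
apply: (@ideal_sim_trans (ideal_mul P (ideal_mul Q (ideal_mul S (fun _ => True))))).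
  apply: ideal_sim_sym.
  apply: ideal_sim_trans (ideal_mul_add hP hQS iT).
  exact/ideal_sim_mul/ideal_mul_add.
have iS := ideal_mul_ideal S iT.
apply: ideal_sim_trans (ideal_mul_add hP hQ iS) _.
exact: ideal_mul_add.
Qed.

End Ideals.

Record ecpoint (F : fieldType) (E : ellCurve F) := ECPoint {
  ecpoint_val : option (F * F);
  ecpoint_on : on_curve E ecpoint_val
}.

HB.instance Definition _ (F : fieldType) (E : ellCurve F) :=
  [isSub for @ecpoint_val F E].
HB.instance Definition _ (F : fieldType) (E : ellCurve F) :=
  [Choice of ecpoint E by <:].

Section PointGroup.
Variables (F : fieldType) (E : ellCurve F).

Definition ec_zero : ecpoint E := @ECPoint F E None isT.
Definition ec_opp (P : ecpoint E) : ecpoint E :=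
  ECPoint (opppt_on (ecpoint_on P)).
Definition ec_add (P Q : ecpoint E) : ecpoint E :=
  ECPoint (addpt_on (ecpoint_on P) (ecpoint_on Q)).

Lemma ec_addA : associative ec_add.
Proof. by move=> P Q S; apply/val_inj/addptA; apply: ecpoint_on. Qed.
Lemma ec_addC : commutative ec_add.
Proof. by move=> P Q; apply/val_inj/addptC; apply: ecpoint_on. Qed.
Lemma ec_add0 : left_id ec_zero ec_add.
Proof. by move=> P; apply/val_inj. Qed.
Lemma ec_addN : left_inverse ec_zero ec_opp ec_add.
Proof. by move=> P; apply/val_inj/addptN. Qed.

HB.instance Definition _ :=
  GRing.isZmodule.Build (ecpoint E) ec_addA ec_addC ec_add0 ec_addN.

End PointGroup.

Section BaseChange.
Variables (F L : fieldType) (f : {rmorphism F -> L}).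

Lemma wdisc_rmorph a2 a4 a6 : wdisc (f a2) (f a4) (f a6) = f (wdisc a2 a4 a6).
Proof. by rewrite /wdisc; ring. Qed.

Lemma ec_base_change_disc (E : ellCurve F) :
  wdisc (f (ec2 E)) (f (ec4 E)) (f (ec6 E)) != 0.
Proof. by rewrite wdisc_rmorph fmorph_eq0 ec_disc. Qed.

Definition ec_base_change (E : ellCurve F) : ellCurve L :=
  EllCurve (ec_base_change_disc E).

End BaseChange.

Definition zmod_isog (G H : zmodType) : Prop :=
  exists f : {additive G -> H}, bijective f.

Section Torsion.
Variable G : zmodType.

Definition torsion : {pred G} :=
  fun x => `[< exists2 n : nat, (0 < n)%N & x *+ n = 0 >].

Lemma torsion_zmod_closed : zmod_closed torsion.
Proof.
split=> [|x y]; rewrite !unfold_in; first by apply/asboolP; exists 1%N.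
move=> /asboolP[m m0 xm] /asboolP[n n0 yn]; apply/asboolP; exists (m * n)%N.
  by rewrite muln_gt0 m0.
by rewrite mulrnBl mulrnA xm mul0rn [(m * n)%N]mulnC mulrnA yn mul0rn subrr.
Qed.

HB.instance Definition _ :=
  GRing.isZmodClosed.Build G torsion torsion_zmod_closed.

Record torsion_subgroup := TorsionElt {
  torsion_val : G;
  _ : torsion_val \in torsion
}.

HB.instance Definition _ := [isSub for torsion_val].
HB.instance Definition _ := [Choice of torsion_subgroup by <:].
HB.instance Definition _ :=
  [SubChoice_isSubZmodule of torsion_subgroup by <:].

End Torsion.

(* G is the direct sum of its torsion subgroup and Z^r; such an r is unique. *)
Definition has_rank (G : zmodType) (r : nat) : Prop :=
  zmod_isog G (torsion_subgroup G * 'rV[int]_r)%type.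

(* y^2 = x (x + s p) (x + s q) over Q, with s = (-1)^sigma. *)
Section TwinPrimeCurve.
Variables (sigma : bool) (p q : nat).
Hypotheses (p_prime : prime p) (q_prime : prime q) (hpq : q = (p + 2)%N).

Lemma twin_disc :
  wdisc ((-1) ^+ sigma * (p%:R + q%:R)) (p%:R * q%:R) 0 != 0 :> rat.
Proof.
have -> : wdisc ((-1) ^+ sigma * (p%:R + q%:R)) (p%:R * q%:R) 0 =
          (16%:R * p%:R ^+ 2 * q%:R ^+ 2) * (q%:R - p%:R) ^+ 2 :> rat.
  by rewrite /wdisc; case: sigma; ring.
have -> : q%:R - p%:R = 2%:R :> rat by rewrite hpq natrD addrC addKr.
have nz n : (0 < n)%N -> n%:R != 0 :> rat by rewrite Num.Theory.pnatr_eq0 lt0n.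
by do 3?[apply: mulf_neq0]; do ?[apply: expf_neq0]; apply: nz;
  rewrite // prime_gt0.
Qed.

Definition twin_curve : ellCurve rat := EllCurve twin_disc.

Lemma twin_cubicE x : wcubic twin_curve x =
  x * (x + (-1) ^+ sigma * p%:R) * (x + (-1) ^+ sigma * q%:R).
Proof. by rewrite /wcubic /=; case: sigma; ring. Qed.

End TwinPrimeCurve.

(* Q(i): pairs of rationals with the multiplication of complex numbers. *)
Notation Qi := (complex rat).

Definition rat_to_Qi : {rmorphism rat -> Qi} := @real_complex_def rat (Phant rat).

Definition points_Q (E : ellCurve rat) : zmodType := ecpoint E.
Definition points_Qi (E : ellCurve rat) : zmodType :=
  ecpoint (ec_base_change rat_to_Qi E).

(* Main.v *)
Require Import Defs.
From HB Require Import structures.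
From mathcomp Require Import all_boot all_order all_algebra all_field.
From mathcomp Require Import boolp complex ring lra zify.

Set Implicit Arguments.
Unset Strict Implicit.
Unset Printing Implicit Defensive.

Import Order.TTheory GRing.Theory Num.Theory.
Local Open Scope ring_scope.

(** Write [E_+] and [E_-] for the curve with [sigma = false] and [sigma = true],
    and [K] for [Q(i)]. Over [K] the two curves are quadratic twists of each other
    by [-1 = i ^+ 2], hence isomorphic, and the identity
    [2P = (P + conj P) + (P - conj P)] writes the double of a [K]-point as the sum
    of a rational point of one curve and of a twisted rational point of the other
    ([double_split]). Hence [E(K)] is finitely generated and its rank is at most
    the sum of the ranks of [E_+(Q)] and [E_-(Q)] ([fin_gen_of_doubles],
    [rank_le_of_doubles]), so that everything reduces to descent over [Q].

    Over [Q] the three points of order two are rational, and any other [P] is determined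
    modulo doubles by the classes of [x], [x + A] and [x + B] modulo squares, where
    [A = +-p] and [B = +-q] ([same_class_halvable]). These classes are read from
    signs and from parities of valuations at [2], [p] and [q]; after translation by
    a point of order two only two bits remain ([normalise], [beta_same]). A value
    of the two bits amounts to a representation of [p] or [q], up to squares, by
    a norm form [X^2 - c Y^2], which is impossible when [c] is not a square modulo
    a prime occurring to an odd power ([norm_value_excluded]). The residues needed
    are those of [-1] modulo primes congruent to 3 modulo 4, and of [2] and [-2]
    modulo primes congruent to 5 modulo 8, consequences of the absence of primitive
    fourth, respectively eighth, roots of unity. With the points of order two
    removed, the number of remaining classes bounds [2 ^ rank]. Always
    [rank E_+(Q) <= 2] and [rank E_-(Q) <= 1], as [p] and [q] are not both sums of
    two squares; both ranks vanish if [p = 5] modulo 8, and [rank E_-(Q) = 0],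
    [rank E_+(Q) <= 1] if [p = 3] modulo 8.

    Finite generation comes from the finiteness of the number of classes by the
    usual height argument ([descent_fin_gen], [height_double],
    [height_translate], [height_finite]).

    Torsion is controlled at the prime 2: the abscissa of a double [2P] of a
    rational point has an even denominator, and doubling it again increases this
    denominator for ever, so torsion points over [Q] are killed by 2
    ([twin_torsion_two]). The identity above shows that torsion points over [K]
    are killed by 4, and since [p], [q] are not squares up to sign in [K], no
    point of order two is a double.

    Finally, in the Pythagorean case an explicit rational point of [E_+] is
    obtained by rotating two circles ([infinite_order_point]); it is not killed
    by 2, hence has infinite order. *)

(** * Finitely generated abelian groups *)

Definition additive_of {G H : zmodType} {f : G -> H} (fB : {morph f : x y / x - y}) :
    {additive G -> H} :=
  HB.pack f (GRing.isZmodMorphism.Build G H f fB).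

Lemma inj_surj_bij (G H : choiceType) (f : G -> H) :
  injective f -> (forall y, exists x, f x = y) -> bijective f.
Proof.
move=> fi /choice[g gK]; exists g => // x; exact: fi.
Qed.

Lemma zmod_isog_sym (G H : zmodType) : zmod_isog G H -> zmod_isog H G.
Proof.
case=> f [g fK gK].
have gB : {morph g : x y / x - y}.
  by move=> x y; apply: (can_inj fK); rewrite raddfB !gK.
by exists (additive_of gB); exists f.
Qed.

Lemma zmod_isog_trans (G H K : zmodType) :
  zmod_isog G H -> zmod_isog H K -> zmod_isog G K.
Proof.
by case=> f bf [g bg]; exists (g \o f : {additive G -> K}); exact: bij_comp.
Qed.

Lemma zmod_isog_prod (G G' H H' : zmodType) :
  zmod_isog G G' -> zmod_isog H H' -> zmod_isog (G * H)%type (G' * H')%type.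
Proof.
case=> f [f' fK f'K] [g [g' gK g'K]].
have fgB : {morph (fun x : G * H => (f x.1, g x.2)) : x y / x - y}.
  by move=> x y; congr (_, _); rewrite /= raddfB.
exists (additive_of fgB); exists (fun x => (f' x.1, g' x.2)) => -[x y] /=.
  by rewrite fK gK.
by rewrite f'K g'K.
Qed.

Section Combinations.
Variable G : zmodType.

Definition zcomb n (g : 'I_n -> G) (c : 'rV[int]_n) : G := \sum_i g i *~ c 0 i.

Lemma zcombB n (g : 'I_n -> G) : {morph zcomb g : c d / c - d}.
Proof.
move=> c d; rewrite /zcomb -sumrB; apply: eq_bigr => i _.
by rewrite !mxE mulrzBr.
Qed.

HB.instance Definition _ n (g : 'I_n -> G) :=
  GRing.isZmodMorphism.Build 'rV[int]_n G (zcomb g) (@zcombB n g).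

Lemma zcombZ n (g : 'I_n -> G) k c : zcomb g (k *: c) = zcomb g c *~ k.
Proof.
rewrite /zcomb mulrz_suml; apply: eq_bigr => i _.
by rewrite mxE mulrzA_C.
Qed.

Lemma zcombM m n (g : 'I_n -> G) (c : 'rV[int]_m) (A : 'M[int]_(m, n)) :
  zcomb g (c *m A) = zcomb (fun i => zcomb g (row i A)) c.
Proof.
rewrite mulmx_sum_row raddf_sum; apply: eq_bigr => i _; exact: zcombZ.
Qed.

Lemma zcomb_delta n (g : 'I_n -> G) i : zcomb g (delta_mx 0 i) = g i.
Proof.
rewrite /zcomb (bigD1 i) //= big1 ?addr0 ?mxE ?eqxx // => j /negPf ji.
by rewrite mxE ji andbF.
Qed.

Lemma torsionP (x : G) : reflect (exists2 n : nat, (0 < n)%N & x *+ n = 0) (x \in torsion (G:=G)).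
Proof. exact: asboolP. Qed.

Lemma torsion_mulz (x : G) (k : int) : k != 0 -> x *~ k \in torsion (G:=G) -> x \in torsion (G:=G).
Proof.
move=> k0 /torsionP[n n0 xn]; apply/torsionP; exists (`|k| * n)%N.
  by rewrite muln_gt0 n0 absz_gt0 k0.
case: k k0 xn => k _; first by rewrite -pmulrn -mulrnA.
rewrite NegzE mulrNz -pmulrn mulNrn -mulrnA => /eqP.
by rewrite oppr_eq0 => /eqP.
Qed.

Definition generates_mod_torsion n (g : 'I_n -> G) : Prop :=
  forall x, exists c, x - zcomb g c \in torsion (G:=G).

(** The lattice spanned by generators independent modulo torsion is a
    complement of the torsion subgroup. *)
Lemma free_generators_has_rank n (g : 'I_n -> G) : generates_mod_torsion g ->
  (forall c, zcomb g c \in torsion (G:=G) -> c = 0) -> has_rank G n.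
Proof.
move=> gen free; apply: zmod_isog_sym.
have fB : {morph (fun x : torsion_subgroup G * 'rV[int]_n =>
    torsion_val x.1 + zcomb g x.2) : x y / x - y}.
  move=> [t c] [u d]; rewrite /= (raddfB (zcomb g)).
  by rewrite opprD addrACA.
exists (additive_of fB); apply: inj_surj_bij => [|x].
  apply: raddf_inj => -[[t ht] c] /= /eqP; rewrite addr_eq0 => /eqP e.
  have c0 : c = 0 by apply: free; rewrite -[zcomb g c]opprK -e rpredN.
  congr (_, _) => //; apply: val_inj => /=.
  by rewrite e c0 raddf0 oppr0.
have [c hc] := gen x; exists (TorsionElt hc, c) => /=.
by rewrite subrK.
Qed.

(** A relation among the generators is brought by a unimodular change of
    generators to the form [d *~ g_0], so that [g_0] is torsion and can be
    dropped. *)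
Lemma drop_generator n (g : 'I_n.+1 -> G) c : generates_mod_torsion g ->
  c != 0 -> zcomb g c \in torsion (G:=G) ->
  exists g' : 'I_n -> G, generates_mod_torsion g'.
Proof.
move=> gen c0 ct; have [L Lu [R Ru [d _ ec]]] := int_Smith_normal_form c.
pose h i := zcomb g (row i R).
(* [L] is a 1 x 1 matrix, so [c] is [L 0 0 * d`_0] times the first row of [R]. *)
have d00 : L 0 0 * d`_0 != 0.
  apply: contraNneq c0 => e; rewrite ec.
  rewrite [L *m _](_ : _ = 0) ?mul0mx //; apply/rowP => j.
  rewrite !mxE big_ord1 !mxE; case: (ord0 == j :> nat); rewrite ?mulr1n ?mulr0n ?mulr0 //.
have h0 : h ord0 \in torsion (G:=G).
  apply: torsion_mulz d00 _; move: ct; rewrite ec zcombM.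
  rewrite {1}/zcomb (bigD1 ord0) //= big1 => [|j j0].
    by rewrite addr0 !mxE big_ord1 !mxE.
  rewrite mxE big_ord1 mxE eq_sym.
  by rewrite (negPf (_ : (j : nat) != 0%N)) // mulr0n mulr0 mulr0z.
exists (fun i => h (lift ord0 i)) => x; have [k hk] := gen x.
pose k' := k *m invmx R.
exists (\row_i k' 0 (lift ord0 i)).
have -> : zcomb (fun i => h (lift ord0 i)) (\row_i k' 0 (lift ord0 i)) =
    zcomb g k - h ord0 *~ k' 0 ord0.
  have -> : k = k' *m R by rewrite mulmxKV.
  rewrite zcombM {2}/zcomb big_ord_recl /= addrAC subrr add0r.
  by apply: eq_bigr => i _; rewrite mxE.
by rewrite opprB addrCA -addrC rpredD // rpredMz.
Qed.

Lemma generators_has_rank n (g : 'I_n -> G) : generates_mod_torsion g ->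
  exists r, has_rank G r.
Proof.
elim: n g => [|n IH] g gen.
  by exists 0%N; apply: free_generators_has_rank gen _ => c _; apply/rowP; case.
have [free|/existsNP[c /not_implyP[ct /eqP c0]]] :=
  pselect (forall c, zcomb g c \in torsion (G:=G) -> c = 0).
  by exists n.+1; apply: free_generators_has_rank gen free.
by have [g' /IH] := drop_generator gen c0 ct.
Qed.

Definition fin_gen : Prop :=
  exists n (g : 'I_n -> G), forall x, exists c, x = zcomb g c.

Lemma fin_gen_has_rank : fin_gen -> exists r, has_rank G r.
Proof.
case=> n [g gen]; apply: (@generators_has_rank n g) => x.
by have [c ->] := gen x; exists c; rewrite subrr rpred0.
Qed.

End Combinations.
Section Generation.
Variable G : zmodType.

Lemma fin_gen_seq (s : seq G) :
  (forall S : G -> Prop, (forall x y, S x -> S y -> S (x - y)) ->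
     (forall x, x \in 0 :: s -> S x) -> forall x, S x) -> fin_gen G.
Proof.
set t := 0 :: s => gen; exists (size t), (fun i => t`_i).
apply: gen => [_ _ [c ->] [d ->]|x].
  by exists (c - d); rewrite raddfB.
move=> /nthP-/(_ 0)[i si <-]; exists (delta_mx 0 (Ordinal si)).
by rewrite zcomb_delta.
Qed.

(** The translates by the finitely many representatives [R] at most square the
    height, and halving takes a fourth root; so outside a finite set, halving
    the difference with a representative strictly decreases the height. *)
Lemma descent_fin_gen (h : G -> nat) (R : seq G) (C : nat) :
  (forall x, exists2 y, y \in R & exists z, x = y + z *+ 2) ->
  (forall x : G, x *+ 2 != 0 -> (h x ^ 4 <= C * h (x *+ 2)%R)%N) ->
  (forall y, exists K, forall x, h (x + y)%R <= K * h x ^ 2)%N ->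
  (forall B, exists s : seq G, forall x, (h x <= B)%N -> x \in s) ->
  fin_gen G.
Proof.
move=> hR h2 /choice[K hK] fin.
pose L := (\sum_(y <- R) K (- y)%R)%N.
have hL y x : y \in R -> (h (x - y)%R <= L * h x ^ 2)%N.
  move=> yR; apply: leq_trans (hK _ _) _; rewrite leq_mul2r; apply/orP; right.
  by rewrite /L (big_rem y) //= leq_addr.
have [s hs] := fin (C * L)%N.
apply: (@fin_gen_seq (R ++ s)) => S SB Ss x.
have S0 : S 0 by apply: Ss; rewrite inE eqxx.
have SD y z : S y -> S z -> S (y + z).
  by move=> Sy Sz; rewrite -[z]opprK; apply: (SB) => //; rewrite -sub0r; apply: SB.
move: {2}(h x).+1 (ltnSn (h x)) => n; elim: n x => // n IH x; rewrite ltnS => hx.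
have [small|big] := leqP (h x) (C * L).
  by apply: Ss; rewrite inE mem_cat hs ?orbT.
have [y yR [z e]] := hR x.
have Sy : S y by apply: Ss; rewrite inE mem_cat yR orbT.
have [z2|z2] := eqVneq (z *+ 2) 0; first by rewrite e z2 addr0.
suff Sz : S z by rewrite e mulr2n; do 2?apply: (SD).
apply: IH; apply: leq_trans hx; rewrite ltnNge; apply/negP => le.
have : (h x ^ 2 * h x ^ 2 <= C * L * h x ^ 2)%N.
  rewrite -expnD -mulnA; apply: leq_trans (_ : h z ^ 4 <= _)%N.
    by rewrite leq_exp2r.
  apply: leq_trans (h2 z z2) _; rewrite leq_mul2l; apply/orP; right.
  by have -> : z *+ 2 = x - y by [rewrite e addrC addKr]; exact: hL.
have hx0 : (0 < h x)%N by apply: leq_ltn_trans big.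
rewrite leq_mul2r expn_eq0 eqn0Ngt hx0 /= leqNgt (leq_trans big) //.
by rewrite -mulnn leq_pmull.
Qed.

End Generation.

(** Among the elements [x] whose double lies in a given class modulo [2] of the
    subgroup spanned by the two images, one is chosen; any other differs from
    it by an element of that subgroup and a solution of [t *+ 2 = 0]. *)
Lemma fin_gen_of_doubles (A B G : zmodType) (f : {additive A -> G})
    (g : {additive B -> G}) (s : seq G) : fin_gen A -> fin_gen B ->
  (forall x, exists a b, x *+ 2 = f a + g b) ->
  (forall x : G, x *+ 2 = 0 -> x \in s) -> fin_gen G.
Proof.
case=> m [u hu] [n [v hv]] h2 hs.
pose F (i : 'I_(m + n)) := match split i with inl j => f (u j) | inr j => g (v j) end.
have hF x : exists c, x *+ 2 = zcomb F c.
  have [a [b ->]] := h2 x; have [c ->] := hu a; have [d ->] := hv b.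
  exists (row_mx c d); rewrite /zcomb big_split_ord /= !raddf_sum.
  congr (_ + _); apply: eq_bigr => i _; rewrite raddfMz /F.
    by rewrite row_mxEl -/(unsplit (inl i)) unsplitK.
  by rewrite row_mxEr -/(unsplit (inr i)) unsplitK.
pose bz (b : 'rV[bool]_(m + n)) : 'rV[int]_(m + n) := map_mx (fun b : bool => (b : nat)%:Z) b.
have /choice[P hP] : forall b, exists y, forall x c, x *+ 2 = zcomb F (bz b + c *+ 2) ->
    exists d, y *+ 2 = zcomb F (bz b + d *+ 2).
  move=> b; have [[y [d e]]|no] := pselect (exists y d, y *+ 2 = zcomb F (bz b + d *+ 2)).
    by exists y => _ _ _; exists d.
  by exists 0 => x c e; case: no; exists x, c.
pose gens := map P (enum {: 'rV[bool]_(m + n)}) ++ map F (enum 'I_(m + n)) ++ s.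
apply: (@fin_gen_seq _ gens) => S SB Ss x.
have S0 : S 0 by apply: Ss; rewrite inE eqxx.
have SN y : S y -> S (- y) by move=> Sy; rewrite -sub0r; apply: SB.
have SD y z : S y -> S z -> S (y + z).
  by move=> Sy Sz; rewrite -[z]opprK; apply: (SB) => //; apply: SN.
have SMn y k : S y -> S (y *+ k).
  by move=> Sy; elim: k => [|k IH]; rewrite ?mulr0n // mulrS; apply: SD.
have SF c : S (zcomb F c).
  rewrite /zcomb; elim/big_rec: _ => // i y _ Sy; apply: SD => //.
  have SFi : S (F i) by apply: Ss; rewrite inE !mem_cat (map_f F) ?mem_enum ?orbT.
  by case: (c 0 i) => k; rewrite ?NegzE ?mulrNz -pmulrn; [|apply: SN]; apply: SMn.
have [c ec] := hF x.
pose b : 'rV[bool]_(m + n) := map_mx (fun k => odd `|k|) c.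
pose d : 'rV[int]_(m + n) := map_mx (fun k => (k %/ 2)%Z) c.
have ed : c = bz b + d *+ 2.
  apply/rowP => i; rewrite !mxE {1}(divz_eq (c 0 i) 2) addrC mulr_natr; congr (_ + _).
  lia.
rewrite ed in ec; have [k ek] := hP b x d ec.
have Ps : S (P b) by apply: Ss; rewrite inE mem_cat (map_f P) ?mem_enum ?orbT.
have -> : x = P b + zcomb F (d - k) + (x - P b - zcomb F (d - k)).
  by rewrite addrC -(addrA x) -opprD subrK.
apply: (SD); first exact: SD.
apply: Ss; rewrite inE !mem_cat hs ?orbT //.
by rewrite !mulrnBl ec ek -raddfMn /= -!raddfB /= mulrnBl opprD addrACA subrr add0r subrr raddf0.
Qed.

Section Rank.
Variable G : zmodType.

Lemma has_rank_free r : has_rank G r ->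
  exists pi : {additive G -> 'rV[int]_r},
    (forall c, exists x, pi x = c) /\ (forall x, (x \in torsion (G:=G)) = (pi x == 0)).
Proof.
case=> f [f' fK f'K].
have piB : {morph (fun x => (f x).2) : x y / x - y} by move=> x y; rewrite raddfB.
exists (additive_of piB); split=> [c|x /=]; first by exists (f' (0, c)); rewrite /= f'K.
apply/torsionP/eqP => [[n n0 xn]|e].
  have : additive_of piB x *+ n = 0 by rewrite -raddfMn xn raddf0.
  move=> e; apply/rowP => i; move/rowP/(_ i): e; rewrite mulmxnE mxE => /eqP.
  by rewrite mulrn_eq0 eqn0Ngt n0 => /eqP.
have /torsionP[n n0 en] : torsion_val (f x).1 \in torsion (G:=G) by case: (f x).1.
exists n => //; apply: (can_inj fK); rewrite raddfMn raddf0.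
have -> : f x *+ n = ((f x).1 *+ n, (f x).2 *+ n).
  by elim: n {n0 en} => // n IH; rewrite !mulrS IH.
rewrite (e : (f x).2 = 0) mul0rn; congr (_, _); apply: val_inj; apply: etrans en.
exact: (raddfMn (\val : torsion_subgroup G -> G)).
Qed.

Lemma has_rank0_torsion : has_rank G 0 -> forall x : G, x \in torsion (G:=G).
Proof.
by move=> /has_rank_free[pi [_ ht]] x; rewrite ht; apply/eqP/rowP; case.
Qed.

(** Torsion dies in the free quotient, and [Z^r] has [2 ^ r] classes modulo 2. *)
Lemma rank_le_classes r (R : seq G) : has_rank G r ->
  (forall x, exists2 y, y \in R &
     exists2 t, t \in torsion (G:=G) & exists z, x = y + t + z *+ 2) ->
  (2 ^ r <= size R)%N.
Proof.
move=> /has_rank_free[pi [surj ht]] hR.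
pose rho x : 'rV['F_2]_r := map_mx intr (pi x).
have <- : #|{: 'rV['F_2]_r}| = (2 ^ r)%N by rewrite card_mx card_Fp // mul1n.
rewrite -(size_map rho); apply: leq_trans (card_size _).
apply/subset_leq_card/subsetP => v _.
have [x ex] := surj (map_mx (fun a : 'F_2 => (a : nat)%:Z) v).
have [y yR [t]] := hR x; rewrite ht => /eqP t0 [z exy].
apply/mapP; exists y => //; apply/rowP => i.
have : rho x = v.
  by apply/rowP => j; rewrite /rho ex !mxE -pmulrn natr_Zp.
rewrite [rho y]/rho; have -> : pi y = pi x - pi z *+ 2.
  by rewrite exy (raddfD pi (y + t)) (raddfD pi y) raddfMn t0 addr0 addrK.
move=> /rowP/(_ i) <-; rewrite !mxE rmorphB rmorphD /= -mulr2n.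
by rewrite -mulr_natr pchar_Fp_0 // mulr0 subr0.
Qed.

(** Over the rationals, the multiples of the basis vectors of [Z^r] form a matrix
    of rank [r] that factors through [n] generators. *)
Lemma rank_le_generators r n (u : 'I_n -> G) : has_rank G r ->
  (forall x, exists2 k : nat, (0 < k)%N & exists c, x *+ k = zcomb u c) -> (r <= n)%N.
Proof.
move=> /has_rank_free[pi [surj ht]] hu.
have /choice[k /choice[c hc]] : forall i, exists k : nat, exists c, (0 < k)%N /\
    delta_mx 0 i *+ k = c *m \matrix_j pi (u j) :> 'rV[int]_r.
  move=> i; have [x <-] := surj (delta_mx 0 i).
  have [k k0 [c e]] := hu x; exists k, c; split=> //.
  rewrite -raddfMn e /zcomb raddf_sum mulmx_sum_row; apply: eq_bigr => j _.
  by rewrite raddfMz rowK -scaler_int intz.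
have e : diag_mx (\row_i (k i)%:R) =
    map_mx intr (\matrix_i c i) *m map_mx intr (\matrix_j pi (u j)) :> 'M[rat]_r.
  rewrite -map_mxM; apply/matrixP => i j; rewrite [LHS]mxE [RHS]mxE.
  have -> : (\matrix_i c i *m \matrix_j pi (u j)) i j = (c i *m \matrix_j pi (u j)) 0 j.
    by rewrite !mxE; apply: eq_bigr => l _; rewrite !mxE.
  rewrite -(hc i).2 mulmxnE !mxE eqxx /= eq_sym.
  case: (j == i); last by rewrite mul0rn.
  by rewrite mulr1n rmorphMn.
have : \rank (diag_mx (\row_i (k i)%:R) : 'M[rat]_r) = r.
  apply: mxrank_unit; rewrite unitmxE det_diag unitfE.
  by apply/prodf_neq0 => i _; rewrite mxE pnatr_eq0 -lt0n (hc i).1.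
by move=> <-; rewrite e; apply: mulmx_max_rank.
Qed.

End Rank.

Lemma has_rank_generators (G : zmodType) r : has_rank G r ->
  exists u : 'I_r -> G, forall x,
    exists2 k : nat, (0 < k)%N & exists c, x *+ k = zcomb u c.
Proof.
move=> /has_rank_free[pi [surj ht]].
have /choice[u hu] : forall i : 'I_r, exists x, pi x = delta_mx 0 i by move=> i; exact: surj.
exists u => x; have : x - zcomb u (pi x) \in torsion (G:=G).
  rewrite ht raddfB subr_eq0; apply/eqP.
  rewrite [LHS]row_sum_delta raddf_sum; apply: eq_bigr => i _.
  by rewrite raddfMz hu -scaler_int intz.
case/torsionP=> k k0; rewrite mulrnBl => /eqP; rewrite subr_eq0 => /eqP e.
by exists k => //; exists (pi x *+ k); rewrite raddfMn.
Qed.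

Lemma rank_le_of_doubles (A B G : zmodType) (f : {additive A -> G})
    (g : {additive B -> G}) rA rB r : has_rank A rA -> has_rank B rB ->
  has_rank G r -> (forall x, exists a b, x *+ 2 = f a + g b) -> (r <= rA + rB)%N.
Proof.
move=> /has_rank_generators[u hu] /has_rank_generators[v hv] hG h2.
apply: (@rank_le_generators G r _
  (fun i => match split i with inl j => f (u j) | inr j => g (v j) end) hG) => x.
have [a [b e]] := h2 x; have [k k0 [c ec]] := hu a; have [l l0 [d ed]] := hv b.
exists (2 * (k * l))%N; first by rewrite !muln_gt0 k0 l0.
exists (row_mx (c *+ l) (d *+ k)).
rewrite mulrnA e mulrnDl -!raddfMn mulrnA ec [(k * l)%N]mulnC mulrnA ed.
rewrite -!raddfMn /zcomb big_split_ord /= !raddf_sum.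
congr (_ + _); apply: eq_bigr => i _; rewrite raddfMz.
  by rewrite row_mxEl -/(unsplit (inl i)) unsplitK.
by rewrite row_mxEr -/(unsplit (inr i)) unsplitK.
Qed.

Lemma torsion_klein (G : zmodType) (a b : G) :
  a *+ 2 = 0 -> b *+ 2 = 0 -> a != 0 -> b != 0 -> a != b ->
  (forall x, x \in torsion (G:=G) -> x \in [:: 0; a; b; a + b]) ->
  zmod_isog (torsion_subgroup G) ('Z_2 * 'Z_2)%type.
Proof.
move=> a2 b2 a0 b0 ab all4; apply: zmod_isog_sym.
have two (x : G) : x *+ 2 = 0 -> x \in torsion (G:=G) by move=> e; apply/torsionP; exists 2%N.
pose F (x : 'Z_2 * 'Z_2) : G := a *+ (x.1 : nat) + b *+ (x.2 : nat).
have FT x : F x \in torsion (G:=G).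
  by apply: two; rewrite /F mulrnDl -!mulrnA ![(_ * 2)%N]mulnC !mulrnA a2 b2 !mul0rn addr0.
have sub2 (c : G) (m n : 'Z_2) : c *+ 2 = 0 -> c *+ (m - n : 'Z_2)%R = c *+ m - c *+ n.
  move=> c2; have cN : - c = c by apply/eqP; rewrite -subr_eq0 -opprD -mulr2n c2 oppr0.
  case: m => [[|[|//]] ?]; case: n => [[|[|//]] ?];
    by rewrite /= ?mulr0n ?mulr1n ?subr0 ?sub0r ?cN ?subrr.
have FB : {morph (fun x => TorsionElt (FT x)) : x y / x - y}.
  move=> x y; apply: val_inj; rewrite [LHS]/= /F !sub2 //.
  by rewrite -[RHS](_ : F x - F y = _) // /F opprD addrACA.
exists (additive_of FB); apply: inj_surj_bij.
  apply: raddf_inj => -[m n] /(congr1 val) /= /eqP; rewrite /F /=.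
  case: m => [[|[|//]] ?]; case: n => [[|[|//]] ?]; rewrite /= ?mulr0n ?mulr1n ?addr0 ?add0r.
  - by move=> _; congr (_, _); apply: val_inj.
  - by rewrite (negPf b0).
  - by rewrite (negPf a0).
  - rewrite addr_eq0 => /eqP e; case/eqP: ab; rewrite e; apply/eqP.
    by rewrite -subr_eq0 -opprD -mulr2n b2 oppr0.
move=> [x xt]; have := all4 x xt; rewrite !inE => /or4P[] /eqP e.
- by exists (0, 0); apply: val_inj; rewrite /= e /F /= !mulr0n addr0.
- by exists (1, 0); apply: val_inj; rewrite /= e /F /= !mulr0n addr0.
- by exists (0, 1); apply: val_inj; rewrite /= e /F /= !mulr0n add0r.
- by exists (1, 1); apply: val_inj; rewrite /= e /F /=.
Qed.

Lemma has_rank0_isog (G T : zmodType) :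
  has_rank G 0 -> zmod_isog (torsion_subgroup G) T -> zmod_isog G T.
Proof.
move=> h0 hT; apply: zmod_isog_trans h0 _; apply: zmod_isog_trans _ hT.
have B : {morph (fun x : torsion_subgroup G * 'rV[int]_0 => x.1) : x y / x - y} by [].
exists (additive_of B); exists (fun t => (t, 0)) => // -[t v] /=.
by congr (_, _); apply/rowP; case.
Qed.

Lemma has_rank1_isog (G T : zmodType) :
  has_rank G 1 -> zmod_isog (torsion_subgroup G) T -> zmod_isog G (T * int)%type.
Proof.
move=> h1 hT; apply: zmod_isog_trans h1 _; apply: zmod_isog_prod hT _.
have B : {morph (fun v : 'rV[int]_1 => v 0 0) : x y / x - y}.
  by move=> x y; rewrite !mxE.
exists (additive_of B); exists (fun k => const_mx k) => [v|k] /=; last by rewrite mxE.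
by apply/rowP => i; rewrite mxE (ord1 i).
Qed.

(** * Homotheties of elliptic curves *)

(** Base change followed by the change of variables with parameter [u]: this
    covers the inclusion of fields, the Galois conjugation and the quadratic
    twist. *)
Section Homothety.
Variables (F L : fieldType) (f : {rmorphism F -> L}) (u : L).
Variables (E : ellCurve F) (E' : ellCurve L).
Hypotheses (u0 : u != 0) (h2 : ec2 E' = u ^+ 2 * f (ec2 E))
  (h4 : ec4 E' = u ^+ 4 * f (ec4 E)) (h6 : ec6 E' = u ^+ 6 * f (ec6 E)).

Definition scale_coord (P : option (F * F)) : option (L * L) :=
  if P is Some (x, y) then Some (u ^+ 2 * f x, u ^+ 3 * f y) else None.

Lemma scale_on_curve P : on_curve E P -> on_curve E' (scale_coord P).
Proof.
case: P => [[x y]|] //= /eqP e; apply/eqP; rewrite /wcubic h2 h4 h6.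
transitivity (u ^+ 6 * f (y ^+ 2)); first by ring.
by rewrite e /wcubic; ring.
Qed.

Lemma scale_addpt P Q :
  scale_coord (addpt E P Q) = addpt E' (scale_coord P) (scale_coord Q).
Proof.
case: P => [[x1 y1]|] //; case: Q => [[x2 y2]|] //=.
have uk0 k : u ^+ k != 0 by rewrite expf_neq0.
have eqx a b k : (u ^+ k * f a == u ^+ k * f b) = (a == b).
  by rewrite (inj_eq (mulfI (uk0 k))) (inj_eq (fmorph_inj f)).
rewrite !eqx -mulrN -rmorphN /= eqx; case: ifP => // ne; rewrite h2 h4.
case: eqVneq ne => [e|d] ne /=.
  have two0 : 2%:R != 0 :> L by have := ec_two E; rewrite -(fmorph_eq0 f) rmorph_nat.
  set l := _ / _; set l' := _ / _; have -> : l' = u * f l.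
    rewrite /l' /l; have [->|y0] := eqVneq y1 0.
      by rewrite (rmorph0 f) !mulr0 !invr0 !mulr0 (rmorph0 f) mulr0.
    have fy0 : f y1 != 0 by rewrite fmorph_eq0.
    by rewrite fmorph_div /=; field; rewrite u0 fy0 two0.
  by congr (Some (_, _)); ring.
have d' : x2 - x1 != 0 by rewrite subr_eq0 eq_sym.
have fd : f x2 - f x1 != 0 by rewrite -rmorphB fmorph_eq0.
set l := _ / _; set l' := _ / _; have -> : l' = u * f l.
  by rewrite /l' /l fmorph_div /=; field; rewrite -mulrBr mulf_eq0 negb_or uk0 fd.
by congr (Some (_, _)); ring.
Qed.

Definition scale_point (P : ecpoint E) : ecpoint E' :=
  ECPoint (scale_on_curve (ecpoint_on P)).

Lemma scale_pointB : {morph scale_point : P Q / P - Q}.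
Proof.
move=> P Q; apply: val_inj; rewrite [LHS]/= scale_addpt /=; congr addpt.
by case: Q => [[[x y]|] ?] //=; rewrite rmorphN mulrN.
Qed.

Lemma scale_point_inj : injective scale_point.
Proof.
move=> [P hP] [Q hQ] /(congr1 val) /= e; apply: val_inj => /=.
case: P Q {hP hQ} e => [[x y]|] [[x' y']|] //= [].
have uk0 k : u ^+ k != 0 by rewrite expf_neq0.
by move=> /(mulfI (uk0 2)) /fmorph_inj -> /(mulfI (uk0 3)) /fmorph_inj ->.
Qed.

Lemma scale_point_surj x y (hP : on_curve E' (Some (u ^+ 2 * f x, u ^+ 3 * f y))) :
  exists P, scale_point P = ECPoint hP.
Proof.
have h : on_curve E (Some (x, y)).
  rewrite /=; move: hP; rewrite /= /wcubic h2 h4 h6 => /eqP e.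
  rewrite -(inj_eq (fmorph_inj f)); apply/eqP/(mulfI (expf_neq0 6 u0)).
  transitivity ((u ^+ 3 * f y) ^+ 2); first by ring.
  by rewrite e /wcubic; ring.
by exists (ECPoint h); apply: val_inj.
Qed.

End Homothety.

(** * Square classes and division by 2 *)

Definition is_square (F : fieldType) (z : F) : Prop := exists t, z = t ^+ 2.

Section SquareClasses.
Variable F : fieldType.
Implicit Types x y z : F.

Lemma is_squareM x y : is_square x -> is_square y -> is_square (x * y).
Proof. by move=> [s ->] [t ->]; exists (s * t); rewrite exprMn. Qed.

Lemma is_square_sqr x : is_square (x ^+ 2).
Proof. by exists x. Qed.

Lemma is_square_divl x y : x != 0 -> is_square x -> is_square (x * y) -> is_square y.
Proof.
move=> x0 [s es] [t et]; exists (t / s); rewrite expr_div_n -et -es.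
by rewrite mulrAC divff // mul1r.
Qed.

End SquareClasses.

Section FullTwoTorsion.
Variables (F : fieldType) (E : ellCurve F).

Definition point (x y : F) (h : y ^+ 2 = wcubic E x) : ecpoint E :=
  @ECPoint F E (Some (x, y)) (introT eqP h).

Lemma ecpointP (P : ecpoint E) :
  P = 0 \/ exists x y (h : y ^+ 2 = wcubic E x), P = point h.
Proof.
case: P => [[[x y]|] hP]; [right|by left; apply: val_inj].
by exists x, y, (eqP hP); apply: val_inj.
Qed.

Lemma opp_point x y (h : y ^+ 2 = wcubic E x) (h' : (- y) ^+ 2 = wcubic E x) :
  - point h = point h'.
Proof. exact: val_inj. Qed.

Lemma double_point_eq0 x y (h : y ^+ 2 = wcubic E x) : (point h *+ 2 == 0) = (y == 0).
Proof.
rewrite mulr2n addr_eq0 -val_eqE /= /eq_op /= /eq_op /= eqxx /=.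
rewrite -subr_eq0 opprK; have -> : y + y = 2%:R * y by ring.
by rewrite mulf_eq0 (negPf (ec_two E)).
Qed.

Lemma point_add x1 y1 x2 y2 x3 y3 (h1 : y1 ^+ 2 = wcubic E x1)
    (h2 : y2 ^+ 2 = wcubic E x2) (h3 : y3 ^+ 2 = wcubic E x3) :
  point h1 + point h2 = point h3 ->
  exists l, [/\ y1 - y2 = l * (x1 - x2),
    l * (y1 + y2) = x1 ^+ 2 + x1 * x2 + x2 ^+ 2 + ec2 E * (x1 + x2) + ec4 E &
    x3 = l ^+ 2 - ec2 E - x1 - x2].
Proof.
move=> /(congr1 val) /= ea.
have : forall P Q S, add_spec E P Q S -> P = Some (x1, y1) -> Q = Some (x2, y2) ->
    S = Some (x3, y3) -> exists l, [/\ y1 - y2 = l * (x1 - x2),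
    l * (y1 + y2) = x1 ^+ 2 + x1 * x2 + x2 ^+ 2 + ec2 E * (x1 + x2) + ec4 E &
    x3 = l ^+ 2 - ec2 E - x1 - x2].
  move=> P Q S; case=> [->|->|//|a1 b1 a2 b2 l a3 b3 -> -> _ l1 l2 l3 _] //.
  by move=> [<- <-] [<- <-] [<- _]; exists l.
by apply; [apply: (addptP (ecpoint_on (point h1)) (ecpoint_on (point h2)))|..].
Qed.

(** The line through two points [y = l * (x - x1) + y1] meets the cubic so that
    the cubic minus its square is [(x - x1) * (x - x2) * (x - x3)]; this identity
    is evaluated at a root of the cubic. *)
Lemma sum_sub_root_square x1 y1 x2 y2 x3 y3 e (h1 : y1 ^+ 2 = wcubic E x1)
    (h2 : y2 ^+ 2 = wcubic E x2) (h3 : y3 ^+ 2 = wcubic E x3) :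
  wcubic E e = 0 -> point h1 + point h2 = point h3 ->
  is_square ((x1 - e) * (x2 - e) * (x3 - e)).
Proof.
move=> he /point_add[l [l1 l2 l3]]; exists (l * (e - x1) + y1).
have e6 : ec6 E = y1 ^+ 2 - (x1 ^+ 3 + ec2 E * x1 ^+ 2 + ec4 E * x1).
  by rewrite h1 /wcubic; ring.
have e2 : y2 = y1 - l * (x1 - x2) by rewrite -l1; ring.
have e4 : ec4 E = l * (y1 + y2) - (x1 ^+ 2 + x1 * x2 + x2 ^+ 2 + ec2 E * (x1 + x2)).
  by rewrite l2; ring.
rewrite -[RHS]subr0 -he /wcubic e6 e4 e2 l3; ring.
Qed.

(** The case [P = Q] of the preceding identity, where [(x - e) ^+ 2] is dropped. *)
Lemma double_sub_root_square x y x' y' e (h : y ^+ 2 = wcubic E x)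
    (h' : y' ^+ 2 = wcubic E x') : wcubic E e = 0 -> y != 0 ->
  point h *+ 2 = point h' -> is_square (x' - e).
Proof.
move=> he y0 /(sum_sub_root_square he); apply: is_square_divl; last exact: is_square_sqr.
rewrite mulf_eq0 orbb subr_eq0; apply: contraNneq y0 => ex.
by move: h; rewrite ex he => /eqP; rewrite sqrf_eq0.
Qed.

Variables e1 e2 e3 : F.
Hypotheses (E2 : ec2 E = - (e1 + e2 + e3)) (E4 : ec4 E = e1 * e2 + e1 * e3 + e2 * e3)
  (E6 : ec6 E = - (e1 * e2 * e3)).

Lemma wcubic_split x : wcubic E x = (x - e1) * (x - e2) * (x - e3).
Proof. by rewrite /wcubic E2 E4 E6; ring. Qed.

Lemma roots_distinct : [/\ e1 != e2, e1 != e3 & e2 != e3].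
Proof.
have := ec_disc E.
have -> : wdisc (ec2 E) (ec4 E) (ec6 E) =
    16%:R * ((e1 - e2) * (e1 - e3) * (e2 - e3)) ^+ 2.
  by rewrite /wdisc E2 E4 E6; ring.
rewrite mulf_eq0 sqrf_eq0 !mulf_eq0 !subr_eq0 !negb_or => /andP[_ /andP[/andP[-> ->] ->]].
by [].
Qed.

Lemma root_point_on e : wcubic E e = 0 -> 0 ^+ 2 = wcubic E e.
Proof. by rewrite expr0n. Qed.

(** With [x - e_i = r_i ^+ 2] and [y = r1 * r2 * r3], the half of [(x, y)] has
    abscissa [x + r1 * r2 + r1 * r3 + r2 * r3], where the tangent has slope
    [r1 + r2 + r3]. *)
Lemma point_halvable x y (h : y ^+ 2 = wcubic E x) :
  is_square (x - e1) -> is_square (x - e2) -> is_square (x - e3) ->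
  exists S : ecpoint E, point h = S *+ 2.
Proof.
move=> [r1 s1] [r2 s2] [r3 s3].
wlog ey : r1 s1 / y = r1 * r2 * r3.
  (* the sign of [y] is absorbed in [r1] *)
  move=> wl; have : (y - r1 * r2 * r3) * (y + r1 * r2 * r3) = 0.
    by rewrite -subr_sqr h wcubic_split s1 s2 s3; ring.
  move/eqP; rewrite mulf_eq0 subr_eq0 addr_eq0 => /orP[] /eqP e; first exact: (wl r1).
  by apply: (wl (- r1)); rewrite ?sqrrN // e; ring.
have [d12 d13 d23] := roots_distinct.
have sum0 a b ea eb : x - ea = a ^+ 2 -> x - eb = b ^+ 2 -> ea != eb -> a + b != 0.
  move=> sa sb; apply: contraNneq => ab; rewrite -subr_eq0.
  have -> : ea - eb = b ^+ 2 - a ^+ 2 by rewrite -sa -sb; ring.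
  by rewrite subr_sqr [b + a]addrC ab mulr0.
have n12 := sum0 _ _ _ _ s1 s2 d12; have n13 := sum0 _ _ _ _ s1 s3 d13.
have n23 := sum0 _ _ _ _ s2 s3 d23.
have f1 : e1 = x - r1 ^+ 2 by rewrite -s1; ring.
have f2 : e2 = x - r2 ^+ 2 by rewrite -s2; ring.
have f3 : e3 = x - r3 ^+ 2 by rewrite -s3; ring.
have h' : ((r1 + r2) * (r1 + r3) * (r2 + r3)) ^+ 2 =
    wcubic E (x + r1 * r2 + r1 * r3 + r2 * r3).
  by rewrite wcubic_split f1 f2 f3; ring.
exists (point h'); rewrite mulr2n; apply: val_inj; rewrite /= eqxx /=.
have two0 := ec_two E.
have y'0 : (r1 + r2) * (r1 + r3) * (r2 + r3) != 0 by rewrite !mulf_neq0.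
have twice z : (z == - z) = (2%:R * z == 0) :> bool.
  by rewrite -subr_eq0 opprK mulr_natl mulr2n.
rewrite twice mulf_eq0 (negPf two0) (negPf y'0) /=.
set l := _ / _; have -> : l = r1 + r2 + r3.
  by rewrite /l E2 E4 f1 f2 f3; field; rewrite n12 n13 n23 two0.
by rewrite ey E2 f1 f2 f3; congr (Some (_, _)); ring.
Qed.

(** Two points whose coordinates agree modulo squares differ by a double; the
    difference may itself be a point of order two. *)
Lemma same_class_halvable x1 y1 x2 y2 (h1 : y1 ^+ 2 = wcubic E x1)
    (h2 : y2 ^+ 2 = wcubic E x2) : y1 != 0 -> y2 != 0 ->
  is_square ((x1 - e1) * (x2 - e1)) -> is_square ((x1 - e2) * (x2 - e2)) ->
  is_square ((x1 - e3) * (x2 - e3)) -> exists S, point h1 = point h2 + S *+ 2.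
Proof.
move=> y10 y20 s1 s2 s3; set P := point h1; set Q := point h2.
suff [S eS] : exists S, P - Q = S *+ 2 by exists S; rewrite -eS addrC subrK.
have [->|[x3 [y3 [h3 e]]]] := ecpointP (P - Q); first by exists 0; rewrite mul0rn.
have h2' : (- y2) ^+ 2 = wcubic E x2 by rewrite sqrrN.
rewrite (opp_point h2 h2') in e; have nz e0 : wcubic E e0 = 0 -> (x1 - e0) * (x2 - e0) != 0.
  move=> he0; rewrite mulf_neq0 // subr_eq0 ; [apply: contraNneq y10|apply: contraNneq y20] => ex.
    by have := h1; rewrite ex he0 => /eqP; rewrite sqrf_eq0.
  by have := h2; rewrite ex he0 => /eqP; rewrite sqrf_eq0.
rewrite (opp_point h2 h2') e.
have root e0 : e0 \in [:: e1; e2; e3] -> wcubic E e0 = 0.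
  by rewrite wcubic_split !inE => /or3P[] /eqP ->; rewrite subrr ?(mul0r, mulr0).
have r1 := root e1; have r2 := root e2; have r3 := root e3.
rewrite !inE !eqxx !orbT /= in r1 r2 r3; move/(_ isT) in r1; move/(_ isT) in r2; move/(_ isT) in r3.
apply: point_halvable.
- exact: is_square_divl (nz _ r1) s1 (sum_sub_root_square r1 e).
- exact: is_square_divl (nz _ r2) s2 (sum_sub_root_square r2 e).
- exact: is_square_divl (nz _ r3) s3 (sum_sub_root_square r3 e).
Qed.

End FullTwoTorsion.

(** * Valuations of rational numbers *)

Lemma odd_abszD (a b : int) : odd (absz (a + b)) = odd (absz a) (+) odd (absz b).
Proof.
have h (m n : nat) : odd (absz (m%:Z - n%:Z)) = odd m (+) odd n.
  case: (leqP m n) => [mn|/ltnW mn].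
    by rewrite -abszN opprB subzn // absz_nat oddB // addbC.
  by rewrite subzn // absz_nat oddB.
case: a b => m [] n.
- by rewrite -PoszD !absz_nat oddD.
- by rewrite NegzE h abszN.
- by rewrite NegzE addrC h addbC abszN.
- by rewrite !NegzE -opprD !abszN -PoszD !absz_nat oddD.
Qed.

Lemma logn_ndvd l n : ~~ (l %| n)%N -> logn l n = 0%N.
Proof. by rewrite lognE => /negPf ->; rewrite !andbF. Qed.

Section Valuation.
Variable l : nat.
Hypothesis l_prime : prime l.
Implicit Types x y z : rat.

Definition vrat x : int := (logn l `|numq x|)%:Z - (logn l `|denq x|)%:Z.

Lemma vrat_frac (n d : int) : n != 0 -> d != 0 ->
  vrat (n%:~R / d%:~R) = (logn l `|n|)%:Z - (logn l `|d|)%:Z.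
Proof.
move=> n0 d0; set x := _ / _.
have x0 : numq x != 0 by rewrite numq_eq0 mulf_neq0 ?invr_eq0 ?intr_eq0.
have e : numq x * d = n * denq x.
  apply: (@intr_inj rat); rewrite !rmorphM /= numqE /x mulrAC divfK ?intr_eq0 //.
have /(congr1 (fun k => logn l `|k|%N)) : numq x * d = n * denq x by [].
rewrite !abszM !lognM ?absz_gt0 ?denq_neq0 // /vrat => h.
by apply/eqP; rewrite subr_eq addrAC eq_sym subr_eq -!PoszD addnC h addnC.
Qed.

Lemma vrat_int (n : int) : n != 0 -> vrat n%:~R = (logn l `|n|)%:Z.
Proof. by move=> n0; rewrite -[n%:~R]divr1 (vrat_frac n0 (oner_neq0 _)) logn1 subr0. Qed.

Lemma vrat_nat (n : nat) : (0 < n)%N -> vrat n%:R = (logn l n)%:Z.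
Proof. by move=> n0; rewrite pmulrn vrat_int // -lt0n. Qed.

Lemma vrat0 : vrat 0 = 0.
Proof. by rewrite /vrat (numq_int 0) (denq_int 0) logn0 logn1. Qed.

Lemma vrat1 : vrat 1 = 0.
Proof. by rewrite -[1]/(1%:R) vrat_nat ?logn1. Qed.

Lemma vratM x y : x != 0 -> y != 0 -> vrat (x * y) = vrat x + vrat y.
Proof.
move=> x0 y0; rewrite -{1}[x]divq_num_den -{1}[y]divq_num_den mulf_div -!intrM.
rewrite vrat_frac ?mulf_neq0 ?numq_eq0 ?denq_neq0 //.
by rewrite !abszM !lognM ?absz_gt0 ?numq_eq0 ?denq_neq0 // /vrat !PoszD; ring.
Qed.

Lemma vratN x : vrat (- x) = vrat x.
Proof. by rewrite /vrat numqN denqN abszN. Qed.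

Lemma vratX2 x : x != 0 -> vrat (x ^+ 2) = vrat x *+ 2.
Proof. by move=> x0; rewrite expr2 vratM. Qed.

Lemma vratV x : x != 0 -> vrat x^-1 = - vrat x.
Proof.
move=> x0; apply/eqP; rewrite -addr_eq0; apply/eqP.
have xV0 : x^-1 != 0 by rewrite invr_eq0.
by rewrite -(vratM xV0 x0) mulVf // vrat1.
Qed.

(** Dividing by [x] reduces to [x = 1], where the claim is that a fraction
    whose numerator is divisible by [l] stays prime to [l] after adding [1]. *)
Lemma vrat_addl x y : x != 0 -> y != 0 -> vrat x < vrat y ->
  x + y != 0 /\ vrat (x + y) = vrat x.
Proof.
move=> x0 y0 lt; pose z := y / x.
have z0 : z != 0 by rewrite mulf_neq0 ?invr_eq0.
have vz : 0 < vrat z by rewrite vratM ?invr_eq0 // vratV // subr_gt0.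
have -> : x + y = x * (1 + z) by rewrite mulrDr mulr1 /z mulrC divfK.
suff [w0 w1] : 1 + z != 0 /\ vrat (1 + z) = 0.
  by rewrite mulf_neq0 // vratM // w1 addr0.
have nz : (l %| `|numq z|)%N.
  move: vz; rewrite /vrat subr_gt0 ltz_nat => lt'.
  have : (0 < logn l `|numq z|)%N by apply: leq_trans lt'.
  by rewrite logn_gt0 mem_primes => /and3P[].
have dz : ~~ (l %| `|denq z|)%N.
  apply/negP => h; have := dvdn_gcd l `|numq z| `|denq z|; rewrite nz h.
  by rewrite (eqP (coprime_num_den z)) dvdn1 => /eqP l1; move: l_prime; rewrite l1.
have nd : ~~ (l %| `|(denq z + numq z)%R|)%N.
  apply: contra dz => h; have : (l%:Z %| denq z)%Z.
    by rewrite -[denq z](addrK (numq z)) rpredB.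
  by [].
have ez : 1 + z = (denq z + numq z)%:~R / (denq z)%:~R.
  rewrite intrD mulrDl divq_num_den divff ?intr_eq0 ?denq_neq0 //.
have s0 : denq z + numq z != 0 by apply: contraNneq nd => ->; rewrite dvdn0.
split; first by rewrite ez mulf_neq0 ?invr_eq0 ?intr_eq0 ?denq_neq0.
rewrite ez vrat_frac ?denq_neq0 //.
by rewrite !logn_ndvd.
Qed.

Definition vodd x : bool := odd `|vrat x|.

Lemma voddM x y : x != 0 -> y != 0 -> vodd (x * y) = vodd x (+) vodd y.
Proof. by move=> x0 y0; rewrite /vodd vratM // odd_abszD. Qed.

Lemma vodd1 : vodd 1 = false.
Proof. by rewrite /vodd vrat1. Qed.

Lemma vodd_square x : is_square x -> vodd x = false.
Proof.
move=> [t ->]; have [->|t0] := eqVneq t 0; last by rewrite expr2 voddM // addbb.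
by rewrite expr2 mul0r /vodd vrat0.
Qed.

Lemma vodd_nat (n : nat) : (0 < n)%N -> vodd n%:R = odd (logn l n).
Proof. by move=> n0; rewrite /vodd vrat_nat. Qed.

(** In a product [a * (a + s) * (a + t)] equal to a square, a prime dividing
    neither [s] nor [t] either divides one factor only or occurs equally in
    the three denominators. *)
Lemma vodd_factor a s t : a != 0 -> a + s != 0 -> a + t != 0 ->
  s != 0 -> t != 0 -> vrat s = 0 -> vrat t = 0 ->
  is_square (a * (a + s) * (a + t)) -> vodd a = false.
Proof.
move=> a0 as0 at0 s0 t0 vs vt /vodd_square; rewrite !voddM ?mulf_neq0 //.
have [lt|gt|e] := ltgtP (vrat a) 0.
- have [|_ e1] := vrat_addl a0 s0; first by rewrite vs.
  have [|_ e2] := vrat_addl a0 t0; first by rewrite vt.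
  by rewrite /vodd e1 e2; case: odd.
- have [|_ e1] := vrat_addl s0 a0; first by rewrite vs.
  have [|_ e2] := vrat_addl t0 a0; first by rewrite vt.
  by rewrite /vodd ![a + _]addrC e1 e2 vs vt !addbF.
- by rewrite /vodd e.
Qed.

Lemma vrat_unit x : x != 0 -> vrat x = 0 ->
  ~~ (l %| `|numq x|)%N /\ ~~ (l %| `|denq x|)%N.
Proof.
move=> x0 /eqP; rewrite /vrat subr_eq0 => /eqP[e].
have pos n : (0 < n)%N -> (0 < logn l n)%N = (l %| n)%N.
  by move=> n0; rewrite logn_gt0 mem_primes l_prime n0.
have nd : ~~ ((l %| `|numq x|) && (l %| `|denq x|))%N.
  rewrite -dvdn_gcd (eqP (coprime_num_den x)) dvdn1.
  by apply: contraL l_prime => /eqP ->.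
have e' : (l %| `|numq x|)%N = (l %| `|denq x|)%N.
  by rewrite -!pos ?absz_gt0 ?numq_eq0 ?denq_neq0 // e.
by move: nd; rewrite e' andbb.
Qed.

(** After dividing by [Y], the case to exclude is that [l] divides
    [n ^+ 2 - c * d ^+ 2] with [n / d] a unit, and then [c] is a square
    modulo [l]. *)
Lemma vodd_norm (c : int) (X Y : rat) : (forall t : 'F_l, t ^+ 2 != c%:~R) ->
  X != 0 -> Y != 0 ->
  X ^+ 2 - c%:~R * Y ^+ 2 != 0 /\ vodd (X ^+ 2 - c%:~R * Y ^+ 2) = false.
Proof.
move=> nonres X0 Y0; have Fp0 (k : int) : (k%:~R == 0 :> 'F_l) = (l %| `|k|)%N.
  have Fn (n : nat) : (n%:R == 0 :> 'F_l) = (l %| n)%N.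
    exact: esym (dvdn_pcharf (pchar_Fp l_prime) n).
  case: k => n; first by rewrite absz_nat -Fn.
  by rewrite NegzE mulrNz oppr_eq0 abszN absz_nat -Fn.
have lc : ~~ (l %| `|c|)%N.
  by rewrite -Fp0; apply: contra (nonres 0) => /eqP ->; rewrite expr0n.
have c0 : c != 0 by apply: contraNneq lc => ->; rewrite dvdn0.
have vc : vrat c%:~R = 0 by rewrite vrat_int // logn_ndvd.
have cQ : c%:~R != 0 :> rat by rewrite intr_eq0.
have X20 : X ^+ 2 != 0 by rewrite sqrf_eq0.
have Y20 : Y ^+ 2 != 0 by rewrite sqrf_eq0.
have vY : vrat (- (c%:~R * Y ^+ 2)) = vrat Y *+ 2 by rewrite vratN vratM // vc add0r vratX2.
have cY0 : - (c%:~R * Y ^+ 2) != 0 by rewrite oppr_eq0 mulf_neq0.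
have even2 (k : int) : odd (absz (k *+ 2)) = false by rewrite mulr2n odd_abszD addbb.
have [lt|gt|e] := ltgtP (vrat X) (vrat Y).
- have [|n0 e] := vrat_addl X20 cY0; first by rewrite vY vratX2 // ltr_pMn2r.
  by rewrite n0 /vodd e vratX2.
- have [|n0 e] := vrat_addl cY0 X20; first by rewrite vY vratX2 // ltr_pMn2r.
  by rewrite addrC n0 /vodd e vY.
pose z := X / Y; have z0 : z != 0 by rewrite mulf_neq0 ?invr_eq0.
have vz : vrat z = 0 by rewrite vratM ?invr_eq0 // vratV // e subrr.
have [_ ld] := vrat_unit z0 vz.
pose m := numq z ^+ 2 - c * denq z ^+ 2.
have lm : ~~ (l %| `|m|)%N.
  rewrite -Fp0; apply: contra (nonres ((numq z)%:~R / (denq z)%:~R)) => /eqP h.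
  have d0 : (denq z)%:~R != 0 :> 'F_l by rewrite Fp0.
  rewrite expr_div_n -subr_eq0 -[X in _ - X](mulfK (expf_neq0 2 d0)) -mulrBl.
  by rewrite -!rmorphXn -rmorphM -rmorphB /= h mul0r.
have m0 : m != 0 by apply: contraNneq lm => ->; rewrite dvdn0.
have d0 : (denq z)%:~R != 0 :> rat by rewrite intr_eq0 denq_neq0.
have -> : X ^+ 2 - c%:~R * Y ^+ 2 = (Y / (denq z)%:~R) ^+ 2 * m%:~R.
  have -> : X = (numq z)%:~R / (denq z)%:~R * Y by rewrite divq_num_den divfK.
  have -> : m%:~R = (numq z)%:~R ^+ 2 - c%:~R * (denq z)%:~R ^+ 2 :> rat by rewrite /m; ring.
  by field.
rewrite mulf_neq0 ?intr_eq0 ?sqrf_eq0 ?mulf_neq0 ?invr_eq0 //; split=> //.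
rewrite voddM ?intr_eq0 ?sqrf_eq0 ?mulf_neq0 ?invr_eq0 //.
rewrite (vodd_square (is_square_sqr _)) /vodd vrat_int //.
by rewrite logn_ndvd.
Qed.

End Valuation.

(** The sum of two fractions with odd numerators and denominators has an even
    numerator. *)
Lemma vrat2_add_units x y : x != 0 -> y != 0 -> x + y != 0 ->
  vrat 2 x = 0 -> vrat 2 y = 0 -> 0 < vrat 2 (x + y).
Proof.
move=> x0 y0 s0 vx vy; have p2 : prime 2 by [].
have [nx dx] := vrat_unit p2 x0 vx; have [ny dy] := vrat_unit p2 y0 vy.
have nd (z : rat) : (denq z)%:~R != 0 :> rat by rewrite intr_eq0 denq_neq0.
pose n : int := numq x * denq y + numq y * denq x.
have e : x + y = n%:~R / (denq x * denq y)%:~R.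
  rewrite -[x in LHS]divq_num_den -[y in LHS]divq_num_den /n.
  by field; rewrite !nd.
have n0 : n != 0.
  by apply: contraNneq s0 => n0; rewrite e n0 mul0r.
rewrite e vrat_frac ?mulf_neq0 ?denq_neq0 // [logn 2 `|_ * _|]logn_ndvd; last first.
  by rewrite abszM Euclid_dvdM // negb_or dx.
rewrite subr0 ltz_nat logn_gt0 mem_primes absz_gt0 n0 /=.
by move: nx dx ny dy; rewrite !dvdn2 !negbK /n odd_abszD !abszM !oddM => -> -> -> ->.
Qed.

Lemma even_logn_square (n : nat) : (0 < n)%N ->
  (forall l, prime l -> ~~ odd (logn l n)) -> exists m, n = (m ^ 2)%N.
Proof.
move=> n0 ev; exists (\prod_(f <- prime_decomp n) f.1 ^ f.2./2)%N.
rewrite {1}(prod_prime_decomp n0) (big_morph (expn^~ 2) (fun a b => expnMn a b 2) (exp1n 2)).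
rewrite big_seq [RHS]big_seq.
apply: eq_bigr => f; rewrite prime_decompE => /mapP[l].
rewrite mem_primes => /and3P[l_prime _ _] -> /=.
by rewrite -expnM muln2 -[in LHS](odd_double_half (logn l n)) (negPf (ev l l_prime)).
Qed.

Lemma rat_square x : 0 < x -> (forall l, prime l -> vodd l x = false) -> is_square x.
Proof.
move=> x0 ev; have n0 : numq x != 0 by rewrite numq_eq0 gt_eqF.
have [|l pl|m em] := @even_logn_square (`|numq x| * `|denq x|)%N.
- by rewrite muln_gt0 !absz_gt0 n0 denq_neq0.
- rewrite lognM ?absz_gt0 ?denq_neq0 // oddD.
  by have := ev l pl; rewrite /vodd /vrat odd_abszD abszN !absz_nat => ->.
have d0 : (denq x)%:~R != 0 :> rat by rewrite intr_eq0 denq_neq0.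
exists (m%:R / (denq x)%:~R); rewrite expr_div_n -natrX -em natrM.
rewrite -[x in LHS]divq_num_den !pmulrn !gez0_abs ?denq_ge0 ?numq_ge0 ?ltW //.
by field.
Qed.

(** * Quadratic non-residues *)

Section NonResidues.
Variable l : nat.
Hypotheses (l_prime : prime l) (l_odd : odd l).

Let Fermat (t : 'F_l) : t ^+ l = t.
Proof. by rewrite -[X in t ^+ X](card_Fp l_prime) expf_card. Qed.

Let two_neq0 : 2%:R != 0 :> 'F_l.
Proof.
rewrite -(dvdn_pcharf (pchar_Fp l_prime)); apply: contraL l_odd => l2.
have := dvdn_leq (isT : (0 < 2)%N) l2; have := prime_gt1 l_prime.
by case: (l) => [|[|[|]]].
Qed.

Let opp_fixed (t : 'F_l) : t = - t -> t = 0.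
Proof.
move/eqP; rewrite -subr_eq0 opprK -mulr2n -mulr_natl mulf_eq0 (negPf two_neq0).
by move/eqP.
Qed.

(** By Fermat, [w = w ^+ l = w * (w ^+ m) ^+ j = - w]. *)
Let no_root (w : 'F_l) m j : l = (m * j).+1 -> odd j -> w ^+ m = -1 -> False.
Proof.
move=> el oj e; have : w = - w.
  rewrite -{1}(Fermat w); have -> : w ^+ l = w ^+ (m * j).+1 by congr (_ ^+ _).
  by rewrite exprSr exprM e -signr_odd oj mulN1r.
move/opp_fixed => w0; move: e; rewrite w0; case: m el => [el|m _].
  by move: l_odd l_prime; rewrite el.
by move/eqP; rewrite expr0n eq_sym oppr_eq0 oner_eq0.
Qed.

Lemma opp1_nonresidue : (l %% 4 = 3)%N -> forall t : 'F_l, t ^+ 2 != -1.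
Proof.
move=> l3 t; apply/eqP; apply: (@no_root t 2 (l %/ 4 * 2).+1).
  by rewrite {1}(divn_eq l 4) l3; lia.
by rewrite /= oddM andbF.
Qed.

(** For [l = 8 * k + 5] some unit [x] is not a root of the polynomial
    [X ^+ (4 * k + 2) - 1]; then [x ^+ (4 * k + 2) = -1]. *)
Lemma sqrt_opp1 : (l %% 8 = 5)%N -> exists i : 'F_l, i ^+ 2 = -1.
Proof.
move=> l5; pose k := (l %/ 8)%N; have el : l = (k * 8 + 5)%N by rewrite {1}(divn_eq l 8) l5.
pose n := (k * 4 + 2)%N.
have [|] := boolP [forall x : 'F_l, (x != 0) ==> (x ^+ n == 1)].
  move/forallP => all1; pose rs := enum [pred x : 'F_l | x != 0].
  have : (size rs < size ('X^n - 1 : {poly 'F_l})%R)%N.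
    apply: max_poly_roots; rewrite ?enum_uniq //.
      by rewrite -size_poly_eq0 size_XnsubC // /n addn2.
    apply/allP => x; rewrite mem_enum inE => x0; rewrite /root !hornerE subr_eq0.
    exact: (implyP (all1 x)).
  rewrite size_XnsubC ?/n ?addn2 // -cardE.
  have := cardC1 (0 : 'F_l); rewrite card_Fp // => ->; lia.
rewrite negb_forall => /existsP[x]; rewrite negb_imply => /andP[x0 xn].
exists (x ^+ (k * 2 + 1)); apply/eqP.
have : (x ^+ n - 1) * (x ^+ n + 1) = 0.
  rewrite -subr_sqr expr1n -exprM; apply/eqP; rewrite subr_eq0; apply/eqP.
  apply: (mulIf x0); rewrite mul1r -exprSr -[RHS]Fermat; congr (_ ^+ _); lia.
move/eqP; rewrite mulf_eq0 subr_eq0 (negPf xn) /= addr_eq0 -exprM.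
by have -> : ((k * 2 + 1) * 2 = n)%N by lia.
Qed.

(** If [i ^+ 2 = -1] and [t ^+ 2] is [2] or [-2], then [(1 + i) / t] is an
    eighth root of unity, whereas [8] does not divide [l - 1]. *)
Lemma two_nonresidue : (l %% 8 = 5)%N -> forall t : 'F_l, t ^+ 2 != 2%:R /\ t ^+ 2 != - 2%:R.
Proof.
move=> l5 t; have [i i2] := sqrt_opp1 l5.
suff h : t ^+ 4 != 4%:R.
  split; apply: contraNneq h => e.
    by rewrite (exprM t 2 2 : t ^+ 4 = _) e; apply/eqP; ring.
  by rewrite (exprM t 2 2 : t ^+ 4 = _) e; apply/eqP; ring.
apply/eqP => t4; have t0 : t != 0.
  apply: contraNneq two_neq0 => t0; move/eqP: t4; rewrite t0 expr0n eq_sym.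
  by have -> : 4%:R = 2%:R * 2%:R :> 'F_l by [ring]; rewrite mulf_eq0 orbb.
pose w := (1 + i) / t.
have w4 : w ^+ 4 = -1.
  rewrite /w expr_div_n t4; have -> : (1 + i) ^+ 4 = - 4%:R.
    have -> : (1 + i) ^+ 4 = ((1 + i ^+ 2) + 2%:R * i) ^+ 2 by ring.
    rewrite i2 subrr add0r exprMn i2; ring.
  by rewrite mulNr divff //; have -> : 4%:R = 2%:R * 2%:R :> 'F_l by [ring]; rewrite mulf_neq0.
apply: (@no_root w 4 (l %/ 8 * 2).+1) w4; last by rewrite /= oddM andbF.
by rewrite {1}(divn_eq l 8) l5; lia.
Qed.

End NonResidues.

(** * Heights on a curve [y^2 = x^3 + s x^2 + m x] *)

(** Growth of order [k] in [M]: the constants in the height inequalities are never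
    computed, only propagated through sums and products. *)
Section Domination.
Variables (I : Type) (M : I -> rat).
Implicit Types (f g : I -> rat) (k : nat).

Definition dominated k f : Prop :=
  exists2 C, 0 <= C & forall i, `|f i| <= C * M i ^+ k.

Lemma dominated_add k f g :
  dominated k f -> dominated k g -> dominated k (fun i => f i + g i).
Proof.
move=> [C C0 hC] [D D0 hD]; exists (C + D); first exact: addr_ge0.
by move=> i; rewrite mulrDl (le_trans (ler_normD _ _)) ?lerD.
Qed.

Lemma dominated_mul k k' f g :
  dominated k f -> dominated k' g -> dominated (k + k') (fun i => f i * g i).
Proof.
move=> [C C0 hC] [D D0 hD]; exists (C * D); first exact: mulr_ge0.
by move=> i; rewrite normrM exprD mulrACA ler_pM.
Qed.

Lemma dominated_scale k c f : dominated k f -> dominated k (fun i => c * f i).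
Proof.
move=> [C C0 hC]; exists (`|c| * C); first exact: mulr_ge0.
by move=> i; rewrite normrM -mulrA ler_wpM2l.
Qed.

Lemma dominated_sqrt k f g : (forall i, 0 <= M i) -> (forall i, f i ^+ 2 = g i) ->
  dominated (k + k) g -> dominated k f.
Proof.
move=> M0 fg [C C0 hC]; exists (C + 1); first exact: addr_ge0.
move=> i; have Mk : 0 <= M i ^+ k by rewrite exprn_ge0.
rewrite -(@ler_pXn2r _ 2) ?nnegrE ?mulr_ge0 ?addr_ge0 // -normrX fg.
apply: le_trans (hC i) _; rewrite exprMn -exprM muln2 -addnn ler_wpM2r ?exprn_ge0 //.
nra.
Qed.

End Domination.

Definition height_rat (x : rat) : nat := maxn `|numq x| `|denq x|.

(** A fraction that is not in lowest terms overestimates the height. *)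
Lemma height_frac_le (n d : int) : d != 0 ->
  (height_rat (n%:~R / d%:~R) <= maxn `|n| `|d|)%N.
Proof.
move=> d0; set x := _ / _.
have e : (numq x * d = n * denq x)%R.
  by apply: (@intr_inj rat); rewrite !rmorphM /= numqE /x mulrAC divfK ?intr_eq0.
have /(congr1 absz) := e; rewrite !abszM => {}e.
have cop := coprime_num_den x.
have dd : (`|denq x| %| `|d|)%N.
  by rewrite -(Gauss_dvdr _ (_ : coprime _ `|numq x|)) 1?coprime_sym // e dvdn_mull.
have dn : (`|numq x| %| `|n|)%N by rewrite -(Gauss_dvdl _ cop) -e dvdn_mulr.
rewrite /height_rat geq_max !leq_max; apply/andP; split; last first.
  by rewrite (dvdn_leq _ dd) ?orbT // absz_gt0.
have [n0|n0] := posnP `|n|%N; last by rewrite (dvdn_leq n0 dn).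
move/eqP: n0; rewrite absz_eq0 => /eqP n0.
by rewrite /x n0 mul0r -[0]/(0%:~R) numq_int.
Qed.

Lemma height_rat_gt0 x : (0 < height_rat x)%N.
Proof. by rewrite leq_max orbC absz_gt0 denq_neq0. Qed.

Lemma norm_num_le_height x : `|(numq x)%:~R : rat| <= (height_rat x)%:R.
Proof. by rewrite -intr_norm -abszE -pmulrn ler_nat leq_maxl. Qed.

Lemma norm_den_le_height x : `|(denq x)%:~R : rat| <= (height_rat x)%:R.
Proof. by rewrite -intr_norm -abszE -pmulrn ler_nat leq_maxr. Qed.

Lemma integral_of_square (z : rat) (n : int) : z ^+ 2 = n%:~R -> z = (numq z)%:~R.
Proof.
move=> e; have h : (numq z * numq z = n * (denq z * denq z))%R.
  apply: (@intr_inj rat); rewrite !rmorphM /= -e !numqE; ring.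
have /(congr1 absz) := h; rewrite !abszM => {}h.
have d1 : `|denq z|%N = 1%N.
  apply/eqP; rewrite -dvdn1; have cop : coprime `|denq z| `|numq z|.
    by rewrite coprime_sym coprime_num_den.
  rewrite -(Gauss_dvdr 1 cop) -(Gauss_dvdr _ cop) muln1 h.
  by rewrite mulnA dvdn_mull.
rewrite -[LHS]divq_num_den; have -> : denq z = 1 by rewrite -absz_denq d1.
by rewrite divr1.
Qed.

Section Heights.
Variables (s m : int) (E : ellCurve rat).
Hypotheses (E2 : ec2 E = s%:~R) (E4 : ec4 E = m%:~R) (E6 : ec6 E = 0).

Let wcubicE x : wcubic E x = x * (x ^+ 2 + s%:~R * x + m%:~R).
Proof. by rewrite /wcubic E2 E4 E6; ring. Qed.

Lemma double_abscissa x y x' y' (h : y ^+ 2 = wcubic E x) (h' : y' ^+ 2 = wcubic E x') :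
  point h *+ 2 = point h' ->
  4%:R * (x * (x ^+ 2 + s%:~R * x + m%:~R)) * x' = (x ^+ 2 - m%:~R) ^+ 2.
Proof.
move/point_add => [l [_ l2 ->]]; rewrite -wcubicE -h.
transitivity ((l * (y + y)) ^+ 2 - 4%:R * y ^+ 2 * (s%:~R + 2%:R * x)).
  by rewrite E2; ring.
by rewrite l2 h wcubicE E2 E4; ring.
Qed.

Lemma sum_abscissa x1 y1 x2 y2 x3 y3 (h1 : y1 ^+ 2 = wcubic E x1)
    (h2 : y2 ^+ 2 = wcubic E x2) (h3 : y3 ^+ 2 = wcubic E x3) :
  point h1 + point h2 = point h3 ->
  x3 * (x1 - x2) ^+ 2 = (x1 + x2) * (x1 * x2 + m%:~R) + 2%:R * s%:~R * x1 * x2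
    - 2%:R * y1 * y2.
Proof.
move/point_add => [l [l1 _ ->]].
transitivity ((l * (x1 - x2)) ^+ 2 - (s%:~R + x1 + x2) * (x1 - x2) ^+ 2).
  by rewrite E2; ring.
rewrite -l1; transitivity (y1 ^+ 2 + y2 ^+ 2 - 2%:R * y1 * y2
  - (s%:~R + x1 + x2) * (x1 - x2) ^+ 2); first by ring.
by rewrite h1 h2 !wcubicE; ring.
Qed.

Definition height (P : ecpoint E) : nat :=
  if ecpoint_val P is Some (x, _) then height_rat x else 1.

Lemma height_gt0 P : (0 < height P)%N.
Proof. by case: P => [[[x y]|] ?] //; apply: height_rat_gt0. Qed.

Let Delta : int := s ^+ 2 - 4%:R * m.

Lemma height_disc_neq0 : 4%:R * Delta * m ^+ 2 != 0.
Proof.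
have := ec_disc E; rewrite E2 E4 E6 -(@intr_eq0 rat) => d.
suff e : wdisc s%:~R m%:~R 0 = 4%:R * (4%:R * Delta * m ^+ 2)%:~R :> rat.
  by apply: contraNneq d => e'; rewrite e e' mulr0.
by rewrite /wdisc /Delta; ring.
Qed.

(** With [x = a / b] in lowest terms, [x(2P)] is the quotient of these two
    quartic forms. *)
Definition dup_num (a b : int) : int := (a ^+ 2 - m * b ^+ 2) ^+ 2.
Definition dup_den (a b : int) : int := 4%:R * (a * b * (a ^+ 2 + s * (a * b) + m * b ^+ 2)).

(** The cofactors of two Bezout identities between the forms, whose right-hand
    sides are multiples of [a ^+ 7] and of [b ^+ 7]. *)
Let U1 a b : int := 4%:R * Delta * a ^+ 3 - 4%:R * (2%:R * m * s * a + 3%:R * m ^+ 2 * b) * (a * b).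
Let V1 a b : int := 2%:R * m * Delta * a ^+ 2 * b
  + (2%:R * m * s * a + 3%:R * m ^+ 2 * b) * (a ^+ 2 - s * (a * b) + m * b ^+ 2).
Let U2 a b : int := 4%:R * Delta * b ^+ 3 - 4%:R * (3%:R * a + 2%:R * s * b) * (a * b).
Let V2 a b : int := 2%:R * Delta * a * b ^+ 2
  + (3%:R * a + 2%:R * s * b) * (a ^+ 2 - s * (a * b) + m * b ^+ 2).

Let bezout_a a b : dup_num a b * U1 a b + dup_den a b * V1 a b = 4%:R * Delta * a ^+ 7.
Proof. by rewrite /dup_num /dup_den /U1 /V1 /Delta; ring. Qed.

Let bezout_b a b :
  dup_num a b * U2 a b + dup_den a b * V2 a b = 4%:R * Delta * m ^+ 2 * b ^+ 7.
Proof. by rewrite /dup_num /dup_den /U2 /V2 /Delta; ring. Qed.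

(** A common divisor of the two forms divides both right-hand sides, and [a ^+ 7]
    and [b ^+ 7] are coprime. *)
Lemma dup_common_divisor (a b k : int) : coprime `|a| `|b| ->
  (k %| dup_num a b)%Z -> (k %| dup_den a b)%Z -> (`|k| <= `|(4%:R * Delta * m ^+ 2)%R|)%N.
Proof.
move=> cop /dvdzP[u eu] /dvdzP[v ev]; have K0 := height_disc_neq0.
apply: dvdn_leq; rewrite ?absz_gt0 //; set K := (_ * _)%R in K0 *.
have k1 : (`|k| %| `|K| * `|a| ^ 7)%N.
  rewrite -abszX -abszM.
  have -> : (K * a ^+ 7)%R = (k * (m ^+ 2 * (u * U1 a b + v * V1 a b)))%R.
    transitivity (m ^+ 2 * (4%:R * Delta * a ^+ 7)); first by rewrite /K; ring.
    by rewrite -(bezout_a a b) eu ev; ring.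
  by rewrite abszM dvdn_mulr.
have k2 : (`|k| %| `|K| * `|b| ^ 7)%N.
  rewrite -abszX -abszM -(bezout_b a b) eu ev.
  have -> : (u * k * U2 a b + v * k * V2 a b)%R = (k * (u * U2 a b + v * V2 a b))%R by ring.
  by rewrite abszM dvdn_mulr.
have cop7 : coprime (`|a| ^ 7) (`|b| ^ 7) by rewrite coprimeXl // coprimeXr.
have := dvdn_gcd `|k| (`|K| * `|a| ^ 7) (`|K| * `|b| ^ 7).
by rewrite k1 k2 -muln_gcdr (eqP cop7) muln1.
Qed.

Let cubic_dominated (c0 c1 c2 c3 : int) : dominated (fun x => (height_rat x)%:R) 3
  (fun x => (c0 * numq x ^+ 3 + c1 * numq x ^+ 2 * denq x + c2 * numq x * denq x ^+ 2
     + c3 * denq x ^+ 3)%:~R).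
Proof.
pose M x : rat := (height_rat x)%:R.
have da : dominated M 1 (fun x => (numq x)%:~R).
  by exists 1 => // x; rewrite mul1r expr1 norm_num_le_height.
have db : dominated M 1 (fun x => (denq x)%:~R).
  by exists 1 => // x; rewrite mul1r expr1 norm_den_le_height.
have := dominated_add (dominated_add (dominated_add
  (dominated_scale c0%:~R (dominated_mul da (dominated_mul da da)))
  (dominated_scale c1%:~R (dominated_mul da (dominated_mul da db))))
  (dominated_scale c2%:~R (dominated_mul da (dominated_mul db db))))
  (dominated_scale c3%:~R (dominated_mul db (dominated_mul db db))).
case=> C C0 hC; exists C => // x; apply: le_trans (hC x).
by rewrite le_eqVlt; apply/orP; left; apply/eqP; congr `|_|; ring.
Qed.

(** In the Bezout identities the cofactors are cubic, so one of the two forms is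
    at least of the order of the fourth power of the height. *)
Lemma dup_lower_bound : exists2 C : rat, 0 <= C & forall x (N : rat),
  `|(dup_num (numq x) (denq x))%:~R| <= N -> `|(dup_den (numq x) (denq x))%:~R| <= N ->
  (height_rat x)%:R ^+ 4 <= C * N.
Proof.
have ext (f : rat -> int) c0 c1 c2 c3 : (forall x, f x = c0 * numq x ^+ 3
    + c1 * numq x ^+ 2 * denq x + c2 * numq x * denq x ^+ 2 + c3 * denq x ^+ 3) ->
    exists2 C : rat, 0 <= C & forall x, `|(f x)%:~R| <= C * (height_rat x)%:R ^+ 3.
  move=> ef; have [C C0 hC] := cubic_dominated c0 c1 c2 c3.
  by exists C => // x; rewrite ef.
have [|C1 C10 h1] := ext (fun x => U1 (numq x) (denq x))
  (4%:R * Delta) (- (8%:R * m * s)) (- (12%:R * m ^+ 2)) 0.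
  by move=> x; rewrite /U1; ring.
have [|D1 D10 k1] := ext (fun x => V1 (numq x) (denq x))
  (2%:R * m * s) (2%:R * m * Delta + 3%:R * m ^+ 2 - 2%:R * m * s ^+ 2)
  (2%:R * m ^+ 2 * s - 3%:R * m ^+ 2 * s) (3%:R * m ^+ 3).
  by move=> x; rewrite /V1; ring.
have [|C2 C20 h2] := ext (fun x => U2 (numq x) (denq x)) 0 (- 12%:R) (- (8%:R * s)) (4%:R * Delta).
  by move=> x; rewrite /U2; ring.
have [|D2 D20 k2] := ext (fun x => V2 (numq x) (denq x))
  3%:R (2%:R * s - 3%:R * s) (2%:R * Delta + 3%:R * m - 2%:R * s ^+ 2) (2%:R * s * m).
  by move=> x; rewrite /V2; ring.
exists (C1 + D1 + (C2 + D2)); first by rewrite !addr_ge0.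
move=> x N hF hG; set M : rat := (height_rat x)%:R.
set a := numq x in hF hG *; set b := denq x in hF hG *.
have M1 : 1 <= M by rewrite ler1n height_rat_gt0.
have M3 : 0 < M ^+ 3 by rewrite exprn_gt0 // (lt_le_trans ltr01).
have N0 : 0 <= N := le_trans (normr_ge0 _) hF.
move: (dup_num a b) (dup_den a b) (bezout_a a b) (bezout_b a b) hF hG => F G eqa eqb hF hG.
have step (k c : int) (u v : int) (Cu Cv : rat) : k != 0 ->
    F * u + G * v = k * c ^+ 7 ->
    `|u%:~R| <= Cu * M ^+ 3 -> `|v%:~R| <= Cv * M ^+ 3 ->
    `|c%:~R : rat| ^+ 7 <= (Cu + Cv) * M ^+ 3 * N.
  move=> k0 e hu hv; apply: (@le_trans _ _ (`|k%:~R| * `|c%:~R : rat| ^+ 7)).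
    rewrite ler_peMl ?exprn_ge0 // -intr_norm -[1]/(1%:~R) ler_int.
    by rewrite -gtz0_ge1 normr_gt0.
  rewrite -normrX -normrM -!rmorphXn -rmorphM /= -e rmorphD !rmorphM /=.
  apply: le_trans (ler_normD _ _) _; rewrite !normrM !mulrDl lerD // mulrC ler_pM //.
have hK := height_disc_neq0; have hD : 4%:R * Delta != 0.
  by apply: contraNneq hK => ->; rewrite mul0r.
have s1 := step _ _ _ _ _ _ hD eqa (h1 x) (k1 x).
have s2 := step _ _ _ _ _ _ hK eqb (h2 x) (k2 x).
have s3 : M ^+ 7 <= `|a%:~R| ^+ 7 + `|b%:~R| ^+ 7.
  have [ab|ab] := leqP `|a| `|b|.
    have -> : M = `|b%:~R| by rewrite /M /height_rat (maxn_idPr ab) -intr_norm -abszE.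
    by rewrite lerDr exprn_ge0.
  have -> : M = `|a%:~R| by rewrite /M /height_rat (maxn_idPl (ltnW ab)) -intr_norm -abszE.
  by rewrite lerDl exprn_ge0.
rewrite -(ler_pM2r M3) -exprD; apply: le_trans s3 _.
apply: le_trans (lerD s1 s2) _; rewrite le_eqVlt; apply/orP; left; apply/eqP; ring.
Qed.

(** Bounding the cancellation in the quotient of the two forms leaves their
    lower bound for the height of the double. *)
Lemma height_double : exists C, forall P : ecpoint E, P *+ 2 != 0 ->
  (height P ^ 4 <= C * height (P *+ 2)%R)%N.
Proof.
have [C C0 hC] := dup_lower_bound.
pose K := absz (4%:R * Delta * m ^+ 2); pose C' : rat := C * K%:R.
exists (Num.bound C') => P P2.
have [P0|[x [y [h eP]]]] := ecpointP P; first by rewrite P0 mul0rn eqxx in P2.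
have y0 : y != 0 by rewrite -(double_point_eq0 h) -eP.
have [e|[x' [y' [h' eP']]]] := ecpointP (P *+ 2); first by rewrite e eqxx in P2.
rewrite eP' eP /height /=; have ex' : point h *+ 2 = point h' by rewrite -eP.
have {}ex' := double_abscissa ex'.
pose a := numq x; pose b := denq x; pose n := numq x'; pose d := denq x'.
have b0 : (b%:~R : rat) != 0 by rewrite intr_eq0 denq_neq0.
have d0 : (d%:~R : rat) != 0 by rewrite intr_eq0 denq_neq0.
have exA : x = a%:~R / b%:~R by rewrite divq_num_den.
have exn : x' = n%:~R / d%:~R by rewrite divq_num_den.
have FG : dup_num a b * d = dup_den a b * n.
  apply: (@intr_inj rat); apply: (mulIf (expf_neq0 4 (invr_neq0 b0))).
  apply: (mulIf (invr_neq0 d0)).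
  transitivity ((x ^+ 2 - m%:~R) ^+ 2); first by rewrite exA /dup_num; field; rewrite b0 d0.
  by rewrite -ex' exA exn /dup_den; field; rewrite b0 d0.
have cop : coprimez d n by rewrite coprimezE coprime_sym coprime_num_den.
have [k Gk] : exists k, dup_den a b = k * d.
  apply/dvdzP; rewrite -(Gauss_dvdzl _ cop) -FG; exact: dvdz_mull.
have Fk : dup_num a b = n * k.
  apply: (mulIf (denq_neq0 x')); rewrite -/d FG Gk; ring.
have kK : (`|k| <= K)%N.
  apply: (@dup_common_divisor a b); first exact: coprime_num_den.
    by rewrite Fk dvdz_mull.
  by rewrite Gk dvdz_mulr.
have bound (c : int) : (`|c| <= height_rat x')%N ->
    `|(k * c)%:~R : rat| <= K%:R * (height_rat x')%:R.
  by move=> hc; rewrite -natrM -intr_norm -abszE -pmulrn ler_nat abszM leq_mul.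
have := hC x (K%:R * (height_rat x')%:R).
rewrite -/a -/b Fk Gk [n * k]mulrC !bound ?leq_maxl ?leq_maxr // => /(_ isT isT) le.
rewrite -(ler_nat rat) natrX natrM; apply: le_trans le _.
by rewrite mulrA -/C' ler_wpM2r // ltW // archi_boundP // mulr_ge0.
Qed.

(** In the addition formula the only term that is not a polynomial in the
    abscissa is the ordinate [y]; but [y * b ^+ 2] is an integer whose square is a
    quartic form in the numerator and denominator of the abscissa. *)
Lemma height_translate (Q : ecpoint E) : exists K, forall P : ecpoint E,
  (height (P + Q)%R <= K * height P ^ 2)%N.
Proof.
have [->|[x0 [y0 [h0 eQ]]]] := ecpointP Q.
  by exists 1%N => P; rewrite addr0 mul1n -mulnn leq_pmull ?height_gt0.
pose X (P : ecpoint E) : rat := if ecpoint_val P is Some (x, _) then x else 0.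
pose Y (P : ecpoint E) : rat := if ecpoint_val P is Some (_, y) then y else 0.
pose a P := numq (X P); pose b P := denq (X P).
pose M P : rat := (height P)%:R.
have hM P : (height_rat (X P) <= height P)%N.
  by case: P => [[[x y]|] ?] //; rewrite /X /height_rat /= numq_int denq_int.
have da : dominated M 1 (fun P => (a P)%:~R).
  exists 1 => // P; rewrite mul1r expr1 (le_trans (norm_num_le_height _)) //.
  by rewrite ler_nat.
have db : dominated M 1 (fun P => (b P)%:~R).
  exists 1 => // P; rewrite mul1r expr1 (le_trans (norm_den_le_height _)) //.
  by rewrite ler_nat.
pose yb P : rat := Y P * (b P)%:~R ^+ 2.
pose q P : int := (b P) * (a P) * (a P * a P + s * (a P * b P) + m * (b P * b P)).
have q2 P : yb P ^+ 2 = (q P)%:~R.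
  have b0 : (b P)%:~R != 0 :> rat by rewrite intr_eq0 denq_neq0.
  have ea : (a P)%:~R = X P * (b P)%:~R by rewrite numqE.
  have eY : Y P ^+ 2 = X P * (X P ^+ 2 + s%:~R * X P + m%:~R).
    case: P {b0 ea} => [[[x y]|] hP]; last by rewrite /X /Y /=; ring.
    by rewrite -wcubicE; apply/eqP: hP.
  rewrite /yb exprMn eY /q !(rmorphM, rmorphD) /= ea; ring.
have dq : dominated M (2 + 2) (fun P => (q P)%:~R).
  have := dominated_mul (dominated_mul db da) (dominated_add (dominated_add
    (dominated_mul da da) (dominated_scale s%:~R (dominated_mul da db)))
    (dominated_scale m%:~R (dominated_mul db db))).
  case=> C C0 hC; exists C => // P; apply: le_trans (hC P).
  by rewrite /q !(rmorphM, rmorphD).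
have M0 P : 0 <= M P by apply: ler0n.
have dy := dominated_sqrt M0 q2 dq.
pose z P := numq (yb P); have ez P : yb P = (z P)%:~R := integral_of_square (q2 P).
set a0 := numq x0; set b0 := denq x0; set c0 := numq y0; set d0 := denq y0.
pose N P : int := d0 * ((a P * b0 + a0 * b P) * (a P * a0 + m * b P * b0)
  + 2%:R * s * a P * a0 * b P * b0) - 2%:R * c0 * z P * b0 ^+ 2.
pose D P : int := (a P * b0 - a0 * b P) ^+ 2 * d0.
have [CN CN0 dN] : dominated M 2 (fun P => (N P)%:~R).
  have := dominated_add (dominated_add
     (dominated_scale d0%:~R (dominated_mul
       (dominated_add (dominated_scale b0%:~R da) (dominated_scale a0%:~R db))
       (dominated_add (dominated_scale a0%:~R da) (dominated_scale (m * b0)%:~R db))))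
     (dominated_scale (d0 * (2%:R * s * a0 * b0))%:~R (dominated_mul da db)))
     (dominated_scale (- (2%:R * c0 * b0 ^+ 2))%:~R dy).
  case=> C C0 hC; exists C => // P; apply: le_trans (hC P).
  by rewrite ez le_eqVlt; apply/orP; left; apply/eqP; congr `|_|; rewrite /N; ring.
have [CD CD0 dD] : dominated M 2 (fun P => (D P)%:~R).
  have e := dominated_add (dominated_scale b0%:~R da) (dominated_scale (- a0)%:~R db).
  have := dominated_scale d0%:~R (dominated_mul e e).
  case=> C C0 hC; exists C => // P; apply: le_trans (hC P).
  by rewrite le_eqVlt; apply/orP; left; apply/eqP; congr `|_|; rewrite /D; ring.
exists (Num.bound CN + Num.bound CD + height Q + height (Q *+ 2)%R + 1)%N => P.
have H1 : (0 < height P ^ 2)%N by rewrite expn_gt0 height_gt0.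
have big k : (k <= height Q \/ k <= height (Q *+ 2)%R \/ k <= 1)%N ->
    (k <= (Num.bound CN + Num.bound CD + height Q + height (Q *+ 2)%R + 1) * height P ^ 2)%N.
  move=> hk; apply: leq_trans (leq_pmulr _ H1); lia.
have [P0|[x [y [h eP]]]] := ecpointP P; first by rewrite {1}P0 add0r; apply: big; left.
have [e|[x3 [y3 [h3 e]]]] := ecpointP (P + Q).
  by rewrite e; apply: big; right; right.
have [ex|ne] := eqVneq x x0.
  have /orP[/eqP ey|/eqP ey] : (y == y0) || (y == - y0).
    by rewrite -eqf_sqr h h0 ex.
    have PQ : P = Q by rewrite eP eQ; apply: val_inj; rewrite /= ex ey.
    by rewrite {1}PQ -mulr2n; apply: big; right; left.
  have PQ : P + Q = 0.
    by apply/eqP; rewrite addr_eq0 eP eQ; apply/eqP/val_inj; rewrite /= ex ey.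
  by rewrite e in PQ.
have eX : X P = x by rewrite /X eP. 
have eY : Y P = y by rewrite /Y eP.
have b0' : b0%:~R != 0 :> rat by rewrite intr_eq0 denq_neq0.
have d0' : d0%:~R != 0 :> rat by rewrite intr_eq0 denq_neq0.
have bP : (b P)%:~R != 0 :> rat by rewrite intr_eq0 denq_neq0.
have exP : x = (a P)%:~R / (b P)%:~R by rewrite -eX divq_num_den.
have ex0 : x0 = a0%:~R / b0%:~R by rewrite divq_num_den.
have ey0 : y0 = c0%:~R / d0%:~R by rewrite divq_num_den.
have eyP : y = (z P)%:~R / (b P)%:~R ^+ 2.
  by rewrite -ez /yb eY mulfK // expf_neq0.
have DN : x3 * (D P)%:~R = (N P)%:~R.
  have ea := e; rewrite eP eQ in ea; have {}ea := sum_abscissa ea.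
  pose d := (x - x0) ^+ 2; rewrite -/d in ea.
  have -> : (D P)%:~R = d * ((b P)%:~R ^+ 2 * b0%:~R ^+ 2 * d0%:~R).
    by rewrite /d exP ex0 /D; field; rewrite bP b0'.
  by rewrite mulrA ea exP ex0 ey0 eyP /N; field; rewrite bP b0' d0'.
have D0 : D P != 0.
  rewrite -(intr_eq0 rat); apply: contraNneq ne => D0; rewrite exP ex0 -subr_eq0.
  have -> : (a P)%:~R / (b P)%:~R - a0%:~R / b0%:~R =
      (a P * b0 - a0 * b P)%:~R / ((b P)%:~R * b0%:~R) :> rat by field; rewrite bP b0'.
  move/eqP: D0; rewrite /D rmorphM rmorphXn /= mulf_eq0 (negPf d0') orbF sqrf_eq0.
  by move=> /eqP ->; rewrite mul0r.
have -> : height (P + Q) = height_rat x3 by rewrite e.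
have -> : x3 = (N P)%:~R / (D P)%:~R by rewrite -DN mulfK // intr_eq0.
apply: leq_trans (height_frac_le _ D0) _.
have toN (C : rat) (k : int) : 0 <= C -> `|k%:~R : rat| <= C * M P ^+ 2 ->
    (`|k| <= Num.bound C * height P ^ 2)%N.
  move=> C0; rewrite -intr_norm -abszE -pmulrn => le.
  rewrite -(ler_nat rat) natrM natrX; apply: le_trans le _.
  by rewrite ler_wpM2r ?exprn_ge0 // ltW // archi_boundP.
rewrite geq_max; apply/andP; split.
  by apply: leq_trans (toN _ _ CN0 (dN P)) _; rewrite leq_mul2r; apply/orP; right; lia.
by apply: leq_trans (toN _ _ CD0 (dD P)) _; rewrite leq_mul2r; apply/orP; right; lia.
Qed.

Lemma height_finite B : exists s' : seq (ecpoint E), forall P, (height P <= B)%N -> P \in s'.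
Proof.
have /choice[R hR] : forall x : rat, exists R : ecpoint E, forall P y,
    ecpoint_val P = Some (x, y) -> P = R \/ P = - R.
  move=> x; have [[R [y hR]]|no] :=
    pselect (exists (R : ecpoint E) y, ecpoint_val R = Some (x, y)); last first.
    by exists 0 => P y e; case: no; exists P, y.
  exists R => P y' e; have hP := ecpoint_on P; have hR' := ecpoint_on R.
  rewrite e /= in hP; rewrite hR /= -(eqP hP) eqf_sqr in hR'.
  case/orP: hR' => /eqP ey; [left|right]; apply: val_inj; rewrite /= e hR ey //.
  by rewrite /= opprK.
pose xs : seq rat := [seq n%:R / d%:R | n <- iota 0 B.+1, d <- iota 0 B.+1].
pose Rs := map R (xs ++ map -%R xs).
exists (0 :: Rs ++ map -%R Rs) => P hP.
have [->|[x [y [h e]]]] := ecpointP P; first by rewrite inE eqxx.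
have hx : (height_rat x <= B)%N by move: hP; rewrite e.
have xin : x \in xs ++ map -%R xs.
  move: hx; rewrite /height_rat geq_max => /andP[hn hd].
  have xabs : `|x| \in xs.
    apply/allpairsP; exists (`|numq x|%N, `|denq x|%N); rewrite !mem_iota /= !ltnS hn hd.
    split=> //; rewrite -{1}[x]divq_num_den normrM normrV ?unitfE ?intr_eq0 ?denq_neq0 //.
    by rewrite -!intr_norm -!abszE -!pmulrn.
  rewrite mem_cat; case: (ger0P x) xabs => [_ ->|_ xabs] //.
  by apply/orP; right; rewrite -[x]opprK map_f.
have Rin : R x \in Rs by apply: map_f.
have [|->|->] := hR x P y; first by rewrite e.
  by rewrite inE mem_cat Rin orbT.
by rewrite inE mem_cat map_f ?orbT.
Qed.

(** The three properties of the height turn the finiteness of [E(Q) / 2E(Q)]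
    into finite generation. *)
Lemma descent_points_fin_gen (R : seq (ecpoint E)) :
  (forall P, exists2 Q, Q \in R & exists S, P = Q + S *+ 2) -> fin_gen (ecpoint E).
Proof.
have [C hC] := height_double.
move=> hR; apply: (descent_fin_gen hR hC height_translate height_finite).
Qed.

End Heights.

(** * Points of order two and representatives of classes *)

Section TwoTorsion.
Variables (F : fieldType) (E : ellCurve F) (e1 e2 e3 : F).
Hypotheses (E2 : ec2 E = - (e1 + e2 + e3)) (E4 : ec4 E = e1 * e2 + e1 * e3 + e2 * e3)
  (E6 : ec6 E = - (e1 * e2 * e3)).

Definition root_point e (h : wcubic E e = 0) : ecpoint E := point (root_point_on h).

Lemma root_point_double e (h : wcubic E e = 0) : root_point h *+ 2 = 0.
Proof. by apply/eqP; rewrite double_point_eq0. Qed.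

Variables (h1 : wcubic E e1 = 0) (h2 : wcubic E e2 = 0) (h3 : wcubic E e3 = 0).

Definition two_torsion_points : seq (ecpoint E) :=
  [:: 0; root_point h1; root_point h2; root_point h3].

Lemma two_torsion_mem P : P *+ 2 = 0 -> P \in two_torsion_points.
Proof.
have [->|[x [y [h ->]]]] := ecpointP P; first by rewrite inE eqxx.
move/eqP; rewrite double_point_eq0 => /eqP y0.
have /eqP : wcubic E x = 0 by rewrite -h y0 expr0n.
rewrite (wcubic_split E2 E4 E6) !mulf_eq0 !subr_eq0 => hx.
have at_root e (he : wcubic E e = 0) : x = e -> point h = root_point he.
  by move=> ex; apply: val_inj; rewrite /= y0 ex.
rewrite !inE; case/orP: hx => [/orP[]|] /eqP ex.
- by rewrite (at_root _ h1 ex) eqxx orbT.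
- by rewrite (at_root _ h2 ex) eqxx !orbT.
- by rewrite (at_root _ h3 ex) eqxx !orbT.
Qed.

Lemma torsion_klein_curve : (forall P : ecpoint E, P \in torsion (G:=ecpoint E) -> P *+ 2 = 0) ->
  zmod_isog (torsion_subgroup (ecpoint E)) ('Z_2 * 'Z_2)%type.
Proof.
move=> tors2; have [d12 d13 d23] := roots_distinct E2 E4 E6.
have neq e e' (he : wcubic E e = 0) (he' : wcubic E e' = 0) :
    e != e' -> root_point he != root_point he'.
  by apply: contraNneq => /(congr1 val) /= [->].
have D1 := root_point_double h1; have D2 := root_point_double h2.
apply: (torsion_klein D1 D2) => //; first exact: neq.
move=> P /tors2 /two_torsion_mem; rewrite !inE.
suff -> : root_point h3 = root_point h1 + root_point h2 by [].
have : root_point h1 + root_point h2 \in two_torsion_points.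
  by apply: two_torsion_mem; rewrite mulrnDl D1 D2 addr0.
rewrite !inE => /or4P[] /eqP e //.
- have : root_point h1 = root_point h2.
    by apply: (addIr (root_point h2)); rewrite e -mulr2n D2.
  by move/eqP; rewrite (negPf (neq _ _ _ _ d12)).
- by move/eqP: e; rewrite -subr_eq0 addrC addKr.
- by move/eqP: e; rewrite -subr_eq0 addrK.
Qed.

End TwoTorsion.

(** Every element is brought into [N] by a translation in [Ts], and inside [N] the
    invariant [beta], with values in [L] or zero, separates the classes modulo
    doubles: one element of [N] is chosen for each value taken. *)
Lemma class_representatives (G : zmodType) (Ts : seq G) (N : G -> Prop)
    (beta : G -> bool * bool) (L : seq (bool * bool)) :
  (forall x, exists x' t, [/\ t \in Ts, x = x' + t & x' = 0 \/ N x']) ->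
  (forall x y, N x -> N y -> beta x = beta y -> exists z, x = y + z *+ 2) ->
  (forall x, N x -> beta x = (false, false) -> exists z, x = z *+ 2) ->
  (forall x, N x -> beta x \in (false, false) :: L) ->
  exists R : seq G, (size R <= (size L).+1)%N /\
    forall x, exists y t z, [/\ y \in R, t \in Ts & x = y + t + z *+ 2].
Proof.
move=> hN same zero hL.
have /choice[r hr] : forall b, exists y, forall x, N x -> beta x = b -> N y /\ beta y = b.
  move=> b; have [[y hy]|no] := pselect (exists y, N y /\ beta y = b).
    by exists y.
  by exists 0 => x Nx bx; case: no; exists x.
exists (0 :: map r L); split; first by rewrite /= size_map.
move=> x; have [x' [t [tT -> [->|Nx]]]] := hN x.
  by exists 0, t, 0; rewrite inE eqxx mul0rn !addr0.
have := hL _ Nx; rewrite inE => /orP[/eqP b0|bL].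
  have [z ->] := zero _ Nx b0; exists 0, t, z; rewrite inE eqxx; split=> //.
  by rewrite add0r addrC.
have [Ny ey] := hr _ _ Nx erefl; have [z ->] := same _ _ Nx Ny (esym ey).
by exists (r (beta x')), t, z; rewrite inE map_f ?orbT // addrAC.
Qed.

(** * The curves [y^2 = x (x + A) (x + B)] with [A = +-p], [B = +-q] *)

Section TwinCurve.
Variables (sigma : bool) (p q : nat).
Hypotheses (p_prime : prime p) (q_prime : prime q) (hpq : q = (p + 2)%N).

Local Notation E := (twin_curve sigma p_prime q_prime hpq).
Definition twinA : rat := (-1) ^+ sigma * p%:R.
Definition twinB : rat := (-1) ^+ sigma * q%:R.
Local Notation A := twinA.
Local Notation B := twinB.

Lemma twin_odd : odd p /\ odd q.
Proof.
case: (even_prime p_prime) => [p2|op]; last by rewrite hpq oddD op.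
by move: q_prime; rewrite hpq p2.
Qed.

Let pq_neq : [/\ p != q, p != 2%N & q != 2%N].
Proof. by have [op oq] := twin_odd; split; apply/eqP; lia. Qed.

Let p_gt0 : (0 < p)%N := prime_gt0 p_prime.
Let q_gt0 : (0 < q)%N := prime_gt0 q_prime.

Lemma vrat_signed l n (l_prime : prime l) : prime n ->
  vrat l ((-1) ^+ sigma * n%:R) = (l == n)%:Z.
Proof.
move=> n_prime; have n0 := prime_gt0 n_prime.
by case: sigma; rewrite ?mulN1r ?vratN ?mul1r vrat_nat // logn_prime.
Qed.

Let vA l : prime l -> vrat l A = (l == p)%:Z.
Proof. by move=> pl; apply: vrat_signed. Qed.

Let vB l : prime l -> vrat l B = (l == q)%:Z.
Proof. by move=> pl; apply: vrat_signed. Qed.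

Let BA : B = A + (-1) ^+ sigma * 2%:R.
Proof. by rewrite /A /B hpq natrD mulrDr. Qed.

Let A0 : A != 0.
Proof. by rewrite mulf_neq0 ?signr_eq0 // pnatr_eq0 -lt0n. Qed.

Let B0 : B != 0.
Proof. by rewrite mulf_neq0 ?signr_eq0 // pnatr_eq0 -lt0n. Qed.

Let S0 : (-1) ^+ sigma * 2%:R != 0 :> rat.
Proof. by rewrite mulf_neq0 ?signr_eq0. Qed.

Lemma twin_split : [/\ ec2 E = - (0 + - A + - B), ec4 E = 0 * - A + 0 * - B + - A * - B
  & ec6 E = - (0 * - A * - B)].
Proof. by split; rewrite /= /A /B; case: sigma; ring. Qed.

Lemma twin_integral_coefs :
  ec2 E = ((-1) ^+ sigma * (p%:Z + q%:Z))%:~R /\ ec4 E = (p%:Z * q%:Z)%:~R.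
Proof. by rewrite /= !rmorphM rmorph_sign rmorphD /= -!pmulrn. Qed.

Let cubicE x : wcubic E x = x * (x + A) * (x + B).
Proof. exact: twin_cubicE. Qed.

Lemma twin_root0 : wcubic E 0 = 0.
Proof. by rewrite cubicE !mul0r. Qed.
Lemma twin_rootA : wcubic E (- A) = 0.
Proof. by rewrite cubicE addNr mulr0 mul0r. Qed.
Lemma twin_rootB : wcubic E (- B) = 0.
Proof. by rewrite cubicE addNr mulr0. Qed.

Definition twin_torsion : seq (ecpoint E) := two_torsion_points twin_root0 twin_rootA twin_rootB.

Lemma twin_two_torsion P : P *+ 2 = 0 -> P \in twin_torsion.
Proof. by have [e2 e4 e6] := twin_split; exact: two_torsion_mem. Qed.

Section Factors.
Variables (x y : rat).
Hypotheses (h : y ^+ 2 = wcubic E x) (y0 : y != 0).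

Lemma twin_factors_neq0 : [/\ x != 0, x + A != 0 & x + B != 0].
Proof.
have : x * (x + A) * (x + B) != 0 by rewrite -cubicE -h sqrf_eq0.
by rewrite !mulf_eq0 !negb_or => /andP[/andP[]].
Qed.

Lemma twin_factors_square : is_square (x * (x + A) * (x + B)).
Proof. by exists y; rewrite h cubicE. Qed.

Lemma vodd_x l : prime l -> l != p -> l != q -> vodd l x = false.
Proof.
move=> pl lp lq; have [x0 xA xB] := twin_factors_neq0.
apply: (vodd_factor pl x0 xA xB A0 B0); rewrite ?vA ?vB ?(negPf lp) ?(negPf lq) //.
exact: twin_factors_square.
Qed.

Lemma vodd_xA l : prime l -> l != 2%N -> l != p -> vodd l (x + A) = false.
Proof.
move=> pl l2 lp; have [x0 xA xB] := twin_factors_neq0.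
have eB : x + A + (-1) ^+ sigma * 2%:R = x + B by rewrite BA addrA.
have eA : x + A + - A = x by rewrite addrK.
apply: (@vodd_factor l pl _ (- A) ((-1) ^+ sigma * 2%:R)); rewrite ?eB ?eA ?oppr_eq0 //.
- by rewrite vratN vA // (negPf lp).
- by rewrite vrat_signed // (negPf l2).
- by have := twin_factors_square; rewrite [x * _]mulrC.
Qed.

Lemma vodd_xB l : prime l -> l != 2%N -> l != q -> vodd l (x + B) = false.
Proof.
move=> pl l2 lq; have [x0 xA xB] := twin_factors_neq0.
have eB : x + B + - ((-1) ^+ sigma * 2%:R) = x + A by rewrite BA; ring.
have eA : x + B + - B = x by rewrite addrK.
apply: (@vodd_factor l pl _ (- B) (- ((-1) ^+ sigma * 2%:R))); rewrite ?eB ?eA ?oppr_eq0 //.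
- by rewrite vratN vB // (negPf lq).
- by rewrite vratN vrat_signed // (negPf l2).
- have -> : (x + B) * x * (x + A) = x * (x + A) * (x + B) by ring.
  exact: twin_factors_square.
Qed.

Lemma vodd_factors l : prime l -> vodd l x (+) vodd l (x + A) (+) vodd l (x + B) = false.
Proof.
move=> pl; have [x0 xA xB] := twin_factors_neq0.
by rewrite -!voddM ?mulf_neq0 // vodd_square //; exact: twin_factors_square.
Qed.

Lemma vodd_xA_p : vodd p (x + A) = vodd p x.
Proof.
have [pq p2 q2] := pq_neq.
have := vodd_factors p_prime; rewrite (@vodd_xB p) // addbF.
by case: (vodd p x) (vodd p (x + A)) => [] [].
Qed.

End Factors.

Lemma translate_not_two_torsion x y (h : y ^+ 2 = wcubic E x) e (he : wcubic E e = 0) :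
  y != 0 -> exists x' y' (h' : y' ^+ 2 = wcubic E x'),
    y' != 0 /\ point h + root_point he = point h'.
Proof.
move=> y0; have d : (point h + root_point he) *+ 2 != 0.
  by rewrite mulrnDl root_point_double addr0 double_point_eq0.
have [e'|[x' [y' [h' e']]]] := ecpointP (point h + root_point he).
  by rewrite e' mul0rn eqxx in d.
by exists x', y', h'; rewrite -(double_point_eq0 h') -e'.
Qed.

(** Adding the point [(0, 0)] multiplies the class of [x] by [A * B]. Since
    [x] vanishes there, this is read on the two other factors. *)
Lemma translate_root0_class x y x' y' (h : y ^+ 2 = wcubic E x) (h' : y' ^+ 2 = wcubic E x') :
  y != 0 -> y' != 0 -> point h + root_point twin_root0 = point h' ->
  is_square (x * x' * (A * B)).
Proof.
move=> y0 y'0 e; have [x0 xA xB] := twin_factors_neq0 h y0.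
have [x'0 x'A x'B] := twin_factors_neq0 h' y'0.
have sA := sum_sub_root_square twin_rootA e.
have sB := sum_sub_root_square twin_rootB e.
rewrite !opprK !add0r in sA sB.
apply: (@is_square_divl _ ((x + A) * A * (x' + A) * ((x + B) * B * (x' + B)))).
- have nz (a b c d g f : rat) : a != 0 -> b != 0 -> c != 0 -> d != 0 -> g != 0 ->
      f != 0 -> a * b * c * (d * g * f) != 0 by move=> *; rewrite !mulf_neq0.
  by apply: nz.
- exact: is_squareM.
have -> : (x + A) * A * (x' + A) * ((x + B) * B * (x' + B)) * (x * x' * (A * B)) =
    (x * (x + A) * (x + B)) * (x' * (x' + A) * (x' + B)) * (A * B) ^+ 2 by ring.
exact: is_squareM (is_squareM (twin_factors_square h) (twin_factors_square h')) (is_square_sqr _).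
Qed.

Lemma translate_rootB_class x y x' y' (h : y ^+ 2 = wcubic E x) (h' : y' ^+ 2 = wcubic E x') :
  point h + root_point twin_rootB = point h' -> is_square (x * x' * - B).
Proof.
by move/(sum_sub_root_square twin_root0); rewrite !subr0 mulrAC.
Qed.

(** * Torsion over the rationals *)

Let AB_not_square x : x ^+ 2 - A * B != 0.
Proof.
have [pq _ _] := pq_neq; apply/eqP => /eqP; rewrite subr_eq0 eq_sym => /eqP e.
have : vodd p (A * B) = false by rewrite e; apply: vodd_square; exact: is_square_sqr.
by rewrite voddM // /vodd vA // vB // eqxx (negPf pq).
Qed.

Let prime2 : prime 2. Proof. by []. Qed.
Local Notation v2 := (vrat 2).

Let v2A : v2 A = 0.
Proof. by have [_ p2 _] := pq_neq; rewrite vA // eq_sym (negPf p2). Qed.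
Let v2B : v2 B = 0.
Proof. by have [_ _ q2] := pq_neq; rewrite vB // eq_sym (negPf q2). Qed.

Lemma twin_double_vrat2 x y x' y' (h : y ^+ 2 = wcubic E x) (h' : y' ^+ 2 = wcubic E x') :
  y != 0 -> point h *+ 2 = point h' ->
  v2 x' = v2 (x ^+ 2 - A * B) *+ 2 - (2 + v2 x + v2 (x + A) + v2 (x + B)).
Proof.
move=> y0 e; have [x0 xA xB] := twin_factors_neq0 h y0.
have [E2 E4] := twin_integral_coefs.
set s : int := _ * (_ + _) in E2; set m : int := _ * _ in E4.
have AB : A * B = m%:~R by rewrite -E4 /= /A /B; case: (sigma); ring.
have := double_abscissa E2 E4 erefl e.
have -> : x * (x ^+ 2 + s%:~R * x + m%:~R) = x * (x + A) * (x + B).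
  by rewrite -E2 -AB /= /A /B; case: (sigma); ring.
rewrite -AB => /esym ee.
have x'0 : x' != 0.
  by apply: contraNneq (AB_not_square x) => x'0; move/eqP: ee; rewrite x'0 mulr0 sqrf_eq0.
have f0 : 4%:R * (x * (x + A) * (x + B)) != 0 by rewrite !mulf_neq0.
have := congr1 (vrat 2) ee; rewrite vratX2 // => ->.
rewrite (vratM 2 f0 x'0) !vratM ?mulf_neq0 //.
have -> : v2 4%:R = 2 by rewrite vrat_nat.
ring.
Qed.

(** If the denominator of [x] is even, the leading terms give [x(2P) ~ x / 4]. If [x]
    is even, [4 x (x + A) (x + B)] is even and [x^2 - A B] is odd. If [x] is a unit,
    [x + A] and [x + B] are even, whereas [x^2 - A B = (x + A) (x - A) - 2p] is
    divisible by 2 only once, since [q = p + 2]. *)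
Lemma twin_double_neg x y x' y' (h : y ^+ 2 = wcubic E x) (h' : y' ^+ 2 = wcubic E x') :
  y != 0 -> point h *+ 2 = point h' -> v2 x' < 0.
Proof.
move=> y0 e; rewrite (twin_double_vrat2 y0 e).
have [x0 xA xB] := twin_factors_neq0 h y0.
have [n0|n0] := ltrP (v2 x) 0.
  have vAB : v2 (- (A * B)) = 0 by rewrite vratN vratM // v2A v2B.
  have x20 : x ^+ 2 != 0 by rewrite sqrf_eq0.
  have AB0 : - (A * B) != 0 by rewrite oppr_eq0 mulf_neq0.
  have [|_ ->] := vrat_addl prime2 x20 AB0; first by rewrite vratX2 // vAB mulrn_wlt0.
  have [|_ ->] := vrat_addl prime2 x0 A0; first by rewrite v2A.
  have [|_ ->] := vrat_addl prime2 x0 B0; first by rewrite v2B.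
  by rewrite vratX2 //; move: (v2 x) n0; clear; lia.
have [n1|n1] := ltrP 0 (v2 x).
  have AB0 : - (A * B) != 0 by rewrite oppr_eq0 mulf_neq0.
  have x20 : x ^+ 2 != 0 by rewrite sqrf_eq0.
  have vAB : v2 (- (A * B)) = 0 by rewrite vratN vratM // v2A v2B.
  have [|_ e1] := vrat_addl prime2 AB0 x20; first by rewrite vAB vratX2 // mulrn_wgt0.
  have [|_ e2] := vrat_addl prime2 A0 x0; first by rewrite v2A.
  have [|_ e3] := vrat_addl prime2 B0 x0; first by rewrite v2B.
  rewrite [x ^+ 2 - _]addrC e1 vAB [x + A]addrC e2 [x + B]addrC e3 v2A v2B.
  by move: (v2 x) n1; clear; lia.
have v0 : v2 x = 0 by apply/eqP; rewrite eq_le n0 n1.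
have uA := vrat2_add_units x0 A0 xA v0 v2A.
have uB := vrat2_add_units x0 B0 xB v0 v2B.
suff -> : v2 (x ^+ 2 - A * B) = 1.
  by rewrite v0; move: (v2 (x + A)) (v2 (x + B)) uA uB; clear; lia.
have p2 : v2 (- (2%:R * p%:R)) = 1.
  have [_ pn2 _] := pq_neq; rewrite vratN vratM ?pnatr_eq0 -?lt0n //.
  by rewrite !vrat_nat // !logn_prime // eqxx [2%N == p]eq_sym (negPf pn2).
have -> : x ^+ 2 - A * B = - (2%:R * p%:R) + (x + A) * (x - A).
  rewrite BA /A; case: (sigma); ring.
have p20 : - (2%:R * p%:R) != 0 :> rat by rewrite oppr_eq0 mulf_neq0 ?pnatr_eq0 -?lt0n.
have [->|xmA] := eqVneq (x - A) 0; first by rewrite mulr0 addr0.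
have uA' := vrat2_add_units x0 (_ : - A != 0) xmA v0 (_ : v2 (- A) = 0).
rewrite vratN oppr_eq0 in uA'; have {}uA' := uA' A0 v2A.
have [|_ ->] := vrat_addl prime2 p20 (mulf_neq0 xA xmA) => //.
by rewrite p2 vratM //; move: (v2 _) (v2 _) uA uA'; clear; lia.
Qed.

Lemma twin_double_step x y (h : y ^+ 2 = wcubic E x) : v2 x < 0 ->
  exists x' y' (h' : y' ^+ 2 = wcubic E x'), point h *+ 2 = point h' /\ v2 x' = v2 x - 2.
Proof.
move=> v0; have neq e : 0 <= v2 e -> x != e.
  by move=> ve; apply: contraTneq v0 => ->; rewrite -leNgt.
have x0 : x != 0 by apply: neq; rewrite vrat0.
have x20 : x ^+ 2 != 0 by rewrite sqrf_eq0.
have [|xA eA] := vrat_addl prime2 x0 A0; first by rewrite v2A.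
have [|xB eB] := vrat_addl prime2 x0 B0; first by rewrite v2B.
have vAB : v2 (- (A * B)) = 0 by rewrite vratN vratM // v2A v2B.
have AB0 : - (A * B) != 0 by rewrite oppr_eq0 mulf_neq0.
have [|_ eAB] := vrat_addl prime2 x20 AB0; first by rewrite vratX2 // vAB mulrn_wlt0.
have y0 : y != 0 by rewrite -sqrf_eq0 h cubicE !mulf_neq0.
have [e|[x' [y' [h' e]]]] := ecpointP (point h *+ 2).
  by move/eqP: e; rewrite double_point_eq0 (negPf y0).
exists x', y', h'; split=> //; rewrite (twin_double_vrat2 y0 e) eAB eA eB vratX2 //.
by move: (v2 x); clear; lia.
Qed.

(** Doubling a point whose abscissa has an even denominator lowers the 2-adic
    valuation of the abscissa by two, so such a point is not periodic under
    doubling; and the double of any point is of this kind. *)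
Lemma twin_torsion_two P : P \in torsion (G:=ecpoint E) -> P *+ 2 = 0.
Proof.
move=> /torsionP[n n0 Pn]; apply/eqP/negPn/negP => P2.
have [P0|[x [y [h eP]]]] := ecpointP P; first by rewrite P0 mul0rn eqxx in P2.
have y0 : y != 0 by rewrite -(double_point_eq0 h) -eP.
have [e|[x' [y' [h' e]]]] := ecpointP (P *+ 2); first by rewrite e eqxx in P2.
rewrite eP in e; have neg := twin_double_neg y0 e; rewrite -eP in e.
have iter k : exists z w (hz : w ^+ 2 = wcubic E z),
    P *+ 2 ^ k.+1 = point hz /\ v2 z = v2 x' - k%:Z *+ 2.
  elim: k => [|k [z [w [hz [ez vz]]]]]; first by exists x', y', h'; rewrite mul0rn subr0.
  have [|z' [w' [hz' [ez' vz']]]] := twin_double_step hz.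
    by rewrite vz; move: (v2 x') neg; clear; lia.
  exists z', w', hz'; rewrite expnSr mulrnA ez ez' vz' vz; split=> //.
  by move: (v2 x'); clear; lia.
(* among [n + 1] powers of two, two agree modulo the order of [P] *)
pose f (k : 'I_n.+1) : 'I_n := Ordinal (ltn_pmod (2 ^ k.+1) n0).
have /injectivePn[i [j ij /(congr1 val) /= e']] : ~~ injectiveb f.
  apply/negP => /injectiveP /leq_card; rewrite !card_ord ltnn //.
have modn_P k : P *+ (k %% n) = P *+ k.
  by rewrite [in RHS](divn_eq k n) mulrnDr mulnC mulrnA Pn mul0rn add0r.
have [z [w [hz [ez vz]]]] := iter i; have [z' [w' [hz' [ez' vz']]]] := iter j.
have : point hz = point hz' by rewrite -ez -ez' -modn_P e' modn_P.
move=> /(congr1 val) /= [ezz _]; case/negP: ij; apply/eqP/val_inj.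
by move: vz; rewrite ezz vz' /=; move: (v2 x') (nat_of_ord i) (nat_of_ord j); clear; lia.
Qed.

(** * Square classes of the rational points *)

Lemma x_class_square x y d (h : y ^+ 2 = wcubic E x) : y != 0 -> 0 < x * d ->
  vodd p d = vodd p x -> vodd q d = vodd q x ->
  (forall l, prime l -> l != p -> l != q -> vodd l d = false) -> is_square (x * d).
Proof.
move=> y0 xd dp dq dl; apply: rat_square => // l pl.
have [x0 _ _] := twin_factors_neq0 h y0.
have d0 : d != 0 by apply: contraTneq xd => ->; rewrite mulr0 ltxx.
rewrite voddM //; have [->|lp] := eqVneq l p; first by rewrite dp addbb.
have [->|lq] := eqVneq l q; first by rewrite dq addbb.
by rewrite (vodd_x h y0 pl lp lq) dl.
Qed.

Lemma xA_class_square x y d (h : y ^+ 2 = wcubic E x) : y != 0 -> 0 < (x + A) * d ->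
  vodd p x = vodd p d -> vodd 2 d = vodd 2 (x + A) ->
  (forall l, prime l -> l != p -> l != 2%N -> vodd l d = false) -> is_square ((x + A) * d).
Proof.
move=> y0 xd dp d2 dl; apply: rat_square => // l pl.
have [_ xA0 _] := twin_factors_neq0 h y0.
have d0 : d != 0 by apply: contraTneq xd => ->; rewrite mulr0 ltxx.
rewrite voddM //; have [->|lp] := eqVneq l p; first by rewrite (vodd_xA_p h y0) dp addbb.
have [->|l2] := eqVneq l 2%N; first by rewrite d2 addbb.
by rewrite (vodd_xA h y0 pl l2 lp) dl.
Qed.

Lemma xB_class_square x y d1 d2 (h : y ^+ 2 = wcubic E x) : y != 0 ->
  d1 != 0 -> d2 != 0 ->
  is_square (x * d1) -> is_square ((x + A) * d2) -> is_square ((x + B) * (d1 * d2)).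
Proof.
move=> y0 d10 d20 s1 s2; have [x0 xA0 _] := twin_factors_neq0 h y0.
apply: (@is_square_divl _ (x * d1 * ((x + A) * d2))).
- by rewrite !(mulf_neq0 x0, mulf_neq0 xA0, mulf_neq0).
- exact: is_squareM.
have -> : x * d1 * ((x + A) * d2) * ((x + B) * (d1 * d2)) =
  x * (x + A) * (x + B) * (d1 * d2) ^+ 2 by ring.
exact: is_squareM (twin_factors_square h) (is_square_sqr _).
Qed.

(** The cubic is positive at [x]. On [E_-] all three factors would be negative if
    [x] were; on [E_+], [x < 0 < x + p] would leave one negative factor only. *)
Lemma x_sign x y (h : y ^+ 2 = wcubic E x) : y != 0 ->
  if sigma then 0 < x else (x < 0) == (x + A < 0).
Proof.
move=> y0; have y2 : 0 < x * (x + A) * (x + B) by rewrite -cubicE -h exprn_even_gt0.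
have hp : 0 < (p%:R : rat) by rewrite ltr0n.
have eq : (q%:R : rat) = p%:R + 2%:R by rewrite hpq natrD.
move: y2; rewrite /A /B eq; case: (sigma) => /=.
  rewrite !mulN1r; move: (p%:R : rat) hp => P P0; case: (ltrP 0 x) => // x0 y2.
  have : 0 <= (x - P) * (x - (P + 2%:R)) by nra.
  by move=> le; have := mulr_le0_ge0 x0 le; rewrite mulrA; lra.
rewrite !mul1r; move: (p%:R : rat) hp => P P0 y2.
apply/eqP; apply/idP/idP => [x0|]; last by lra.
rewrite ltNge; apply/negP => xP.
have : 0 <= (x + P) * (x + (P + 2%:R)) by nra.
by move=> le; have := mulr_le0_ge0 (ltW x0) le; rewrite mulrA; lra.
Qed.

(** Translation by [(0, 0)] makes the valuation of [x] at [p] even; translation by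
    [(-B, 0)] then makes [x] positive on [E_+], and its valuation at [q] even on
    [E_-]. The two bits [beta] remain. *)
Definition normalised_x (x : rat) : bool :=
  ~~ vodd p x && ~~ (if sigma then vodd q x else x < 0).

Definition beta_x (x : rat) : bool * bool :=
  (if sigma then x + A < 0 else vodd q x, vodd 2 (x + A)).

Definition normalised (P : ecpoint E) : Prop := exists x y (h : y ^+ 2 = wcubic E x),
  [/\ P = point h, y != 0 & normalised_x x].

Definition beta (P : ecpoint E) : bool * bool :=
  if ecpoint_val P is Some (x, _) then beta_x x else (false, false).

Let voddA l : prime l -> vodd l A = (l == p).
Proof. by move=> pl; rewrite /vodd vA // absz_nat oddb. Qed.

Let voddB l : prime l -> vodd l (- B) = (l == q).
Proof. by move=> pl; rewrite /vodd vratN vB // absz_nat oddb. Qed.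

Lemma normalise P : exists P' T, [/\ T \in twin_torsion, P = P' + T & P' = 0 \/ normalised P'].
Proof.
have [pq p2 q2] := pq_neq.
have tors2 (R S : ecpoint E) : R *+ 2 = 0 -> S *+ 2 = 0 -> (R + S) *+ 2 = 0.
  by move=> r s; rewrite mulrnDl r s addr0.
have T1 := root_point_double twin_root0; have T3 := root_point_double twin_rootB.
suff [P' [T [t2 e n]]] : exists P' T, [/\ T *+ 2 = 0, P + T = P' & P' = 0 \/ normalised P'].
  exists P', (- T); split=> //; first by apply: twin_two_torsion; rewrite mulNrn t2 oppr0.
  by rewrite -e addrK.
have [P2|P2] := eqVneq (P *+ 2) 0.
  by exists 0, (- P); rewrite subrr mulNrn P2 oppr0; split=> //; left.
have [P0|[x0 [y0 [h0 eP]]]] := ecpointP P; first by rewrite P0 mul0rn eqxx in P2.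
have y00 : y0 != 0 by rewrite -(double_point_eq0 h0) -eP.
have [x [y [h [Ta [ta ea yn0 xp]]]]] : exists x y (h : y ^+ 2 = wcubic E x) T,
    [/\ T *+ 2 = 0, P + T = point h, y != 0 & vodd p x = false].
  case vp : (vodd p x0); last by exists x0, y0, h0, 0; rewrite mul0rn addr0; split.
  have [x [y [h [yn0 e]]]] := translate_not_two_torsion h0 twin_root0 y00.
  exists x, y, h, (root_point twin_root0); rewrite eP; split=> //.
  have := vodd_square p (translate_root0_class y00 yn0 e).
  have [xn0 _ _] := twin_factors_neq0 h0 y00; have [x'n0 _ _] := twin_factors_neq0 h yn0.
  rewrite (voddM _ (mulf_neq0 xn0 x'n0) (mulf_neq0 A0 B0)) (voddM _ xn0 x'n0) (voddM _ A0 B0).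
  rewrite vp voddA // -[vodd p B]/(odd _) vB // eqxx (negPf pq).
  by case: (vodd p x).
case bad : (if sigma then vodd q x else x < 0); last first.
  exists (point h), Ta; split=> //; right; exists x, y, h; split=> //.
  by rewrite /normalised_x xp bad.
have [x' [y' [h' [y'n0 e]]]] := translate_not_two_torsion h twin_rootB yn0.
exists (point h'), (Ta + root_point twin_rootB); split; first exact: tors2.
  by rewrite addrA ea.
right; exists x', y', h'; split=> //.
have sq := translate_rootB_class e.
have [xn0 _ _] := twin_factors_neq0 h yn0; have [x'n0 _ _] := twin_factors_neq0 h' y'n0.
have BN0 : - B != 0 by rewrite oppr_eq0.
have vx' l : prime l -> vodd l x' = vodd l x (+) (l == q).
  move=> pl; have := vodd_square l sq.
  rewrite (voddM _ (mulf_neq0 xn0 x'n0) BN0) (voddM _ xn0 x'n0) voddB //.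
  by case: (vodd l x) (vodd l x') (l == q) => [] [] [].
rewrite /normalised_x vx' // xp (negPf pq) /=.
have pos : ~~ sigma -> x < 0 -> 0 < x'.
  move=> ns xneg; have : 0 < x * x' * - B.
    have [t et] := sq; rewrite et exprn_even_gt0 //=.
    apply: contraTneq (mulf_neq0 (mulf_neq0 xn0 x'n0) BN0) => t0.
    by rewrite et t0 expr0n eqxx.
  have B_gt0 : 0 < B by rewrite /B (negPf ns) mul1r ltr0n.
  by rewrite mulrN oppr_gt0 pmulr_llt0 // nmulr_rlt0.
move: bad pos; case: (sigma) => [bad _|bad pos]; first by rewrite vx' // bad eqxx.
by rewrite -leNgt ltW // pos.
Qed.

Lemma normalised_signs x y (h : y ^+ 2 = wcubic E x) : y != 0 -> normalised_x x ->
  [/\ 0 < x, vodd p x = false & if sigma then vodd q x = false else 0 < x + A].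
Proof.
move=> y0 /andP[/negPf vp]; have [x0 xA _] := twin_factors_neq0 h y0.
have := x_sign h y0; case: (sigma) => [xpos /negPf vq|/eqP e]; first by split.
rewrite e -!leNgt => xA'; split=> //; last by rewrite lt_neqAle eq_sym xA.
by rewrite lt_neqAle eq_sym x0 leNgt e -leNgt.
Qed.

(** Signs and parities of valuations agree, so the products of the corresponding
    factors are positive with even valuations, that is squares. *)
Lemma beta_same P Q : normalised P -> normalised Q -> beta P = beta Q ->
  exists S, P = Q + S *+ 2.
Proof.
move=> [x [y [h [-> y0 nx]]]] [x' [y' [h' [-> y'0 nx']]]] eb.
have [e2 e4 e6] := twin_split.
have [x0 vp vs] := normalised_signs h y0 nx.
have [x'0 vp' vs'] := normalised_signs h' y'0 nx'.
have [/= eb1 eb2] : beta_x x = beta_x x' := eb.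
have [_ xA _] := twin_factors_neq0 h y0; have [_ xA' _] := twin_factors_neq0 h' y'0.
have vqe : vodd q x' = vodd q x.
  by move: eb1 vs vs'; case: (sigma) => [_ -> ->|->].
have sA : 0 < (x + A) * (x' + A).
  move: eb1 vs vs'; case: (sigma) => [eb1 _ _|_ p1 p2]; last exact: mulr_gt0.
  have [neg|pos] := ltrP (x + A) 0; first by rewrite nmulr_rgt0 // -eb1.
  by rewrite mulr_gt0 // lt_neqAle eq_sym ?xA ?xA' //= leNgt -?eb1 -leNgt.
have s1 : is_square (x * x').
  apply: (x_class_square h) => //; rewrite ?mulr_gt0 ?vp ?vp' //.
  by move=> l pl lp lq; exact: (vodd_x h').
have s2 : is_square ((x + A) * (x' + A)).
  apply: (xA_class_square h) => //; rewrite ?(vodd_xA_p h') ?vp ?vp' //.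
  by move=> l pl lp l2; exact: (vodd_xA h').
apply: (same_class_halvable e2 e4 e6); rewrite ?subr0 ?opprK //.
have xn0 : x * x' != 0 by rewrite mulf_neq0 // gt_eqF.
apply: (@is_square_divl _ (x * x' * ((x + A) * (x' + A)))).
- by rewrite mulf_neq0 // mulf_neq0.
- exact: is_squareM.
have -> : x * x' * ((x + A) * (x' + A)) * ((x + B) * (x' + B)) =
   x * (x + A) * (x + B) * (x' * (x' + A) * (x' + B)) by ring.
exact: is_squareM (twin_factors_square h) (twin_factors_square h').
Qed.

Lemma beta_zero P : normalised P -> beta P = (false, false) -> exists S, P = S *+ 2.
Proof.
move=> [x [y [h [-> y0 nx]]]] eb; have [e2 e4 e6] := twin_split.
have [x0 vp vs] := normalised_signs h y0 nx.
have [/= eb1 eb2] : beta_x x = (false, false) := eb.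
have [_ xA _] := twin_factors_neq0 h y0.
have vq : vodd q x = false by move: eb1 vs; case: (sigma).
have sA : 0 < x + A.
  move: eb1 vs; case: (sigma) => // /negbT; rewrite -leNgt => le _.
  by rewrite lt_neqAle eq_sym xA.
have s1 : is_square (x * 1).
  by apply: (x_class_square h); rewrite ?mulr1 ?vodd1 ?vp ?vq // => *; rewrite vodd1.
have s2 : is_square ((x + A) * 1).
  by apply: (xA_class_square h); rewrite ?mulr1 ?vodd1 ?vp ?eb2 // => *; rewrite vodd1.
have s3 := xB_class_square h y0 (oner_neq0 _) (oner_neq0 _) s1 s2.
rewrite !mulr1 in s1 s2 s3.
by apply: (point_halvable e2 e4 e6); rewrite ?subr0 ?opprK.
Qed.

(** The values of [beta] that are not excluded bound the number of classes modulo
    doubles and torsion; finitely many classes start the descent on heights. *)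
Lemma twin_rank (L : seq (bool * bool)) :
  (forall x y (h : y ^+ 2 = wcubic E x), y != 0 -> normalised_x x ->
     beta_x x \in (false, false) :: L) ->
  fin_gen (ecpoint E) /\ forall r, has_rank (ecpoint E) r -> (2 ^ r <= (size L).+1)%N.
Proof.
move=> hL; have [||||R [szR hR]] :=
  @class_representatives (ecpoint E) twin_torsion normalised beta L.
- exact: normalise.
- exact: beta_same.
- exact: beta_zero.
- by move=> P [x [y [h [-> y0 nx]]]]; exact: (hL x y).
split; last first.
  move=> r hr; apply: leq_trans szR; apply: (rank_le_classes hr) => P.
  have [y [t [z [yR tT e]]]] := hR P; exists y => //; exists t; last by exists z.
  apply/torsionP; exists 2%N => //; move: tT; rewrite !inE.
  by case/or4P => /eqP ->; rewrite ?mul0rn ?root_point_double.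
have [E2 E4] := twin_integral_coefs.
set s : int := _ * (_ + _) in E2; set m : int := _ * _ in E4.
apply: (@descent_points_fin_gen s m E E2 E4 erefl [seq y + t | y <- R, t <- twin_torsion]) => P.
have [y [t [z [yR tT e]]]] := hR P; exists (y + t); last by exists z.
by apply/allpairsP; exists (y, t).
Qed.

End TwinCurve.

(** * Classes excluded by quadratic residues *)

Lemma norm_value_excluded l (c : int) (X Y d W : rat) : prime l ->
  (forall t : 'F_l, t ^+ 2 != c%:~R) -> X != 0 -> Y != 0 -> vodd l d ->
  X ^+ 2 - c%:~R * Y ^+ 2 = d * W ^+ 2 -> False.
Proof.
move=> pl nonres X0 Y0 od e; have [nz] := vodd_norm pl nonres X0 Y0.
rewrite e in nz *; have : (d != 0) && (W ^+ 2 != 0) by rewrite -negb_or -mulf_eq0.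
by case/andP=> d0 W0; rewrite voddM // od (vodd_square _ (is_square_sqr W)).
Qed.

Lemma square_multiple (x d : rat) : d != 0 -> x != 0 -> is_square (x * d) ->
  exists2 u, u != 0 & x = d * u ^+ 2.
Proof.
move=> d0 x0 [t et]; exists (t / d).
  by rewrite mulf_neq0 ?invr_eq0 // -sqrf_eq0 -et mulf_neq0.
by rewrite expr_div_n -et; field.
Qed.

Section TwinPrimes.
Variables (p q : nat).
Hypotheses (p_prime : prime p) (q_prime : prime q) (hpq : q = (p + 2)%N).
Local Notation E sigma := (twin_curve sigma p_prime q_prime hpq).

Let p_gt0 : (0 < p)%N := prime_gt0 p_prime.
Let q_gt0 : (0 < q)%N := prime_gt0 q_prime.
Let qQ : (q%:R : rat) != 0. Proof. by rewrite pnatr_eq0 -lt0n. Qed.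
Let p_odd : odd p := (twin_odd p_prime q_prime hpq).1.
Let q_odd : odd q := (twin_odd p_prime q_prime hpq).2.
Let vodd_prime l n : prime n -> vodd l n%:R = (l == n).
Proof. by move=> pn; rewrite vodd_nat ?prime_gt0 // logn_prime // oddb. Qed.

Let vodd_pow l n (b : bool) : prime n -> vodd l (n%:R ^+ b) = b && (l == n).
Proof. by case: b => pn; rewrite ?expr0 ?expr1 ?vodd1 ?vodd_prime. Qed.

Let vodd_sign l (b c : bool) : vodd l ((-1) ^+ c * 2%:R ^+ b) = b && (l == 2%N).
Proof. by case: c; rewrite ?mulN1r ?mul1r /vodd ?vratN; exact: vodd_pow. Qed.

Lemma plus_factors x y (h : y ^+ 2 = wcubic (E false) x) : y != 0 ->
  normalised_x false p q x -> exists u v w, let: (b1, b2) := beta_x false p q x in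
  [/\ u != 0, v != 0 & w != 0] /\ [/\ x = q%:R ^+ b1 * u ^+ 2, x + p%:R = 2%:R ^+ b2 * v ^+ 2
    & x + q%:R = q%:R ^+ b1 * 2%:R ^+ b2 * w ^+ 2].
Proof.
move=> y0 nx; have [x0 vp xA0] := normalised_signs h y0 nx.
have [xn0 xAn xBn] := twin_factors_neq0 h y0.
set b1 := (beta_x false p q x).1; set b2 := (beta_x false p q x).2.
have eA : twinA false p = p%:R by rewrite /twinA mul1r.
have eB : twinB false q = q%:R by rewrite /twinB mul1r.
have d1 : (q%:R : rat) ^+ b1 != 0 by rewrite expf_neq0.
have d2 : (2%:R : rat) ^+ b2 != 0 by rewrite expf_neq0.
have pq : p != q by rewrite hpq -{1}[p]addn0 eqn_add2l.
have p2 : p != 2%N by apply: contraTneq p_odd => ->.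
have s1 : is_square (x * q%:R ^+ b1).
  apply: (x_class_square h) => //;
    rewrite ?vodd_pow // ?vp ?(negPf pq) ?andbF ?andbT ?eqxx ?andbT //.
    by rewrite mulr_gt0 // exprn_gt0 // ltr0n.
  by move=> l pl _ /negPf lq; rewrite vodd_pow // lq andbF.
have s2 : is_square ((x + twinA false p) * 2%:R ^+ b2).
  apply: (xA_class_square h) => //; rewrite ?vodd_pow // ?vp ?(negPf p2) ?andbF ?eqxx ?andbT //.
    by rewrite mulr_gt0 // exprn_gt0.
  by move=> l pl _ /negPf l2; rewrite vodd_pow // l2 andbF.
have s3 := xB_class_square h y0 d1 d2 s1 s2.
have [u u0 eu] := square_multiple d1 xn0 s1.
have [v v0 ev] := square_multiple d2 xAn s2.
have [w w0 ew] := square_multiple (mulf_neq0 d1 d2) xBn s3.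
exists u, v, w; rewrite [beta_x _ _ _ _]surjective_pairing -/b1 -/b2.
by rewrite eA in ev; rewrite eB in ew; split.
Qed.

Lemma minus_factors x y (h : y ^+ 2 = wcubic (E true) x) : y != 0 ->
  normalised_x true p q x -> exists u v w, let: (b1, b2) := beta_x true p q x in
  [/\ u != 0, v != 0 & w != 0] /\ [/\ x = u ^+ 2,
    x - p%:R = (-1) ^+ b1 * 2%:R ^+ b2 * v ^+ 2 & x - q%:R = (-1) ^+ b1 * 2%:R ^+ b2 * w ^+ 2].
Proof.
move=> y0 nx; have [x0 vp vq] := normalised_signs h y0 nx.
have [xn0 xAn xBn] := twin_factors_neq0 h y0.
set b1 := (beta_x true p q x).1; set b2 := (beta_x true p q x).2.
have eA : twinA true p = - p%:R by rewrite /twinA mulN1r.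
have eB : twinB true q = - q%:R by rewrite /twinB mulN1r.
have d1 : (1 : rat) != 0 := oner_neq0 _.
have d2 : (-1 : rat) ^+ b1 * 2%:R ^+ b2 != 0 by rewrite mulf_neq0 ?signr_eq0 ?expf_neq0.
have p2 : p != 2%N by apply: contraTneq p_odd => ->.
have s1 : is_square (x * 1).
  by apply: (x_class_square h) => // *; rewrite ?mulr1 ?vodd1.
have s2 : is_square ((x + twinA true p) * ((-1) ^+ b1 * 2%:R ^+ b2)).
  apply: (xA_class_square h) => //; rewrite ?vodd_sign ?vp ?(negPf p2) ?andbF ?eqxx ?andbT //.
    rewrite mulrA pmulr_lgt0 ?exprn_gt0 // /b1 /beta_x /=.
    case: (ltrP (x + twinA true p) 0) => [neg|pos]; first by rewrite expr1 mulrN1 oppr_gt0.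
    by rewrite expr0 mulr1 lt_neqAle eq_sym xAn.
  by move=> l pl _ /negPf l2; rewrite vodd_sign l2 andbF.
have s3 := xB_class_square h y0 d1 d2 s1 s2; rewrite mul1r in s3.
have [u u0 eu] := square_multiple d1 xn0 s1.
have [v v0 ev] := square_multiple d2 xAn s2.
have [w w0 ew] := square_multiple d2 xBn s3.
exists u, v, w; rewrite [beta_x _ _ _ _]surjective_pairing -/b1 -/b2.
by rewrite mul1r in eu; rewrite eA in ev; rewrite eB in ew; split.
Qed.

(** On [E_-] both [p] and [q] are values of the form [X^2 - d Y^2]. *)
Lemma minus_excluded x y (h : y ^+ 2 = wcubic (E true) x) b1 b2 : y != 0 ->
  normalised_x true p q x -> beta_x true p q x = (b1, b2) ->
  (exists2 l, (l == p) || (l == q) &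
    forall t : 'F_l, t ^+ 2 != ((-1) ^+ b1 * 2%:R ^+ b2 : int)%:~R) -> False.
Proof.
move=> y0 nx eb [l hl nonres]; have [u [v [w]]] := minus_factors h y0 nx.
rewrite eb => -[[u0 v0 w0] [eu ev ew]].
have ed : ((-1) ^+ b1 * 2%:R ^+ b2 : int)%:~R = (-1) ^+ b1 * 2%:R ^+ b2 :> rat.
  by rewrite rmorphM rmorph_sign rmorphXn.
have pl : prime l by case/orP: hl => /eqP ->.
case/orP: hl nonres => /eqP -> nonres.
  apply: (norm_value_excluded (d := p%:R) (W := 1) p_prime nonres u0 v0).
    by rewrite vodd_prime.
  by rewrite ed -ev -eu; ring.
apply: (norm_value_excluded (d := q%:R) (W := 1) q_prime nonres u0 w0).
  by rewrite vodd_prime.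
by rewrite ed -ew -eu; ring.
Qed.

Let two_nonres l : prime l -> (l %% 8 = 5)%N -> forall t : 'F_l, t ^+ 2 != (2%:Z)%:~R.
Proof.
move=> pl l5 t; have ol : odd l by lia.
by have [] := two_nonresidue pl ol l5 t.
Qed.

Let opp_two_nonres l : prime l -> (l %% 8 = 5)%N -> forall t : 'F_l, t ^+ 2 != (- 2%:Z)%:~R.
Proof.
move=> pl l5 t; have ol : odd l by lia.
by rewrite rmorphN; have [] := two_nonresidue pl ol l5 t.
Qed.

(** Here [u^2 - 2 v^2 = - p] and [u^2 - 2 w^2 = - q]. *)
Lemma plus_excluded_01 x y (h : y ^+ 2 = wcubic (E false) x) : y != 0 ->
  normalised_x false p q x -> beta_x false p q x = (false, true) ->
  (p %% 8 = 5)%N \/ (q %% 8 = 5)%N -> False.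
Proof.
move=> y0 nx eb; have [u [v [w]]] := plus_factors h y0 nx.
rewrite eb !expr0 !expr1 !mul1r => -[[u0 v0 w0] [eu ev ew]] [p5|q5].
  apply: (norm_value_excluded (d := - p%:R) (W := 1) p_prime (two_nonres p_prime p5) u0 v0).
    by rewrite /vodd vratN -/(vodd p _) vodd_prime.
  by rewrite -pmulrn -ev -eu; ring.
apply: (norm_value_excluded (d := - q%:R) (W := 1) q_prime (two_nonres q_prime q5) u0 w0).
  by rewrite /vodd vratN -/(vodd q _) vodd_prime.
by rewrite -pmulrn -ew -eu; ring.
Qed.

Let Fp_eq l (a b : nat) : prime l -> a = b %[mod l] -> (a%:R : 'F_l) = b%:R.
Proof. by move=> pl e; rewrite -(Fp_nat_mod pl a) e Fp_nat_mod. Qed.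

(** Here [v^2 - q u^2 = p], where [q] is congruent to [2] modulo [p] and [p] to [-2]
    modulo [q]. *)
Lemma plus_excluded_10 x y (h : y ^+ 2 = wcubic (E false) x) : y != 0 ->
  normalised_x false p q x -> beta_x false p q x = (true, false) ->
  (p %% 8 = 5)%N \/ (q %% 8 = 5)%N -> False.
Proof.
move=> y0 nx eb; have [u [v [w]]] := plus_factors h y0 nx.
rewrite eb !expr0 !expr1 !mul1r => -[[u0 v0 w0] [eu ev ew]] [p5|q5].
  have nonres (t : 'F_p) : t ^+ 2 != (q%:Z)%:~R.
    rewrite -pmulrn (@Fp_eq p q 2) //; first exact: two_nonres.
    by rewrite hpq modnDl.
  apply: (norm_value_excluded (d := p%:R) (W := 1) p_prime nonres v0 u0).
    by rewrite vodd_prime.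
  by rewrite -pmulrn -ev eu; ring.
have nonres (t : 'F_q) : t ^+ 2 != (p%:Z)%:~R.
  rewrite -pmulrn; have -> : (p%:R : 'F_q) = - 2%:R.
    apply/eqP; rewrite -addr_eq0 -natrD -hpq; apply/eqP; exact: pchar_Fp_0.
  by have := opp_two_nonres q_prime q5 t; rewrite rmorphN.
apply: (norm_value_excluded (d := q%:R) (W := u) q_prime nonres v0 (oner_neq0 _)).
  by rewrite vodd_prime.
by rewrite -pmulrn -eu -ev; ring.
Qed.

(** Here [(2 v)^2 - 2 p = 2 q u^2], where [2 p] is congruent to [-4] modulo [q]. *)
Lemma plus_excluded_11 x y (h : y ^+ 2 = wcubic (E false) x) : y != 0 ->
  normalised_x false p q x -> beta_x false p q x = (true, true) -> (q %% 4 = 3)%N -> False.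
Proof.
move=> y0 nx eb q3; have [u [v [w]]] := plus_factors h y0 nx.
rewrite eb !expr1 => -[[u0 v0 w0] [eu ev ew]].
have q2 : q != 2%N by apply: contraTneq q_odd => ->.
have two0 : (2%:R : 'F_q) != 0.
  rewrite -(dvdn_pcharf (pchar_Fp q_prime)) dvdn_prime2 //.
have nonres (t : 'F_q) : t ^+ 2 != ((2 * p)%:Z)%:~R.
  rewrite -pmulrn; have -> : ((2 * p)%:R : 'F_q) = - 2%:R ^+ 2.
    apply/eqP; rewrite -addr_eq0 expr2 -natrM -natrD (_ : 2 * p + 2 * 2 = 2 * q)%N.
      by rewrite natrM (pchar_Fp_0 q_prime) mulr0.
    by rewrite hpq mulnDr.
  apply: contra (opp1_nonresidue q_prime q_odd q3 (t / 2%:R)) => /eqP e.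
  by rewrite expr_div_n e mulNr divff // expf_neq0.
have tv0 : 2%:R * v != 0 by rewrite mulf_neq0.
have d0 : (2%:R * q%:R : rat) != 0 by rewrite mulf_neq0.
apply: (norm_value_excluded (d := 2%:R * q%:R) (W := u) q_prime nonres tv0 (oner_neq0 _)).
  by rewrite voddM // !vodd_prime // eqxx (negPf q2).
rewrite -pmulrn natrM; transitivity (2%:R * (2%:R * v ^+ 2 - p%:R)); first by ring.
by rewrite -ev addrK eu; ring.
Qed.

Lemma beta_cases (L : seq (bool * bool)) (b : bool * bool) :
  (forall b1 b2, b = (b1, b2) -> (b1, b2) \notin (false, false) :: L -> False) ->
  b \in (false, false) :: L.
Proof. by case: b => b1 b2 H; apply/negPn/negP => /(H b1 b2 erefl). Qed.

Lemma plus_rank : fin_gen (ecpoint (E false)) /\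
  forall r, has_rank (ecpoint (E false)) r -> [/\ (r <= 2)%N,
    (p %% 8 = 5)%N -> r = 0%N & (p %% 8 = 3)%N -> (r <= 1)%N].
Proof.
have pow r k : (2 ^ r <= 2 ^ k)%N -> (r <= k)%N by rewrite leq_exp2l.
have [fg r2] := @twin_rank false p q p_prime q_prime hpq
  [:: (true, false); (false, true); (true, true)] (fun x y h y0 nx =>
  ltac:(by case: (beta_x _ _ _ _) => [[] []])).
split=> // r hr; split.
- exact: (pow r 2%N (r2 r hr)).
- move=> p5; have q3 : (q %% 4 = 3)%N by lia.
  have [|_ r0] := @twin_rank false p q p_prime q_prime hpq [::]; last first.
    by apply/eqP; rewrite -leqn0; exact: (pow r 0%N (r0 r hr)).
  move=> x y h y0 nx; apply: beta_cases => -[] [] eb // _.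
  + exact: (plus_excluded_11 h y0 nx eb q3).
  + by apply: (plus_excluded_10 h y0 nx eb); left.
  + by apply: (plus_excluded_01 h y0 nx eb); left.
- move=> p3; have q5 : (q %% 8 = 5)%N by lia.
  have [|_ r1] := @twin_rank false p q p_prime q_prime hpq [:: (true, true)]; last first.
    exact: (pow r 1%N (r1 r hr)).
  move=> x y h y0 nx; apply: beta_cases => -[] [] eb // _.
  + by apply: (plus_excluded_10 h y0 nx eb); right.
  + by apply: (plus_excluded_01 h y0 nx eb); right.
Qed.

(** Both [p] and [q] would be sums of two rational squares, but one of two
    consecutive odd numbers is congruent to 3 modulo 4. *)
Lemma minus_excluded_10 x y (h : y ^+ 2 = wcubic (E true) x) : y != 0 ->
  normalised_x true p q x -> beta_x true p q x = (true, false) -> False.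
Proof.
move=> y0 nx eb; apply: (minus_excluded h y0 nx eb).
have [p3|q3] : (p %% 4 = 3)%N \/ (q %% 4 = 3)%N by move: p_odd q_odd; lia.
  exists p; rewrite ?eqxx // => t; rewrite expr1 expr0 mulr1 rmorphN1.
  exact: opp1_nonresidue.
exists q; rewrite ?eqxx ?orbT // => t; rewrite expr1 expr0 mulr1 rmorphN1.
exact: opp1_nonresidue.
Qed.

Lemma minus_rank : fin_gen (ecpoint (E true)) /\
  forall r, has_rank (ecpoint (E true)) r -> [/\ (r <= 1)%N,
    (p %% 8 = 5)%N -> r = 0%N & (p %% 8 = 3)%N -> r = 0%N].
Proof.
have [|fg r1] := @twin_rank true p q p_prime q_prime hpq [:: (false, true); (true, true)].
  move=> x y h y0 nx; apply: beta_cases => -[] [] eb // _.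
  exact: (minus_excluded_10 h y0 nx eb).
have rank0 r : has_rank (ecpoint (E true)) r ->
    (exists2 l, (l == p) || (l == q) & (l %% 8 = 5)%N) -> r = 0%N.
  move=> hr [l hl l5]; have pl : prime l by case/orP: hl => /eqP ->.
  have [|_ r0] := @twin_rank true p q p_prime q_prime hpq [::]; last first.
    by apply/eqP; rewrite -leqn0 -(@leq_exp2l 2) //; exact: (r0 r hr).
  move=> x y h y0 nx; apply: beta_cases => -[] [] eb // _.
  + apply: (minus_excluded h y0 nx eb); exists l => // t; rewrite !expr1 mulN1r.
    exact: opp_two_nonres.
  + exact: (minus_excluded_10 h y0 nx eb).
  + apply: (minus_excluded h y0 nx eb); exists l => // t; rewrite expr0 expr1 mul1r.
    exact: two_nonres.
split=> // r hr; split=> [|p5|p3].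
(* two non-trivial classes are left, and [2 ^ r <= 3] *)
- by have := r1 r hr; case: (r) => [|[|k]] //=; rewrite !expnS; lia.
- by apply: (rank0 r hr); exists p; rewrite ?eqxx.
- by apply: (rank0 r hr); exists q; rewrite ?eqxx ?orbT //; lia.
Qed.

End TwinPrimes.

(** * A point of infinite order *)

(** For [q = a^2 + b^2] and [c^2 = (a - 1)^2 + (b - 1)^2], the circles
    [u^2 + w^2 = q] and [v^2 + w^2 = 2] have the points [(a, b)] and [(1, 1)];
    turning them by the angle of [(a - 1) + (1 - b) i] brings them to the same
    height [w]. Then [x = - u^2] satisfies [x + p = - v^2] and [x + q = w^2]. *)
Lemma infinite_order_point (p q : nat) (p_prime : prime p) (q_prime : prime q)
    (hpq : q = (p + 2)%N) (a b c : int) (epsilon delta : bool) :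
  q%:Z = a ^+ 2 + b ^+ 2 ->
  (a + (-1) ^+ epsilon) ^+ 2 + (b + (-1) ^+ delta) ^+ 2 = c ^+ 2 ->
  exists P : ecpoint (twin_curve false p_prime q_prime hpq), P *+ 2 != 0.
Proof.
move=> hq hc; have [_ q_odd] := twin_odd p_prime q_prime hpq.
have q2 : (2 < q)%N by have := prime_gt1 p_prime; lia.
(* the signs [epsilon] and [delta] are absorbed in [a] and [b] *)
have [a' [b' [{}hq {}hc]]] : exists a' b' : int,
    q%:Z = a' ^+ 2 + b' ^+ 2 /\ (a' - 1) ^+ 2 + (b' - 1) ^+ 2 = c ^+ 2.
  exists (- (-1) ^+ epsilon * a), (- (-1) ^+ delta * b); rewrite hq -hc.
  by case: (epsilon); case: (delta); split; ring.
move: a' b' hq hc => {}a {}b hq hc.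
have no_double (k : int) : q%:Z = 2%:R * k -> False.
  by move: q_odd; clear; lia.
have c0 : c != 0.
  apply/eqP => c0; move: hc; rewrite c0 expr0n => hc.
  by apply: (no_double (a + b - 1)); move: hq hc; clear; nia.
have u0 : q%:Z - a - b != 0.
  apply/eqP => e; have : a ^+ 2 - a + (b ^+ 2 - b) = 0 by move: hq e; clear; lia.
  have nn (k : int) : 0 <= k ^+ 2 - k by clear; nia.
  by move: (nn a) (nn b) hq q2; clear; nia.
have v0 : a + b - 2%:R != 0.
  apply/eqP => e; apply: (no_double (a ^+ 2 - 2%:R * a + 2%:R)).
  have -> : q%:Z = a ^+ 2 + (2%:R - a) ^+ 2.
    by rewrite hq; have -> : b = 2%:R - a by move: e; clear; lia.
  by ring.
have w0 : a - b != 0.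
  apply/eqP => e; apply: (no_double (a ^+ 2)); rewrite hq.
  by have -> : b = a by [move: e; clear; lia]; ring.
pose u : rat := (q%:Z - a - b)%:~R / c%:~R.
pose v : rat := (a + b - 2%:R)%:~R / c%:~R.
pose w : rat := (a - b)%:~R / c%:~R.
have cQ : (c%:~R : rat) != 0 by rewrite intr_eq0.
have eq : (q%:R : rat) = a%:~R ^+ 2 + b%:~R ^+ 2.
  by rewrite pmulrn hq; ring.
have ec : (c%:~R : rat) ^+ 2 = (a%:~R - 1) ^+ 2 + (b%:~R - 1) ^+ 2.
  by rewrite -rmorphXn /= -hc; ring.
have ep : (p%:R : rat) = q%:R - 2%:R by rewrite hpq natrD addrK.
have over_c (z : rat) (k : int) : z * c%:~R ^+ 2 = k%:~R ^+ 2 -> z = (k%:~R / c%:~R) ^+ 2.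
  by move=> e; rewrite expr_div_n -e mulfK // expf_neq0.
have e1 : p%:R - u ^+ 2 = - v ^+ 2.
  apply/eqP; rewrite -subr_eq0 opprK; apply/eqP.
  apply: (mulIf (expf_neq0 2 cQ)); rewrite mul0r.
  transitivity (p%:R * c%:~R ^+ 2 - (q%:R - a%:~R - b%:~R) ^+ 2
    + (a%:~R + b%:~R - 2%:R) ^+ 2 : rat).
    by rewrite /u /v; field.
  by rewrite ec ep eq; ring.
have e2 : q%:R - u ^+ 2 = w ^+ 2.
  apply/eqP; rewrite -subr_eq0; apply/eqP.
  apply: (mulIf (expf_neq0 2 cQ)); rewrite mul0r.
  transitivity (q%:R * c%:~R ^+ 2 - (q%:R - a%:~R - b%:~R) ^+ 2 - (a%:~R - b%:~R) ^+ 2 : rat).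
    by rewrite /u /w; field.
  by rewrite ec eq; ring.
have h : (u * v * w) ^+ 2 = wcubic (twin_curve false p_prime q_prime hpq) (- u ^+ 2).
  by rewrite twin_cubicE !mul1r ![- u ^+ 2 + _]addrC e1 e2; ring.
exists (point h); rewrite double_point_eq0 !mulf_neq0 ?invr_eq0 ?intr_eq0 //.
Qed.

(** * Points over [Q(i)] *)

Definition iQ : Qi := Complex 0 1.

Lemma iQ_sqr : iQ ^+ 2 = -1.
Proof. by apply/eqP; rewrite eq_complex /=; apply/andP; split; apply/eqP; ring. Qed.

Lemma iQ_neq0 : iQ != 0.
Proof. by rewrite -sqrf_eq0 iQ_sqr oppr_eq0 oner_eq0. Qed.

Definition conj_Qi (z : Qi) : Qi := conjc z.

Lemma conj_QiB : {morph conj_Qi : z w / z - w}.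
Proof.
by move=> [a b] [c d]; apply/eqP; rewrite eq_complex /=; apply/andP; split; apply/eqP; ring.
Qed.

Lemma conj_QiK : involutive conj_Qi.
Proof. by move=> [a b]; rewrite /conj_Qi /= opprK. Qed.

Lemma conj_QiM : monoid_morphism conj_Qi.
Proof.
by split=> [|[a b] [c d]]; apply/eqP; rewrite eq_complex /=; apply/andP; split;
  apply/eqP; ring.
Qed.

HB.instance Definition _ := GRing.isZmodMorphism.Build Qi Qi conj_Qi conj_QiB.
HB.instance Definition _ := GRing.isMonoidMorphism.Build Qi Qi conj_Qi conj_QiM.

Lemma conj_fixed (z : Qi) : conj_Qi z = z -> exists a, z = rat_to_Qi a.
Proof.
case: z => a b [e]; exists a; congr Complex; lra.
Qed.

Lemma conj_opp (z : Qi) : conj_Qi z = - z -> exists b, z = iQ * rat_to_Qi b.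
Proof.
case: z => a b [e]; exists b; apply/eqP; rewrite eq_complex /=.
by apply/andP; split; apply/eqP; lra.
Qed.

Lemma square_in_Qi (z : rat) : is_square (rat_to_Qi z) -> is_square z \/ is_square (- z).
Proof.
move=> [[a b] [ez e0]].
have /eqP : a * b = 0 by lra.
rewrite mulf_eq0 => /orP[] /eqP ab0; [right; exists b|left; exists a].
  by rewrite ez ab0; ring.
by rewrite ez ab0; ring.
Qed.

Section OverQi.
Variables (sigma : bool) (p q : nat).
Hypotheses (p_prime : prime p) (q_prime : prime q) (hpq : q = (p + 2)%N).
Local Notation E tau := (twin_curve tau p_prime q_prime hpq).
Local Notation EK := (ec_base_change rat_to_Qi (E sigma)).
Local Notation G := (ecpoint EK).
Local Notation f := rat_to_Qi.

Let scale1 (R : pzRingType) (x y : R) k : x = y -> x = 1 ^+ k * y.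
Proof. by move=> ->; rewrite expr1n mul1r. Qed.

Let twist2 : ec2 EK = iQ ^+ 2 * f (ec2 (E (~~ sigma))).
Proof.
rewrite iQ_sqr mulN1r -rmorphN; apply: (congr1 f (_ : ec2 (E sigma) = _)).
by rewrite /=; case: sigma; ring.
Qed.
Let twist4 : ec4 EK = iQ ^+ 4 * f (ec4 (E (~~ sigma))).
Proof. by rewrite (exprM iQ 2 2) iQ_sqr sqrrN expr1n mul1r. Qed.
Let twist6 : ec6 EK = iQ ^+ 6 * f (ec6 (E (~~ sigma))).
Proof. by rewrite [ec6 (E (~~ sigma))]/(0) rmorph0 mulr0; exact: rmorph0. Qed.

Let conj_real (a : rat) : f a = conj_Qi (f a).
Proof. by apply/eqP; rewrite eq_complex /= oppr0 !eqxx. Qed.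

Let incl2 : ec2 EK = 1 ^+ 2 * f (ec2 (E sigma)) := scale1 2 erefl.
Let incl4 : ec4 EK = 1 ^+ 4 * f (ec4 (E sigma)) := scale1 4 erefl.
Let incl6 : ec6 EK = 1 ^+ 6 * f (ec6 (E sigma)) := scale1 6 erefl.

Let conj2 : ec2 EK = 1 ^+ 2 * conj_Qi (ec2 EK) := scale1 2 (conj_real _).
Let conj4 : ec4 EK = 1 ^+ 4 * conj_Qi (ec4 EK) := scale1 4 (conj_real _).
Let conj6 : ec6 EK = 1 ^+ 6 * conj_Qi (ec6 EK) := scale1 6 (conj_real _).

Definition inclusion : {additive ecpoint (E sigma) -> G} :=
  additive_of (scale_pointB (oner_neq0 Qi) incl2 incl4 incl6).
Definition twist : {additive ecpoint (E (~~ sigma)) -> G} :=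
  additive_of (scale_pointB iQ_neq0 twist2 twist4 twist6).
Definition conjugation : {additive G -> G} :=
  additive_of (scale_pointB (f := conj_Qi) (oner_neq0 Qi) conj2 conj4 conj6).

Lemma inclusion_inj : injective inclusion.
Proof. exact: (scale_point_inj (oner_neq0 Qi)). Qed.

Lemma twist_inj : injective twist.
Proof. exact: (scale_point_inj iQ_neq0). Qed.

Lemma conjugationK P : conjugation (conjugation P) = P.
Proof.
case: P => [[[x y]|] hP]; apply: val_inj; last by [].
change (Some (1 ^+ 2 * conj_Qi (1 ^+ 2 * conj_Qi x), 1 ^+ 3 * conj_Qi (1 ^+ 3 * conj_Qi y)) =
  Some (x, y)).
by rewrite !expr1n !mul1r !conj_QiK.
Qed.

Lemma conj_fixed_point P : conjugation P = P -> exists a, P = inclusion a.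
Proof.
case: P => [[[x y]|] hP]; last by exists 0; rewrite raddf0; apply: val_inj.
move=> /(congr1 val) /=; rewrite !expr1n !mul1r => -[/conj_fixed[a ea] /conj_fixed[b eb]].
have hP' : on_curve EK (Some (1 ^+ 2 * f a, 1 ^+ 3 * f b)).
  by rewrite !expr1n !mul1r -ea -eb.
have [R eR] := scale_point_surj (oner_neq0 Qi) incl2 incl4 incl6 hP'.
exists R; apply: val_inj; rewrite /= -/(scale_coord f 1 (ecpoint_val R)).
by move/(congr1 val): eR => /= ->; rewrite !expr1n !mul1r ea eb.
Qed.

Lemma conj_opp_point P : conjugation P = - P -> exists b, P = twist b.
Proof.
case: P => [[[x y]|] hP]; last by exists 0; rewrite raddf0; apply: val_inj.
move=> /(congr1 val) /=; rewrite !expr1n !mul1r => -[/conj_fixed[a ea] /conj_opp[b eb]].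
have ex : x = iQ ^+ 2 * f (- a) by rewrite iQ_sqr ea rmorphN mulrNN mul1r.
have ey : y = iQ ^+ 3 * f (- b) by rewrite exprSr iQ_sqr eb rmorphN; ring.
have hP' : on_curve EK (Some (iQ ^+ 2 * f (- a), iQ ^+ 3 * f (- b))) by rewrite -ex -ey.
have [R eR] := scale_point_surj iQ_neq0 twist2 twist4 twist6 hP'.
exists R; apply: val_inj; rewrite /= -/(scale_coord f iQ (ecpoint_val R)).
by move/(congr1 val): eR => /= ->; rewrite -ex -ey.
Qed.

(** [2P = (P + conj P) + (P - conj P)], where conjugation fixes the first summand
    and changes the sign of the second. *)
Lemma double_split P : exists a b,
  [/\ P *+ 2 = inclusion a + twist b, inclusion a = P + conjugation P &
      twist b = P - conjugation P].
Proof.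
have [|a ea] := @conj_fixed_point (P + conjugation P).
  by rewrite raddfD conjugationK addrC.
have [|b eb] := @conj_opp_point (P - conjugation P).
  by rewrite raddfB conjugationK opprB.
exists a, b; split; [|exact: esym ea|exact: esym eb].
by rewrite -ea -eb addrACA subrr addr0 mulr2n.
Qed.

Lemma split_Qi : [/\ ec2 EK = - (f 0 + f (- twinA sigma p) + f (- twinB sigma q)),
  ec4 EK = f 0 * f (- twinA sigma p) + f 0 * f (- twinB sigma q)
    + f (- twinA sigma p) * f (- twinB sigma q)
  & ec6 EK = - (f 0 * f (- twinA sigma p) * f (- twinB sigma q))].
Proof.
have [e2 e4 e6] := twin_split sigma p_prime q_prime hpq.
rewrite -!rmorphM -!rmorphD -!rmorphN; split.
- by rewrite -e2.
- by rewrite -e4.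
- by rewrite -e6.
Qed.

Let root_Qi (e : rat) : wcubic (E sigma) e = 0 -> wcubic EK (f e) = 0.
Proof.
move=> he; transitivity (f (wcubic (E sigma) e)); last by rewrite he rmorph0.
by rewrite /wcubic /= !(rmorphD, rmorphM, rmorphXn).
Qed.

Let r0 := root_Qi (twin_root0 sigma p_prime q_prime hpq).
Let rA := root_Qi (twin_rootA sigma p_prime q_prime hpq).
Let rB := root_Qi (twin_rootB sigma p_prime q_prime hpq).

Lemma signed_prime_not_square_Qi l : prime l ->
  ~ is_square (f ((-1) ^+ sigma * l%:R)) /\ ~ is_square (f (- ((-1) ^+ sigma * l%:R))).
Proof.
move=> pl; have v : vodd l ((-1) ^+ sigma * l%:R) by rewrite /vodd (vrat_signed sigma pl pl) eqxx.
have vN : vodd l (- ((-1) ^+ sigma * l%:R)) by rewrite /vodd vratN.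
split=> /square_in_Qi[] /(vodd_square l); rewrite ?opprK ?v ?vN //.
Qed.

(** If [2P] had order two, the differences between its abscissa and the other roots
    would be squares; among them are [p] or [q] up to sign. *)
Lemma double_not_two_torsion (P : G) : P *+ 2 *+ 2 = 0 -> P *+ 2 = 0.
Proof.
have [e2 e4 e6] := split_Qi.
move=> /(two_torsion_mem e2 e4 e6 r0 rA rB).
have [->|[x [y [h ->]]]] := ecpointP P; first by rewrite mul0rn.
have [y0|y0] := eqVneq y 0; first by move=> _; apply/eqP; rewrite double_point_eq0 y0.
have [nA nA'] := signed_prime_not_square_Qi p_prime.
have [_ nB'] := signed_prime_not_square_Qi q_prime.
rewrite !inE => /or4P[/eqP //|/eqP e|/eqP e|/eqP e].
- case: nA; have := double_sub_root_square rA y0 e.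
  by rewrite -rmorphB sub0r opprK.
- case: nA'; have := double_sub_root_square r0 y0 e.
  by rewrite -rmorphB subr0.
- case: nB'; have := double_sub_root_square r0 y0 e.
  by rewrite -rmorphB subr0.
Qed.

(** The two summands of [2P] come from torsion points over [Q], which are killed
    by 2. *)
Lemma torsion_two_Qi (P : G) : P \in torsion (G:=G) -> P *+ 2 = 0.
Proof.
move=> /torsionP[n n0 Pn]; apply: double_not_two_torsion.
have [a [b [e ea eb]]] := double_split P.
have Pn' : conjugation P *+ n = 0 by rewrite -raddfMn Pn raddf0.
have a2 : a *+ 2 = 0.
  apply: (twin_torsion_two (sigma := sigma)).
  apply/torsionP; exists n; first by [].
  apply: inclusion_inj.
  by rewrite (raddfMn inclusion) (raddf0 inclusion) ea mulrnDl Pn Pn' addr0.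
have b2 : b *+ 2 = 0.
  apply: (twin_torsion_two (sigma := ~~ sigma)).
  apply/torsionP; exists n; first by [].
  apply: twist_inj.
  by rewrite (raddfMn twist) (raddf0 twist) eb mulrnBl Pn Pn' subr0.
by rewrite e mulrnDl -!raddfMn a2 b2 !raddf0 addr0.
Qed.

Lemma torsion_isog_Qi : zmod_isog (torsion_subgroup G) ('Z_2 * 'Z_2)%type.
Proof.
have [e2 e4 e6] := split_Qi.
exact: (torsion_klein_curve e2 e4 e6 r0 rA rB torsion_two_Qi).
Qed.

Lemma rank_Qi : exists r, has_rank G r /\ [/\ (r <= 3)%N,
  (p %% 8 = 5)%N -> r = 0%N & (p %% 8 = 3)%N -> (r <= 1)%N].
Proof.
have [e2 e4 e6] := split_Qi.
have doubles P : exists a b, P *+ 2 = inclusion a + twist b.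
  by have [a [b [e _ _]]] := double_split P; exists a, b.
have [fgp rkp] := plus_rank p_prime q_prime hpq.
have [fgm rkm] := minus_rank p_prime q_prime hpq.
have fg tau : fin_gen (ecpoint (E tau)) by case: tau.
have [|r hr] := @fin_gen_has_rank G.
  apply: (fin_gen_of_doubles (fg _) (fg _) doubles) => P.
  exact: (two_torsion_mem e2 e4 e6 r0 rA rB).
have [rp hrp] := fin_gen_has_rank fgp; have [rm hrm] := fin_gen_has_rank fgm.
have le : (r <= rp + rm)%N.
  move: inclusion twist doubles hr; case: (sigma) => inc tw doubles hr.
    by rewrite addnC; exact: (rank_le_of_doubles hrm hrp hr doubles).
  exact: (rank_le_of_doubles hrp hrm hr doubles).
have [p2 p0 p1] := rkp rp hrp; have [m1 m0 m0'] := rkm rm hrm.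
exists r; split; first exact: hr.
split.
- exact: leq_trans le (leq_add p2 m1).
- by move=> p5; rewrite (p0 p5) (m0 p5) leqn0 in le; apply/eqP.
- by move=> p3; rewrite (m0' p3) addn0 in le; exact: leq_trans le (p1 p3).
Qed.

Lemma nontorsion_Qi (P : ecpoint (E false)) : P *+ 2 != 0 ->
  exists R : G, R \notin torsion (G:=G).
Proof.
move=> P2.
suff [h hi] : exists h : {additive ecpoint (E false) -> G}, injective h.
  exists (h P); apply: contra P2 => /torsion_two_Qi; rewrite -raddfMn => e.
  by apply/eqP/hi; rewrite e raddf0.
move: inclusion inclusion_inj twist twist_inj; case: (sigma) => /= inc inci tw twi.
  by exists tw.
by exists inc.
Qed.

End OverQi.

Lemma twin_torsion_isog sigma (p q : nat) (p_prime : prime p) (q_prime : prime q)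
    (hpq : q = (p + 2)%N) :
  zmod_isog (torsion_subgroup (ecpoint (twin_curve sigma p_prime q_prime hpq)))
    ('Z_2 * 'Z_2)%type.
Proof.
have [e2 e4 e6] := twin_split sigma p_prime q_prime hpq.
exact: (torsion_klein_curve e2 e4 e6 (twin_root0 _ _ _ _) (twin_rootA _ _ _ _)
  (twin_rootB _ _ _ _) (@twin_torsion_two _ _ _ _ _ _)).
Qed.

Lemma rank_one (G : zmodType) r (x : G) :
  has_rank G r -> (r <= 1)%N -> x \notin torsion (G:=G) -> has_rank G 1.
Proof.
case: r => [|[|//]] // h0 _; by rewrite (has_rank0_torsion h0).
Qed.

Theorem theorem1 (p q : nat) (p_prime : prime p) (q_prime : prime q)
    (hpq : q = (p + 2)%N) :
  let E (sigma : bool) := twin_curve sigma p_prime q_prime hpq in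
  let pythagorean_shift :=
    exists (a b c : int) (epsilon delta : bool),
      (q%:Z = a ^+ 2 + b ^+ 2) /\
      ((a + (-1) ^+ epsilon) ^+ 2 + (b + (-1) ^+ delta) ^+ 2 = c ^+ 2) in
  [/\ (* (a) *)
      forall sigma : bool, (p = 5 %[mod 8])%N ->
        has_rank (points_Qi (E sigma)) 0 /\
        zmod_isog (points_Qi (E sigma)) ('Z_2 * 'Z_2)%type,
      (* (b) *)
      forall sigma : bool, (p = 3 %[mod 8])%N -> pythagorean_shift ->
        has_rank (points_Qi (E sigma)) 1 /\
        zmod_isog (points_Qi (E sigma)) ('Z_2 * 'Z_2 * int)%type,
      (* (c) *)
      forall sigma : bool,
        exists2 r : nat, has_rank (points_Qi (E sigma)) r & (r <= 3)%N
    & (* (d) *)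
      (p = 3 %[mod 8])%N -> pythagorean_shift ->
        has_rank (points_Q (E false)) 1 /\
        zmod_isog (points_Q (E false)) ('Z_2 * 'Z_2 * int)%type ].
Proof.
move=> E shift.
have nontorsion : shift -> exists P : ecpoint (E false), P *+ 2 != 0.
  by move=> [a [b [c [epsilon [delta [hq hc]]]]]]; exact: infinite_order_point hq hc.
split.
- move=> sigma p5; have [r [hr [_ r0 _]]] := rank_Qi sigma p_prime q_prime hpq.
  have h0 : has_rank (points_Qi (E sigma)) 0 by rewrite -(r0 p5).
  by split=> //; exact: has_rank0_isog h0 (torsion_isog_Qi _ _ _ _).
- move=> sigma p3 /nontorsion[P P2]; have [r [hr [_ _ r1]]] := rank_Qi sigma p_prime q_prime hpq.
  have [R Rt] := nontorsion_Qi sigma P2.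
  have h1 : has_rank (points_Qi (E sigma)) 1 := rank_one hr (r1 p3) Rt.
  by split=> //; exact: has_rank1_isog h1 (torsion_isog_Qi _ _ _ _).
- by move=> sigma; have [r [hr [r3 _ _]]] := rank_Qi sigma p_prime q_prime hpq; exists r.
- move=> p3 /nontorsion[P P2]; have [fg rk] := plus_rank p_prime q_prime hpq.
  have [r hr] := fin_gen_has_rank fg; have [_ _ r1] := rk r hr.
  have Pt : P \notin torsion (G:=ecpoint (E false)).
    by apply: contra P2 => /twin_torsion_two ->.
  have h1 : has_rank (points_Q (E false)) 1 := rank_one hr (r1 p3) Pt.
  by split=> //; exact: has_rank1_isog h1 (twin_torsion_isog _ _ _ _).
Qed.
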